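(* Consider $\mathbb{OP}^2=F_4/\mathrm{Spin}(9)$ with the $F_4$-invariant spin$^9$ structure determined by the double covering $\lambda_9:\mathrm{Spin}(9)\to\mathrm{SO}(9)$. A basis for the space of $F_4$-invariant $3$-twisted spin$^9$ spinors on $\mathbb{OP}^2$ is given by $$\psi_p=\sum_{k=0}^{18}\sum_{\ell=1}^{\mu_k}\bigl(\widehat{Y_{\mathcal I_{k,\ell}}.w_0}\bigr)^\sharp\otimes\bigl(Y_{\mathcal I_{k,\ell}}.w_p\bigr),\qquad p=1,2,3,4,$$ where $\sharp:\Sigma_{16}^*\to\Sigma_{16}$ is the musical isomorphism, $w_0$ is a highest weight vector of $\Sigma_{16}^-$, $w_p$ ($p=1,2,3,4$) are highest weight vectors for the four copies of $\Sigma_{16}^-$ inside $\Sigma_9^{\otimes3}$, the multi-indices $\mathcal I_{k,\ell}$ are those of the list in the context, and $\widehat{Y_{\mathcal I_{k,\ell}}.w_0}\in\Sigma_{16}^*$ is the dual map sending $Y_{\mathcal I_{k',\ell'}}.w_0\mapsto\delta_{k,k'}\delta_{\ell,\ell'}$ and $\Sigma_{16}^+\mapsto0$.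
   Context: Setting. The isotropy representation $\sigma$ of $F_4/\mathrm{Spin}(9)$ is the real $16$-dimensional spin representation of $\mathrm{Spin}(9)$ on $\mathfrak m\cong\mathbb R^{16}$. $\mathrm{Spin}^9(16)=(\mathrm{Spin}(16)\times\mathrm{Spin}(9))/\langle(-1,-1)\rangle$. The spin$^9$ structure is $F_4\times_{\phi_1}\mathrm{Spin}^9(16)$, with $\phi_1$ the unique lift of $\sigma\times\lambda_9:\mathrm{Spin}(9)\to\mathrm{SO}(16)\times\mathrm{SO}(9)$. Its invariant $3$-twisted spin$^9$ spinors are the elements of $\Sigma_{16}\otimes\Sigma_9^{\otimes3}$ fixed by $\mathrm{Spin}(9)$ acting via $\phi_1$, where $\Sigma_N$ is the complex spin representation of $\mathrm{Spin}(N)$. As $\mathfrak{spin}(9)^{\mathbb C}$-modules (via the spin lift $\widetilde\sigma$ of $\sigma$), $\Sigma_{16}=\Sigma_{16}^-\oplus\Sigma_{16}^+$ (half-spin spaces) with $\Sigma_{16}^-\simeq V(\omega_1+\omega_4)$ and $\Sigma_{16}^+\simeq V(\omega_3)\oplus V(2\omega_1)$, where $V(\mu)$ is the irreducible module of highest weight $\mu$ and $\omega_i$ are the fundamental weights of $\mathfrak{so}(9,\mathbb C)$; and $V(\omega_1+\omega_4)$ occurs in $\Sigma_9^{\otimes3}$ with multiplicity exactly $4$. The vectors $w_1,\dots,w_4$ are linearly independent highest weight vectors of weight $\omega_1+\omega_4$ in $\Sigma_9^{\otimes 3}$. The musical isomorphism $\sharp$ is that of a non-degenerate $\mathfrak{spin}(9)^{\mathbb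 C}$-invariant bilinear form on $\Sigma_{16}$, so it is an isomorphism of $\mathfrak{spin}(9)^{\mathbb C}$-modules. Lowering operators. View $\mathfrak{so}(9,\mathbb C)\cong\mathfrak{spin}(9)^{\mathbb C}$ as skew-symmetric $9\times9$ matrices; $E_{i,j}$ has $-1$ at $(i,j)$, $+1$ at $(j,i)$. Cartan subalgebra: spanned by $h_j=-{\rm i}E_{2j-1,2j}$, $j=1,\dots,4$, with dual basis $v_j$; simple roots $\alpha_1=v_1-v_2$, $\alpha_2=v_2-v_3$, $\alpha_3=v_3-v_4$, $\alpha_4=v_4$. Simple root vectors: $X_1=E_{1,3}+E_{2,4}+{\rm i}(-E_{2,3}+E_{1,4})$, $X_2=E_{3,5}+E_{4,6}+{\rm i}(-E_{4,5}+E_{3,6})$, $X_3=E_{5,7}+E_{6,8}+{\rm i}(-E_{6,7}+E_{5,8})$, $X_4=E_{7,9}-{\rm i}E_{8,9}$; lowering operators $Y_i=\overline{X_i}$ (complex conjugate matrix). For a multi-index $\mathcal I=\{i_1,\dots,i_k\}$ put $Y_{\mathcal I}=Y_{i_1}.Y_{i_2}.\cdots.Y_{i_k}$ (successive action, $Y_{i_k}$ first), $Y_\varnothing=\mathrm{Id}$. List of the multi-indices $\mathcal I_{k,\ell}$, $\ell=1,\dots,\mu_k$ (a digit string $i_1i_2\dots i_k$ stands for $\{i_1,\dots,i_k\}$; $\mu_k$ is the number of strings in row $k$; the vectors $Y_{\mathcal I_{k,\ell}}.w_0$ form a basis of $\Sigma_{16}^-$): $k=0$: $\varnothing$. $k=1$: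 1, 4. $k=2$: 21, 14, 34. $k=3$: 321, 214, 134, 234, 434. $k=4$: 4321, 3214, 2134, 4134, 1234, 4234. $k=5$: 34321, 44321, 23214, 43214, 12134, 42134, 41234, 34234. $k=6$: 234321, 434321, 344321, 444321, 123214, 423214, 412134, 342134, 341234, 434234. $k=7$: 1234321, 4234321, 4434321, 2344321, 4344321, 4123214, 3423214, 3412134, 4342134, 2341234, 4341234. $k=8$: 41234321, 34234321, 44234321, 34434321, 44434321, 12344321, 42344321, 34123214, 43423214, 23412134, 43412134, 42341234. $k=9$: 341234321, 441234321, 434234321, 344234321, 444234321, 234434321, 434434321, 412344321, 234123214, 434123214, 423412134, 342341234. $k=10$: 2341234321, 4341234321, 3441234321, 4441234321, 4434234321, 2344234321, 4344234321, 1234434321, 4234434321, 4234123214, 3423412134, 4342341234. $k=11$: 42341234321, 44341234321, 23441234321, 43441234321, 34434234321, 44434234321, 12344234321, 42344234321, 41234434321, 34234123214, 43423412134. $k=12$: 342341234321, 442341234321, 344341234321, 444341234321, 123441234321, 423441234321, 234434234321, 434434234321, 412344234321, 434234123214. $k=13$: 4342341234321, 3442341234321, 4442341234321, 2344341234321, 4344341234321, 4123441234321, 1234434234321, 4234434234321. $k=14$: 44342341234321, 23442341234321, 43442341234321, 12344341234321, 42344341234321, 41234434234321. $k=15$: 344342341234321, 444342341234321, 123442341234321, 423442341234321, 412344341234321. $k=16$: 2344342341234321, 4344342341234321, 4123442341234321. $k=17$: 12344342341234321, 42344342341234321. $k=18$: 412344342341234321. *)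

(* Defs.v *)
From HB Require Import structures.
From mathcomp Require Import all_boot all_order all_algebra.
From mathcomp Require Import reals.
From mathcomp Require Import complex mxtens.

Set Implicit Arguments.
Unset Strict Implicit.
Unset Printing Implicit Defensive.

Import Order.TTheory GRing.Theory Num.Theory.
Local Open Scope ring_scope.
Local Open Scope complex_scope.

Section Kronecker.
Variable K : pzRingType.

Definition kX : 'M[K]_2 := \matrix_(i, j) (i != j)%:R.
Definition kZ : 'M[K]_2 := \matrix_(i, j) ((-1) ^+ i * (i == j)%:R).
(* [[0, 1], [-1, 0]] *)
Definition kE : 'M[K]_2 := \matrix_(i, j) ((-1) ^+ i * (i != j)%:R).
Definition kI : 'M[K]_2 := 1%:M.

End Kronecker.

Arguments kX {K}.
Arguments kZ {K}.
Arguments kE {K}.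
Arguments kI {K}.

Section CliffordModules.
Variable R : realType.
Implicit Types (n d : nat).

Definition mxC n d (A : 'M[R]_(n, d)) : 'M[R[i]]_(n, d) :=
  map_mx (fun x => x%:C) A.

(* A complex Clifford module of R^n is a family c of matrices with
   c_i c_j + c_j c_i = -2 delta_ij; this is Clifford multiplication by a real
   vector. *)
Definition clifford_mul n d (c : 'I_n -> 'M[R[i]]_d) (v : 'cV[R]_n) : 'M_d :=
  \sum_i (v i 0)%:C *: c i.

(* Spin(n), as the image in GL(Sigma_n) of the even products of unit vectors;
   the complex spin representation is faithful on Spin(n). *)
Definition in_spin n d (c : 'I_n -> 'M[R[i]]_d) (g : 'M[R[i]]_d) : Prop :=
  exists vs : seq 'cV[R]_n,
    [/\ ~~ odd (size vs),
        forall v, v \in vs -> \sum_i v i 0 ^+ 2 = 1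
      & g = \prod_(v <- vs) clifford_mul c v].

(* lambda_n(g) = A, i.e. g v g^-1 = A v in the Clifford algebra *)
Definition lies_over n d (c : 'I_n -> 'M[R[i]]_d)
    (g : 'M[R[i]]_d) (A : 'M[R]_n) : Prop :=
  forall v : 'cV[R]_n,
    g *m clifford_mul c v = clifford_mul c (A *m v) *m g.

(* The differential of the spin representation on a skew-symmetric A, through
   the inverse of the differential of lambda_n, which is e_i e_j |-> 2 E_ij for
   the skew matrix E_ij with entry -1 at (i, j) and +1 at (j, i). *)
Definition spin_act n d (c : 'I_n -> 'M[R[i]]_d) (A : 'M[R[i]]_n) : 'M[R[i]]_d :=
  4%:R^-1 *: \sum_i \sum_j A j i *: (c i *m c j).

(* Nine anticommuting real symmetric matrices of square 1: the real spin
   representation of Spin(9) on R^16 is generated by their even products. *)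
Definition sigma_clifford (i : 'I_9) : 'M[R]_16 :=
  nth 0
    [:: kE *t kE *t kX *t kI;
        kE *t kE *t kE *t kE;
        kE *t kE *t kZ *t kI;
        kE *t kX *t kI *t kE;
        kE *t kI *t kE *t kX;
        kE *t kI *t kE *t kZ;
        kE *t kZ *t kI *t kE;
        kX *t kI *t kI *t kI;
        kZ *t kI *t kI *t kI] i.

(* Sigma_9 = C^16 is the complexification of R^16. *)
Definition cliff9 (i : 'I_9) : 'M[R[i]]_16 := 'i *: mxC (sigma_clifford i).

(* The elements of Spin(9) in GL(Sigma_9) are real matrices; sigma is their
   action on R^16. *)
Definition sigma (g : 'M[R[i]]_16) : 'M[R]_16 := map_mx (@complex.Re R) g.

Fixpoint spin_dim (m : nat) : nat :=
  if m is m'.+1 then (2 * spin_dim m')%N else 1%N.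

(* The complex Clifford module of R^(2m), of dimension 2^m *)
Fixpoint clifford_even (m : nat) : nat -> 'M[R[i]]_(spin_dim m) :=
  if m is m'.+1 then fun i =>
    if (i < m'.*2)%N then kZ *t clifford_even m' i
    else if i == m'.*2 then kE *t 1%:M
    else ('i *: kX) *t 1%:M
  else fun=> 0.

End CliffordModules.

Notation dim16 := (spin_dim 8).
Notation Sigma9 R := 'cV[R[i]]_16.
Notation Sigma16 R := 'cV[R[i]]_dim16.
Notation Sigma9x3 R := 'cV[R[i]]_(16 * 16 * 16).
Notation Spinors R := 'cV[R[i]]_(dim16 * (16 * 16 * 16)).

Section Spin9Spinors.
Variable R : realType.

Definition cliff16 (i : 'I_16) : 'M[R[i]]_dim16 := clifford_even R 8 i.

Definition volume16 : 'M[R[i]]_dim16 := \prod_(i < 16) cliff16 i.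

(* With this orientation of R^16 the half-spin space isomorphic to
   V(omega_1 + omega_4) is the eigenspace for -1. *)
Definition in_Sigma16_plus (v : Sigma16 R) : Prop := volume16 *m v = v.
Definition in_Sigma16_minus (v : Sigma16 R) : Prop := volume16 *m v = - v.

(* Equality of classes in (Spin(16) x Spin(9)) / <(-1, -1)> *)
Definition eq_spin9_16 (x y : 'M[R[i]]_dim16 * 'M[R[i]]_16) : Prop :=
  x = y \/ x = (- y.1, - y.2).

(* phi is a lift of sigma x lambda_9 to a homomorphism from Spin(9) to
   Spin^9(16); phi g is a representative of the class of the image of g. *)
Definition is_spin9_lift
    (phi : 'M[R[i]]_16 -> 'M[R[i]]_dim16 * 'M[R[i]]_16) : Prop :=
  (forall g, in_spin (@cliff9 R) g ->
     [/\ in_spin cliff16 (phi g).1, in_spin (@cliff9 R) (phi g).2,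
         lies_over cliff16 (phi g).1 (sigma g)
       & exists2 A, lies_over (@cliff9 R) g A
                  & lies_over (@cliff9 R) (phi g).2 A]) /\
  (forall g h, in_spin (@cliff9 R) g -> in_spin (@cliff9 R) h ->
     eq_spin9_16 (phi (g *m h))
       ((phi g).1 *m (phi h).1, (phi g).2 *m (phi h).2)).

(* The action of the class of (a, b) on the 3-twisted spinors is well defined
   since 3 is odd. *)
Definition invariant_spinor
    (phi : 'M[R[i]]_16 -> 'M[R[i]]_dim16 * 'M[R[i]]_16) (psi : Spinors R) : Prop :=
  forall g, in_spin (@cliff9 R) g ->
    ((phi g).1 *t ((phi g).2 *t (phi g).2 *t (phi g).2)) *m psi = psi.

Definition rho9 (A : 'M[R[i]]_9) : 'M[R[i]]_16 := spin_act (@cliff9 R) A.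

(* rho9 A is also the differential of sigma, so this is the differential of
   the spin lift of sigma. *)
Definition rho16 (A : 'M[R[i]]_9) : 'M[R[i]]_dim16 := spin_act cliff16 (rho9 A).

Definition rho9x3 (A : 'M[R[i]]_9) : 'M[R[i]]_(16 * 16 * 16) :=
  rho9 A *t 1%:M *t 1%:M + 1%:M *t rho9 A *t 1%:M + 1%:M *t 1%:M *t rho9 A.

(* Row and column numbers of elem start from 1. *)
Definition elem (i j : nat) : 'M[R[i]]_9 :=
  \matrix_(k, l) (((k.+1 == j) && (l.+1 == i))%:R
                  - ((k.+1 == i) && (l.+1 == j))%:R).

(* h_{j+1} *)
Definition cartan (j : 'I_4) : 'M[R[i]]_9 := - 'i *: elem j.*2.+1 j.*2.+2.

(* X_1, ..., X_4 *)
Definition raising (i : nat) : 'M[R[i]]_9 :=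
  match i with
  | 1 => elem 1 3 + elem 2 4 + 'i *: (- elem 2 3 + elem 1 4)
  | 2 => elem 3 5 + elem 4 6 + 'i *: (- elem 4 5 + elem 3 6)
  | 3 => elem 5 7 + elem 6 8 + 'i *: (- elem 6 7 + elem 5 8)
  | _ => elem 7 9 - 'i *: elem 8 9
  end.

Definition lowering (i : nat) : 'M[R[i]]_9 := map_mx (@conjc R) (raising i).

(* omega_1, ..., omega_4 in the basis (v_1, ..., v_4) dual to (h_1, ..., h_4):
   omega_i = v_1 + ... + v_i for i < 4, omega_4 = (v_1 + ... + v_4) / 2 *)
Definition fundamental_weight (i : nat) (j : 'I_4) : R[i] :=
  if i == 4%N then 2%:R^-1 else (j < i)%:R.

Definition highest_weight_vector d (rho : 'M[R[i]]_9 -> 'M[R[i]]_d)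
    (mu : 'I_4 -> R[i]) (v : 'cV[R[i]]_d) : Prop :=
  [/\ v != 0,
      forall i, (1 <= i <= 4)%N -> rho (raising i) *m v = 0
    & forall j, rho (cartan j) *m v = mu j *: v].

Definition weight_1_4 (j : 'I_4) : R[i] :=
  fundamental_weight 1 j + fundamental_weight 4 j.

(* Y_{i_1}.(Y_{i_2}.( ... Y_{i_k}.v)) *)
Definition lower d (rho : 'M[R[i]]_9 -> 'M[R[i]]_d) (I : seq nat)
    (v : 'cV[R[i]]_d) : 'cV[R[i]]_d :=
  foldr (fun i u => rho (lowering i) *m u) v I.

Definition invariant_form (B : 'M[R[i]]_dim16) : Prop :=
  forall A : 'M[R[i]]_9, A^T = - A -> (rho16 A)^T *m B + B *m rho16 A = 0.

(* Linear forms on Sigma16 are row vectors; sharp B f is the vector u such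
   that u^T *m B = f. *)
Definition sharp (B : 'M[R[i]]_dim16) (f : 'rV[R[i]]_dim16) : Sigma16 R :=
  (f *m invmx B)^T.

End Spin9Spinors.

(* Row k lists the multi-indices of length k. *)
Definition multi_index_table : seq (seq (seq nat)) :=
  [::
   [:: [::]];
   [:: [:: 1];
       [:: 4]];
   [:: [:: 2; 1];
       [:: 1; 4];
       [:: 3; 4]];
   [:: [:: 3; 2; 1];
       [:: 2; 1; 4];
       [:: 1; 3; 4];
       [:: 2; 3; 4];
       [:: 4; 3; 4]];
   [:: [:: 4; 3; 2; 1];
       [:: 3; 2; 1; 4];
       [:: 2; 1; 3; 4];
       [:: 4; 1; 3; 4];
       [:: 1; 2; 3; 4];
       [:: 4; 2; 3; 4]];
   [:: [:: 3; 4; 3; 2; 1];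
       [:: 4; 4; 3; 2; 1];
       [:: 2; 3; 2; 1; 4];
       [:: 4; 3; 2; 1; 4];
       [:: 1; 2; 1; 3; 4];
       [:: 4; 2; 1; 3; 4];
       [:: 4; 1; 2; 3; 4];
       [:: 3; 4; 2; 3; 4]];
   [:: [:: 2; 3; 4; 3; 2; 1];
       [:: 4; 3; 4; 3; 2; 1];
       [:: 3; 4; 4; 3; 2; 1];
       [:: 4; 4; 4; 3; 2; 1];
       [:: 1; 2; 3; 2; 1; 4];
       [:: 4; 2; 3; 2; 1; 4];
       [:: 4; 1; 2; 1; 3; 4];
       [:: 3; 4; 2; 1; 3; 4];
       [:: 3; 4; 1; 2; 3; 4];
       [:: 4; 3; 4; 2; 3; 4]];
   [:: [:: 1; 2; 3; 4; 3; 2; 1];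
       [:: 4; 2; 3; 4; 3; 2; 1];
       [:: 4; 4; 3; 4; 3; 2; 1];
       [:: 2; 3; 4; 4; 3; 2; 1];
       [:: 4; 3; 4; 4; 3; 2; 1];
       [:: 4; 1; 2; 3; 2; 1; 4];
       [:: 3; 4; 2; 3; 2; 1; 4];
       [:: 3; 4; 1; 2; 1; 3; 4];
       [:: 4; 3; 4; 2; 1; 3; 4];
       [:: 2; 3; 4; 1; 2; 3; 4];
       [:: 4; 3; 4; 1; 2; 3; 4]];
   [:: [:: 4; 1; 2; 3; 4; 3; 2; 1];
       [:: 3; 4; 2; 3; 4; 3; 2; 1];
       [:: 4; 4; 2; 3; 4; 3; 2; 1];
       [:: 3; 4; 4; 3; 4; 3; 2; 1];
       [:: 4; 4; 4; 3; 4; 3; 2; 1];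
       [:: 1; 2; 3; 4; 4; 3; 2; 1];
       [:: 4; 2; 3; 4; 4; 3; 2; 1];
       [:: 3; 4; 1; 2; 3; 2; 1; 4];
       [:: 4; 3; 4; 2; 3; 2; 1; 4];
       [:: 2; 3; 4; 1; 2; 1; 3; 4];
       [:: 4; 3; 4; 1; 2; 1; 3; 4];
       [:: 4; 2; 3; 4; 1; 2; 3; 4]];
   [:: [:: 3; 4; 1; 2; 3; 4; 3; 2; 1];
       [:: 4; 4; 1; 2; 3; 4; 3; 2; 1];
       [:: 4; 3; 4; 2; 3; 4; 3; 2; 1];
       [:: 3; 4; 4; 2; 3; 4; 3; 2; 1];
       [:: 4; 4; 4; 2; 3; 4; 3; 2; 1];
       [:: 2; 3; 4; 4; 3; 4; 3; 2; 1];
       [:: 4; 3; 4; 4; 3; 4; 3; 2; 1];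
       [:: 4; 1; 2; 3; 4; 4; 3; 2; 1];
       [:: 2; 3; 4; 1; 2; 3; 2; 1; 4];
       [:: 4; 3; 4; 1; 2; 3; 2; 1; 4];
       [:: 4; 2; 3; 4; 1; 2; 1; 3; 4];
       [:: 3; 4; 2; 3; 4; 1; 2; 3; 4]];
   [:: [:: 2; 3; 4; 1; 2; 3; 4; 3; 2; 1];
       [:: 4; 3; 4; 1; 2; 3; 4; 3; 2; 1];
       [:: 3; 4; 4; 1; 2; 3; 4; 3; 2; 1];
       [:: 4; 4; 4; 1; 2; 3; 4; 3; 2; 1];
       [:: 4; 4; 3; 4; 2; 3; 4; 3; 2; 1];
       [:: 2; 3; 4; 4; 2; 3; 4; 3; 2; 1];
       [:: 4; 3; 4; 4; 2; 3; 4; 3; 2; 1];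
       [:: 1; 2; 3; 4; 4; 3; 4; 3; 2; 1];
       [:: 4; 2; 3; 4; 4; 3; 4; 3; 2; 1];
       [:: 4; 2; 3; 4; 1; 2; 3; 2; 1; 4];
       [:: 3; 4; 2; 3; 4; 1; 2; 1; 3; 4];
       [:: 4; 3; 4; 2; 3; 4; 1; 2; 3; 4]];
   [:: [:: 4; 2; 3; 4; 1; 2; 3; 4; 3; 2; 1];
       [:: 4; 4; 3; 4; 1; 2; 3; 4; 3; 2; 1];
       [:: 2; 3; 4; 4; 1; 2; 3; 4; 3; 2; 1];
       [:: 4; 3; 4; 4; 1; 2; 3; 4; 3; 2; 1];
       [:: 3; 4; 4; 3; 4; 2; 3; 4; 3; 2; 1];
       [:: 4; 4; 4; 3; 4; 2; 3; 4; 3; 2; 1];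
       [:: 1; 2; 3; 4; 4; 2; 3; 4; 3; 2; 1];
       [:: 4; 2; 3; 4; 4; 2; 3; 4; 3; 2; 1];
       [:: 4; 1; 2; 3; 4; 4; 3; 4; 3; 2; 1];
       [:: 3; 4; 2; 3; 4; 1; 2; 3; 2; 1; 4];
       [:: 4; 3; 4; 2; 3; 4; 1; 2; 1; 3; 4]];
   [:: [:: 3; 4; 2; 3; 4; 1; 2; 3; 4; 3; 2; 1];
       [:: 4; 4; 2; 3; 4; 1; 2; 3; 4; 3; 2; 1];
       [:: 3; 4; 4; 3; 4; 1; 2; 3; 4; 3; 2; 1];
       [:: 4; 4; 4; 3; 4; 1; 2; 3; 4; 3; 2; 1];
       [:: 1; 2; 3; 4; 4; 1; 2; 3; 4; 3; 2; 1];
       [:: 4; 2; 3; 4; 4; 1; 2; 3; 4; 3; 2; 1];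
       [:: 2; 3; 4; 4; 3; 4; 2; 3; 4; 3; 2; 1];
       [:: 4; 3; 4; 4; 3; 4; 2; 3; 4; 3; 2; 1];
       [:: 4; 1; 2; 3; 4; 4; 2; 3; 4; 3; 2; 1];
       [:: 4; 3; 4; 2; 3; 4; 1; 2; 3; 2; 1; 4]];
   [:: [:: 4; 3; 4; 2; 3; 4; 1; 2; 3; 4; 3; 2; 1];
       [:: 3; 4; 4; 2; 3; 4; 1; 2; 3; 4; 3; 2; 1];
       [:: 4; 4; 4; 2; 3; 4; 1; 2; 3; 4; 3; 2; 1];
       [:: 2; 3; 4; 4; 3; 4; 1; 2; 3; 4; 3; 2; 1];
       [:: 4; 3; 4; 4; 3; 4; 1; 2; 3; 4; 3; 2; 1];
       [:: 4; 1; 2; 3; 4; 4; 1; 2; 3; 4; 3; 2; 1];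
       [:: 1; 2; 3; 4; 4; 3; 4; 2; 3; 4; 3; 2; 1];
       [:: 4; 2; 3; 4; 4; 3; 4; 2; 3; 4; 3; 2; 1]];
   [:: [:: 4; 4; 3; 4; 2; 3; 4; 1; 2; 3; 4; 3; 2; 1];
       [:: 2; 3; 4; 4; 2; 3; 4; 1; 2; 3; 4; 3; 2; 1];
       [:: 4; 3; 4; 4; 2; 3; 4; 1; 2; 3; 4; 3; 2; 1];
       [:: 1; 2; 3; 4; 4; 3; 4; 1; 2; 3; 4; 3; 2; 1];
       [:: 4; 2; 3; 4; 4; 3; 4; 1; 2; 3; 4; 3; 2; 1];
       [:: 4; 1; 2; 3; 4; 4; 3; 4; 2; 3; 4; 3; 2; 1]];
   [:: [:: 3; 4; 4; 3; 4; 2; 3; 4; 1; 2; 3; 4; 3; 2; 1];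
       [:: 4; 4; 4; 3; 4; 2; 3; 4; 1; 2; 3; 4; 3; 2; 1];
       [:: 1; 2; 3; 4; 4; 2; 3; 4; 1; 2; 3; 4; 3; 2; 1];
       [:: 4; 2; 3; 4; 4; 2; 3; 4; 1; 2; 3; 4; 3; 2; 1];
       [:: 4; 1; 2; 3; 4; 4; 3; 4; 1; 2; 3; 4; 3; 2; 1]];
   [:: [:: 2; 3; 4; 4; 3; 4; 2; 3; 4; 1; 2; 3; 4; 3; 2; 1];
       [:: 4; 3; 4; 4; 3; 4; 2; 3; 4; 1; 2; 3; 4; 3; 2; 1];
       [:: 4; 1; 2; 3; 4; 4; 2; 3; 4; 1; 2; 3; 4; 3; 2; 1]];
   [:: [:: 1; 2; 3; 4; 4; 3; 4; 2; 3; 4; 1; 2; 3; 4; 3; 2; 1];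
       [:: 4; 2; 3; 4; 4; 3; 4; 2; 3; 4; 1; 2; 3; 4; 3; 2; 1]];
   [:: [:: 4; 1; 2; 3; 4; 4; 3; 4; 2; 3; 4; 1; 2; 3; 4; 3; 2; 1]]
  ].

Definition mu (k : nat) : nat := size (nth [::] multi_index_table k).

Definition multi_index (k l : nat) : seq nat :=
  nth [::] (nth [::] multi_index_table k) l.

Section BasisSpinors.
Variable R : realType.

(* eta k l is the linear form dual to the vector given by multi_index k l in
   the basis of Sigma16_minus, extended by 0 to Sigma16_plus. *)
Definition dual_forms (w0 : Sigma16 R)
    (eta : nat -> nat -> 'rV[R[i]]_dim16) : Prop :=
  forall k l, (k < 19)%N -> (l < mu k)%N ->
    (forall k' l', (k' < 19)%N -> (l' < mu k')%N ->
       eta k l *m lower (@rho16 R) (multi_index k' l') w0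
       = ((k == k') && (l == l'))%:R%:M) /\
    (forall v, in_Sigma16_plus v -> eta k l *m v = 0).

Definition psi (B : 'M[R[i]]_dim16) (eta : nat -> nat -> 'rV[R[i]]_dim16)
    (w : Sigma9x3 R) : Spinors R :=
  \sum_(k < 19) \sum_(l < mu k)
    sharp B (eta k l) *t lower (@rho9x3 R) (multi_index k l) w.

End BasisSpinors.

(* Main.v *)
(* Through the form B an element of Sigma_16 (x) Sigma_9^3 is a linear map X
   from Sigma_16 to Sigma_9^3. It is invariant if and only if X commutes with
   so(9). Indeed Spin(9) is generated by rotations in planes, and the rotation
   with cosine and sine c, s acts, up to sign, by a product of commuting factors
   c + s Q with Q^2 = -1, with derivative the sum of the Q. If
   c + i s = (3 + 4i) / 5, which is not a root of unity, a vector fixed up to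
   sign is annihilated by the derivative.

   An intertwiner X vanishes on Sigma_16^+, where the central element -1 of
   Spin(9) acts differently than on Sigma_9^3, and it is determined by the highest
   weight vector X w_0. In Sigma_9^3 the highest weight vectors of this weight are
   spanned by w_1, ..., w_4. Conversely, the Hermitian products of the vectors
   Y_I w depend only on the weight and the norm of the highest weight vector w.
   So Y_I w_0 |-> Y_I w_p is well defined, and it commutes with the raising and
   lowering operators. *)
From HB Require Import structures.
From mathcomp Require Import all_boot all_order all_algebra.
From mathcomp Require Import reals complex mxtens.
From mathcomp Require Import ring lra zify.
Require Import Defs.

Set Implicit Arguments.
Unset Strict Implicit.
Unset Printing Implicit Defensive.

Import Order.TTheory GRing.Theory Num.Theory.
Local Open Scope ring_scope.

(** * Kronecker products and Clifford families *)

(** The lift [phi] is an arbitrary map, known at each element only through what it lies over; no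
    continuity is assumed, so it cannot be differentiated. Its values are pinned down one rotation
    at a time: by Schur's lemma an element over a given rotation is unique up to a scalar, and an
    invariant bilinear form reduces the scalar to a sign. The factors c + s Q arise because the
    product of two of the nine Clifford generators acts on R^16 as a signed permutation of square
    -1, so its spin lift is an explicit product over eight planes. For invariance only planes
    through the ninth axis are treated: they already generate Spin(9) and so(9).

    That w_1, ..., w_4 span comes from the 27 coordinates of weight omega_1 + omega_4 in Sigma_9^3:
    the raising equations leave at most four of them free. That the 128 vectors Y_I w_0 span
    Sigma_16^- is obtained without a determinant of that size: dual forms give independence, and
    Clifford multiplication by one vector exchanges Sigma_16^+ and Sigma_16^-, which bounds the
    dimension. *)

Section Tensor.
Variable F : comPzRingType.

Lemma tensmxDl m n p q (A B : 'M[F]_(m, n)) (C : 'M[F]_(p, q)) :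
  (A + B) *t C = A *t C + B *t C.
Proof. by apply/matrixP=> i j; rewrite !mxE mulrDl. Qed.

Lemma tensmxDr m n p q (A : 'M[F]_(m, n)) (B C : 'M[F]_(p, q)) :
  A *t (B + C) = A *t B + A *t C.
Proof. by apply/matrixP=> i j; rewrite !mxE mulrDr. Qed.

Lemma tensmxZl m n p q a (A : 'M[F]_(m, n)) (C : 'M[F]_(p, q)) :
  (a *: A) *t C = a *: (A *t C).
Proof. by apply/matrixP=> i j; rewrite !mxE mulrA. Qed.

Lemma tensmxZr m n p q a (A : 'M[F]_(m, n)) (C : 'M[F]_(p, q)) :
  A *t (a *: C) = a *: (A *t C).
Proof. by apply/matrixP=> i j; rewrite !mxE mulrCA. Qed.

Lemma tensmxNl m n p q (A : 'M[F]_(m, n)) (C : 'M[F]_(p, q)) :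
  (- A) *t C = - (A *t C).
Proof. by rewrite -scaleN1r tensmxZl scaleN1r. Qed.

Lemma tensmxNr m n p q (A : 'M[F]_(m, n)) (C : 'M[F]_(p, q)) :
  A *t (- C) = - (A *t C).
Proof. by rewrite -scaleN1r tensmxZr scaleN1r. Qed.

Lemma tensmx11 m n : (1%:M : 'M[F]_m) *t (1%:M : 'M[F]_n) = 1%:M.
Proof.
apply/matrixP=> i j; case: (mxtens_indexP i)=> i0 i1.
case: (mxtens_indexP j)=> j0 j1; rewrite tensmxE !mxE -natrM mulnb.
by rewrite (can_eq (@mxtens_indexK _ _)) xpair_eqE.
Qed.

Lemma tensmx_suml m n p q (I : Type) (r : seq I) (P : pred I)
    (A : I -> 'M[F]_(m, n)) (C : 'M[F]_(p, q)) :
  (\sum_(i <- r | P i) A i) *t C = \sum_(i <- r | P i) A i *t C.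
Proof.
apply: (big_morph (fun M => M *t C)); last exact: tens0mx.
by move=> A' B'; rewrite tensmxDl.
Qed.

(** A vector of the tensor product read as a matrix; [A *t B] then acts by [X |-> A X B^T]. This is
    what turns spinors into linear maps. *)
Definition unvec m n (x : 'cV[F]_(m * n)) : 'M[F]_(m, n) :=
  \matrix_(i, j) x (mxtens_index (i, j)) 0.

Lemma unvec_inj m n : injective (@unvec m n).
Proof.
move=> x y /matrixP xy; apply/colP=> k; case: (mxtens_indexP k)=> i j.
by have := xy i j; rewrite !mxE.
Qed.

Lemma unvec_linear m n : linear (@unvec m n).
Proof. by move=> a x y; apply/matrixP=> i j; rewrite !mxE. Qed.

HB.instance Definition _ m n :=
  GRing.isLinear.Build F 'cV[F]_(m * n) 'M[F]_(m, n) _ (@unvec m n)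
    (@unvec_linear m n).

Lemma unvec_tens m n m' n' (A : 'M[F]_(m', m)) (B : 'M[F]_(n', n)) x :
  unvec ((A *t B) *m x) = A *m unvec x *m B^T.
Proof.
apply/matrixP=> i j; rewrite !mxE.
transitivity (\sum_k \sum_l A i k * B j l * x (mxtens_index (k, l)) 0).
  rewrite pair_big /= (reindex (@mxtens_index m n)) /=; last first.
    by exists (@mxtens_unindex m n)=> k _; rewrite (mxtens_indexK, mxtens_unindexK).
  by apply: eq_bigr=> -[k l] _; rewrite tensmxE.
rewrite exchange_big; apply: eq_bigr=> l _; rewrite !mxE mulr_suml.
by apply: eq_bigr=> k _; rewrite !mxE mulrAC.
Qed.

Lemma unvec_tens_col m n (u : 'cV[F]_m) (v : 'cV[F]_n) :
  unvec (u *t v : 'cV[F]_(m * n)) = u *m v^T.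
Proof.
apply/matrixP=> i j; rewrite !mxE big_ord1 !mxE !mxtens_indexK /=.
by congr (u i _ * v j _); exact: ord1.
Qed.

End Tensor.

Definition skew (F : pzRingType) n (A : 'M[F]_n) : Prop := A^T = - A.

Section Skew.
Variables (F : comPzRingType) (n : nat).
Implicit Types A B : 'M[F]_n.

Lemma skewD A B : skew A -> skew B -> skew (A + B).
Proof. by rewrite /skew raddfD /= opprD => -> ->. Qed.

Lemma skewN A : skew A -> skew (- A).
Proof. by rewrite /skew raddfN /= => ->. Qed.

Lemma skewZ a A : skew A -> skew (a *: A).
Proof. by rewrite /skew linearZ => /= ->; rewrite scalerN. Qed.

End Skew.

Section Clifford.
Variables (K : fieldType) (n d : nat).
Variable c : 'I_n -> 'M[K]_d.

Definition is_clifford : Prop :=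
  forall i j, c i * c j + c j * c i = (- (i == j)%:R *+ 2)%:M.

Definition cliff_vec (v : 'cV[K]_n) : 'M[K]_d := \sum_i v i 0 *: c i.

Lemma cliff_vec_linear : linear cliff_vec.
Proof.
move=> a u v; rewrite /cliff_vec scaler_sumr -big_split /=.
by apply: eq_bigr=> i _; rewrite !mxE scalerDl scalerA.
Qed.

HB.instance Definition _ :=
  GRing.isLinear.Build K 'cV[K]_n 'M[K]_d _ cliff_vec cliff_vec_linear.

Lemma cliff_vec_delta i : cliff_vec (delta_mx i 0) = c i.
Proof.
rewrite /cliff_vec (bigD1 i) //= mxE !eqxx scale1r big1 ?addr0 // => j ji.
by rewrite mxE (negPf ji) scale0r.
Qed.

Hypothesis c_clifford : is_clifford.

Lemma clifford_anti i j : i != j -> c i * c j = - (c j * c i).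
Proof.
move=> ij; apply/eqP; rewrite -subr_eq0 opprK c_clifford (negPf ij).
by rewrite oppr0 mul0rn -scalemx1 scale0r.
Qed.

End Clifford.

Section CliffordChar0.
Variables (K : numFieldType) (n d : nat).
Variable c : 'I_n -> 'M[K]_d.
Hypothesis c_clifford : is_clifford c.

Lemma clifford_sqr i : c i * c i = - 1.
Proof.
have := c_clifford i i; rewrite eqxx -mulr2n -scaler_nat => /eqP.
rewrite -[X in _ == X]scalemx1 -[X in X *: 1%:M]mulr_natl -scalerA.
rewrite (inj_eq (scalerI _)) ?pnatr_eq0 // => /eqP->.
by rewrite scaleN1r.
Qed.

Lemma clifford_sqrK i (M : 'M[K]_d) : c i * (c i * M) = - M.
Proof. by rewrite mulrA clifford_sqr mulN1r. Qed.

(** The commutator equals [c_i {c_j, c_k} - {c_i, c_k} c_j], and anticommutators of generators are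
    scalars. *)
Lemma commutator_cliff_pair i j k :
  c i * c j * c k - c k * (c i * c j) =
  (i == k)%:R *+ 2 *: c j - (j == k)%:R *+ 2 *: c i.
Proof.
transitivity (c i * (c j * c k + c k * c j) - (c i * c k + c k * c i) * c j).
  by rewrite mulrDr mulrDl !mulrA opprD addrA addrK.
rewrite !c_clifford -!mulmxE mul_mx_scalar mul_scalar_mx.
by rewrite !mulNrn !scaleNr opprK addrC.
Qed.

End CliffordChar0.

Definition adjmx (R : realType) m n (A : 'M[R[i]]_(m, n)) : 'M[R[i]]_(n, m) :=
  (map_mx (@conjc R) A)^T.

Section Adjoint.
Variable R : realType.
Implicit Types m n p q : nat.

Lemma adjmxD m n (A B : 'M[R[i]]_(m, n)) : adjmx (A + B) = adjmx A + adjmx B.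
Proof. by rewrite /adjmx map_mxD raddfD. Qed.

Lemma adjmxN m n (A : 'M[R[i]]_(m, n)) : adjmx (- A) = - adjmx A.
Proof. by rewrite /adjmx map_mxN raddfN. Qed.

Lemma adjmxZ m n a (A : 'M[R[i]]_(m, n)) :
  adjmx (a *: A) = conjc a *: adjmx A.
Proof. by rewrite /adjmx map_mxZ linearZ. Qed.

Lemma adjmxM m n p (A : 'M[R[i]]_(m, n)) (B : 'M_(n, p)) :
  adjmx (A *m B) = adjmx B *m adjmx A.
Proof. by rewrite /adjmx map_mxM trmx_mul. Qed.

Lemma adjmx1 n : adjmx (1%:M : 'M[R[i]]_n) = 1%:M.
Proof. by rewrite /adjmx map_mx1 trmx1. Qed.

Lemma adjmx_sum m n (I : Type) (r : seq I) (P : pred I)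
    (A : I -> 'M[R[i]]_(m, n)) :
  adjmx (\sum_(i <- r | P i) A i) = \sum_(i <- r | P i) adjmx (A i).
Proof.
apply: (big_morph (@adjmx R m n)); first exact: adjmxD.
by rewrite /adjmx map_mx0 trmx0.
Qed.

Lemma adjmxK m n (A : 'M[R[i]]_(m, n)) : adjmx (adjmx A) = A.
Proof. by apply/matrixP=> i j; rewrite !mxE conjcK. Qed.

Lemma adjmx_tens m n p q (A : 'M[R[i]]_(m, n)) (B : 'M_(p, q)) :
  adjmx (A *t B) = adjmx A *t adjmx B.
Proof. by rewrite /adjmx (map_mxT (@conjc R)) trmx_tens. Qed.

(** Definiteness of the standard Hermitian form, which lets linear relations be read off from
    norms. *)
Lemma adjmx_mul_eq0 n (u : 'cV[R[i]]_n) : (adjmx u *m u == 0) = (u == 0).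
Proof.
apply/eqP/eqP=> [/matrixP/(_ 0 0)|->]; last by rewrite mulmx0.
rewrite !mxE => u0; apply/colP=> i; rewrite mxE.
have {}u0: \sum_j (`|u j 0| ^+ 2) = 0 :> R[i].
  by rewrite -[RHS]u0; apply: eq_bigr=> j _; rewrite !mxE sqr_normc mulrC.
move/eqP: u0; rewrite psumr_eq0 => [/allP/(_ i)|j _]; last exact: exprn_ge0.
by rewrite mem_index_enum sqrf_eq0 normr_eq0 => /(_ isT)/eqP.
Qed.

End Adjoint.

Section SpinAction.
Variables (R : realType) (n d : nat).
Variable c : 'I_n -> 'M[R[i]]_d.
Implicit Types A B : 'M[R[i]]_n.

Lemma spin_act_linear : linear (spin_act c).
Proof.
move=> a A B; rewrite /spin_act scalerA mulrC -scalerA -scalerDr; congr (_ *: _).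
rewrite scaler_sumr -big_split; apply: eq_bigr=> i _ /=.
rewrite scaler_sumr -big_split; apply: eq_bigr=> j _ /=.
by rewrite !mxE scalerDl scalerA.
Qed.

HB.instance Definition _ :=
  GRing.isLinear.Build R[i] 'M[R[i]]_n 'M[R[i]]_d _ (spin_act c) spin_act_linear.

Lemma adjmx_spin_act A :
  (forall i, adjmx (c i) = - c i) -> adjmx (spin_act c A) = spin_act c (adjmx A).
Proof.
move=> cN; rewrite /spin_act adjmxZ exchange_big fmorphV rmorph_nat /=; congr (_ *: _).
rewrite adjmx_sum; apply: eq_bigr=> i _; rewrite adjmx_sum; apply: eq_bigr=> j _.
by rewrite adjmxZ adjmxM !cN mulNmx mulmxN opprK !mxE.
Qed.

Hypothesis c_clifford : is_clifford c.

(** The two sums over a Kronecker delta are equal by skewness and carry a factor 2 each; this is the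
    4 in the definition of [spin_act]. Thus [spin_act] inverts the differential of lambda_n. *)
Lemma spin_act_cliff A k : skew A ->
  spin_act c A * c k - c k * spin_act c A = cliff_vec c (col k A).
Proof.
move=> skA; have Aji i j : A j i = - A i j.
  by have /matrixP/(_ i j) := skA; rewrite !mxE.
rewrite /spin_act -!mulmxE -scalemxAl -scalemxAr -scalerBr.
transitivity (4%:R^-1 *: \sum_i \sum_j (A j i *: ((i == k)%:R *+ 2 *: c j)
                                   - A j i *: ((j == k)%:R *+ 2 *: c i))).
  rewrite mulmx_suml mulmx_sumr -sumrB; congr (_ *: _); apply: eq_bigr=> i _.
  rewrite mulmx_suml mulmx_sumr -sumrB; apply: eq_bigr=> j _.
  by rewrite -scalemxAl -scalemxAr -!scalerBr !mulmxE commutator_cliff_pair.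
under eq_bigr do rewrite sumrB; rewrite sumrB /=.
rewrite (bigD1 k) //= [X in _ + X - _]big1 ?addr0 => [|i /negPf ik]; last first.
  by apply: big1=> j _; rewrite ik mul0rn scale0r scaler0.
rewrite [X in _ - X]exchange_big [X in _ - X](bigD1 k) //= [X in _ - (_ + X)]big1 ?addr0; last first.
  by move=> i /negPf ik; apply: big1=> j _; rewrite ik mul0rn scale0r scaler0.
rewrite eqxx -sumrB scaler_sumr; apply: eq_bigr=> i _.
rewrite mxE (Aji i k) !scaleNr opprK !scalerA -scalerDl scalerA; congr (_ *: _).
have n4 : 4%:R != 0 :> R[i] by rewrite pnatr_eq0.
by rewrite -mulrDr mulrCA -[_ + _](natrD _ 2 2) mulVf ?mulr1.
Qed.

(** Commutation with [spin_act c A] is a derivation that sends [c_k] to the combination of the [c_l]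
    with coefficients [A l k]. Applied to the quadratic expression for B, it turns the coefficients
    into those of the commutator. *)
Lemma spin_act_bracket A B : skew A -> skew B ->
  spin_act c (A *m B - B *m A) =
  spin_act c A * spin_act c B - spin_act c B * spin_act c A.
Proof.
move=> skA skB; set rA := spin_act c A; have cE k : rA *m c k = c k *m rA + \sum_l A l k *: c l.
  have := spin_act_cliff k skA; rewrite -!mulmxE => /eqP; rewrite subr_eq => /eqP->.
  by rewrite addrC; congr (_ + _); apply: eq_bigr=> l _; rewrite mxE.
have -> : spin_act c B = 4%:R^-1 *: \sum_i \sum_j B j i *: (c i *m c j) by [].
move: rA cE => rA cE; rewrite -!mulmxE -scalemxAl -scalemxAr -scalerBr.
rewrite mulmx_suml mulmx_sumr -sumrB [LHS]/spin_act; congr (_ *: _).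
transitivity (\sum_i \sum_j B j i *: ((\sum_l A l i *: c l) *m c j
                                 + c i *m (\sum_l A l j *: c l))); last first.
  apply: eq_bigr=> i _; rewrite mulmx_suml mulmx_sumr -sumrB; apply: eq_bigr=> j _.
  rewrite -scalemxAl -scalemxAr -scalerBr; congr (_ *: _).
  rewrite mulmxA cE mulmxDl -[c i *m rA *m _]mulmxA (cE j) mulmxDr mulmxA.
  by rewrite [RHS]addrC !addrA addNr add0r addrC.
have Aji i j : A j i = - A i j.
  by have /matrixP/(_ i j) := skA; rewrite !mxE.
transitivity (\sum_i \sum_j (- (B *m A) j i + (A *m B) j i) *: (c i *m c j)).
  by apply: eq_bigr=> i _; apply: eq_bigr=> j _; rewrite !mxE addrC.
under eq_bigr do under eq_bigr do rewrite scalerDl.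
under [RHS]eq_bigr do under eq_bigr do rewrite scalerDr.
under eq_bigr do rewrite big_split; under [RHS]eq_bigr do rewrite big_split.
rewrite !big_split /=; congr (_ + _).
  rewrite exchange_big [RHS]exchange_big /=; apply: eq_bigr=> j _.
  under [RHS]eq_bigr do rewrite mulmx_suml scaler_sumr.
  rewrite exchange_big; apply: eq_bigr=> l _; rewrite mxE -sumrN scaler_suml.
  by apply: eq_bigr=> i _; rewrite -scalemxAl scalerA (Aji i l) mulrN.
apply: eq_bigr=> i _.
under [RHS]eq_bigr do rewrite mulmx_sumr scaler_sumr.
rewrite exchange_big; apply: eq_bigr=> l _; rewrite mxE scaler_suml.
by apply: eq_bigr=> j _; rewrite -scalemxAr scalerA mulrC.
Qed.

End SpinAction.

(** * Explicit matrices *)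

(* Matrices of Gaussian integers stored as lists of rows, so that identities
   between the explicit matrices of the paper can be checked by evaluation. *)
Definition gint : Type := (int * int)%type.
Definition gmx : Type := seq (seq gint).

Definition gadd (x y : gint) : gint := (x.1 + y.1, x.2 + y.2).
Definition gmul (x y : gint) : gint :=
  (x.1 * y.1 - x.2 * y.2, x.1 * y.2 + x.2 * y.1).
Definition gconj (x : gint) : gint := (x.1, - x.2).

Definition gget (A : gmx) i j : gint := nth (0, 0) (nth [::] A i) j.
Definition gtab m n (f : nat -> nat -> gint) : gmx :=
  mkseq (fun i => mkseq (f i) n) m.

Definition gaddmx m n (A B : gmx) : gmx :=
  gtab m n (fun i j => gadd (gget A i j) (gget B i j)).
Definition gscalemx m n a (A : gmx) : gmx :=
  gtab m n (fun i j => gmul a (gget A i j)).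
(** The matrices are sparse, so each sum runs over the nonzero entries of the row only, which keeps
    evaluation short. *)
Definition gmulmx m n p (A B : gmx) : gmx :=
  gtab m p (fun i =>
    let support := [seq k <- iota 0 n | gget A i k != (0, 0)] in
    fun j => foldr (fun k s => gadd (gmul (gget A i k) (gget B k j)) s) (0, 0) support).
Definition gtensmx m n p q (A B : gmx) : gmx :=
  gtab (m * p) (n * q) (fun i j =>
    gmul (gget A (i %/ p) (j %/ q)) (gget B (i %% p) (j %% q))).
Definition gtrmx m n (A : gmx) : gmx := gtab m n (fun i j => gget A j i).
Definition gconjmx m n (A : gmx) : gmx :=
  gtab m n (fun i j => gconj (gget A i j)).
Definition gsubmx m n (A B : gmx) : gmx := gaddmx m n A (gscalemx m n (-1, 0) B).
Definition gcommutator n (A B : gmx) : gmx :=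
  gsubmx n n (gmulmx n n n A B) (gmulmx n n n B A).
Definition geq m n (A B : gmx) : bool :=
  all (fun i => all (fun j => gget A i j == gget B i j) (iota 0 n)) (iota 0 m).

Section GaussianMatrices.
Variable R : realType.
Local Notation C := R[i].

Definition emb (x : gint) : C := Complex x.1%:~R x.2%:~R.

Lemma embD x y : emb (gadd x y) = emb x + emb y.
Proof. by rewrite /emb /gadd /= !rmorphD. Qed.

Lemma embM x y : emb (gmul x y) = emb x * emb y.
Proof. by rewrite /emb /gmul /= rmorphB rmorphD !rmorphM. Qed.

Lemma emb_conj x : emb (gconj x) = conjc (emb x).
Proof. by rewrite /emb /gconj /= rmorphN. Qed.

Lemma emb_int (k : int) : emb (k, 0) = k%:~R.
Proof. by rewrite -[RHS](rmorph_int (@real_complex_def R (Phant R))). Qed.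

Definition gmat m n (A : gmx) : 'M[C]_(m, n) := \matrix_(i, j) emb (gget A i j).

Lemma gget_tab m n f (i : 'I_m) (j : 'I_n) : gget (gtab m n f) i j = f i j.
Proof. by rewrite /gget /gtab !nth_mkseq. Qed.

Lemma gmatD m n A B : gmat m n A + gmat m n B = gmat m n (gaddmx m n A B).
Proof. by apply/matrixP=> i j; rewrite !mxE gget_tab embD. Qed.

Lemma gmatZ m n a A : emb a *: gmat m n A = gmat m n (gscalemx m n a A).
Proof. by apply/matrixP=> i j; rewrite !mxE gget_tab embM. Qed.

Lemma gmatB m n A B : gmat m n A - gmat m n B = gmat m n (gsubmx m n A B).
Proof. by rewrite -gmatD -gmatZ emb_int scaleN1r. Qed.

Lemma gmatM m n p A B : gmat m n A *m gmat n p B = gmat m p (gmulmx m n p A B).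
Proof.
apply/matrixP=> i j; rewrite !mxE gget_tab /=.
have -> (s : seq nat) : emb (foldr (fun k s => gadd (gmul (gget A i k) (gget B k j)) s)
    (0, 0) s) = \sum_(k <- s) emb (gget A i k) * emb (gget B k j).
  elim: s => [|k s IH] /=; first by rewrite big_nil emb_int.
  by rewrite big_cons embD embM IH.
rewrite big_filter [RHS]big_mkcond -[n in iota 0 n]subn0 big_mkord.
apply: eq_bigr=> k _; rewrite !mxE; case: eqP => //= ->.
by rewrite emb_int mul0r.
Qed.

Lemma gmat_comm n A B :
  gmat n n A *m gmat n n B - gmat n n B *m gmat n n A =
  gmat n n (gcommutator n A B).
Proof. by rewrite !gmatM gmatB. Qed.

Lemma gmat_tens m n p q A B :
  gmat m n A *t gmat p q B = gmat (m * p) (n * q) (gtensmx m n p q A B).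
Proof. by apply/matrixP=> i j; rewrite !mxE gget_tab embM. Qed.

Lemma gmat_tr m n A : (gmat n m A)^T = gmat m n (gtrmx m n A).
Proof. by apply/matrixP=> i j; rewrite !mxE gget_tab. Qed.

Lemma gmat_conj m n A : map_mx (@conjc R) (gmat m n A) = gmat m n (gconjmx m n A).
Proof. by apply/matrixP=> i j; rewrite !mxE gget_tab emb_conj. Qed.

Lemma geqP m n A B : geq m n A B -> gmat m n A = gmat m n B.
Proof.
move=> /allP AB; apply/matrixP=> i j; rewrite !mxE.
have io k (l : 'I_k) : val l \in iota 0 k by rewrite mem_iota ltn_ord.
by have /allP/(_ _ (io _ j))/eqP-> := AB _ (io _ i).
Qed.

End GaussianMatrices.

Definition gscalar n (a : gint) : gmx := gtab n n (fun i j => if i == j then a else (0, 0)).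

Definition gX : gmx := [:: [:: (0, 0); (1, 0)]; [:: (1, 0); (0, 0)]].
Definition gZ : gmx := [:: [:: (1, 0); (0, 0)]; [:: (0, 0); (-1, 0)]].
Definition gE : gmx := [:: [:: (0, 0); (1, 0)]; [:: (-1, 0); (0, 0)]].
Definition gI : gmx := gscalar 2 (1, 0).

Definition gtens4 (A B C D : gmx) : gmx :=
  gtensmx 8 8 2 2 (gtensmx 4 4 2 2 (gtensmx 2 2 2 2 A B) C) D.

Definition gcliff (i : nat) : gmx :=
  gscalemx 16 16 (0, 1)
    (nth [::]
      [:: gtens4 gE gE gX gI; gtens4 gE gE gE gE; gtens4 gE gE gZ gI;
          gtens4 gE gX gI gE; gtens4 gE gI gE gX; gtens4 gE gI gE gZ;
          gtens4 gE gZ gI gE; gtens4 gX gI gI gI; gtens4 gZ gI gI gI] i).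

Definition gelem (i j : nat) : gmx :=
  gtab 9 9 (fun k l => (((k.+1 == j) && (l.+1 == i) : nat)%:Z
                        - ((k.+1 == i) && (l.+1 == j) : nat)%:Z, 0)).

Definition grho_term (A : gmx) (i j : nat) (B : gmx) : gmx :=
  if gget A j i == (0, 0) then B else
  gaddmx 16 16 (gscalemx 16 16 (gget A j i) (gmulmx 16 16 16 (gcliff i) (gcliff j))) B.

(* Four times the spin representation *)
Definition grho (A : gmx) : gmx :=
  foldr (fun i B => foldr (grho_term A i) B (iota 0 9)) (gscalar 16 (0, 0)) (iota 0 9).

Definition graising (k : nat) : gmx :=
  let a := gaddmx 9 9 in let i := gscalemx 9 9 (0, 1) in
  let m := gscalemx 9 9 (-1, 0) in
  match k with
  | 1 => a (a (gelem 1 3) (gelem 2 4)) (i (a (m (gelem 2 3)) (gelem 1 4)))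
  | 2 => a (a (gelem 3 5) (gelem 4 6)) (i (a (m (gelem 4 5)) (gelem 3 6)))
  | 3 => a (a (gelem 5 7) (gelem 6 8)) (i (a (m (gelem 6 7)) (gelem 5 8)))
  | _ => gsubmx 9 9 (gelem 7 9) (i (gelem 8 9))
  end.

Definition glowering k := gconjmx 9 9 (graising k).
Definition gcartan (j : nat) := gscalemx 9 9 (0, -1) (gelem j.*2.+1 j.*2.+2).

Section ExplicitMatrices.
Variable R : realType.
Local Notation C := R[i].
Local Notation gmat := (@gmat R).

Lemma gmat_scalar n a : gmat n n (gscalar n a) = (emb R a)%:M.
Proof.
apply/matrixP=> i j; rewrite !mxE gget_tab -val_eqE.
by case: eqP => // _; rewrite emb_int.
Qed.

Lemma cliff9E i : cliff9 R i = gmat 16 16 (gcliff i).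
Proof.
have mxCE m n (A : 'M[R]_(m, n)) (B : gmx) :
    (forall i j, (A i j)%:C%C = emb R (gget B i j)) -> mxC A = gmat m n B.
  by move=> AB; apply/matrixP=> i' j; rewrite !mxE AB.
have EX : mxC (@kX R) = gmat 2 2 gX.
  by apply: mxCE; do 2![case=> [[|[|]] //= ?]]; rewrite mxE.
have EZ : mxC (@kZ R) = gmat 2 2 gZ.
  by apply: mxCE; do 2![case=> [[|[|]] //= ?]]; rewrite mxE /= ?mulr1 ?mulr0 //.
have EE : mxC (@kE R) = gmat 2 2 gE.
  by apply: mxCE; do 2![case=> [[|[|]] //= ?]]; rewrite mxE /= ?mulr1 ?mulr0 //.
have EI : mxC (@kI R) = gmat 2 2 gI.
  by rewrite gmat_scalar emb_int /mxC map_mx1.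
have tensE A B C' D (A' B' C'' D' : gmx) : mxC A = gmat 2 2 A' -> mxC B = gmat 2 2 B' ->
    mxC C' = gmat 2 2 C'' -> mxC D = gmat 2 2 D' ->
    mxC (A *t B *t C' *t D) = gmat 16 16 (gtens4 A' B' C'' D').
  move=> AE BE CE DE; rewrite /mxC.
  rewrite !(map_mxT (real_complex_def (Phant R))) -!/(mxC _) AE BE CE DE.
  by rewrite !gmat_tens.
rewrite /cliff9 /gcliff -gmatZ; congr (_ *: _).
case: i => [[|[|[|[|[|[|[|[|[|i]]]]]]]]] ?] //=; rewrite /sigma_clifford; exact: tensE.
Qed.

Lemma all_iotaP n (P : pred nat) : all P (iota 0 n) -> forall i : 'I_n, P i.
Proof. by move=> /allP PP i; apply: PP; rewrite mem_iota ltn_ord. Qed.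

Lemma cliff9_clifford : is_clifford (@cliff9 R).
Proof.
have chk : all (fun i => let A := gcliff i in all (fun j => let B := gcliff j in
    geq 16 16 (gaddmx 16 16 (gmulmx 16 16 16 A B) (gmulmx 16 16 16 B A))
      (gscalar 16 (if i == j then (-2, 0) else (0, 0)))) (iota 0 9)) (iota 0 9).
  by vm_compute.
move=> i j; rewrite !cliff9E -!mulmxE !gmatM gmatD.
rewrite (geqP _ (all_iotaP (all_iotaP chk i) j)) gmat_scalar -val_eqE {chk}.
case: (val i == val j); first by rewrite emb_int mulNrn.
by rewrite emb_int oppr0 mul0rn.
Qed.

Lemma cliff9_tr i : (cliff9 R i)^T = cliff9 R i.
Proof.
have chk : all (fun i => geq 16 16 (gtrmx 16 16 (gcliff i)) (gcliff i)) (iota 0 9).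
  by vm_compute.
by rewrite cliff9E gmat_tr (geqP _ (all_iotaP chk i)).
Qed.

Lemma adjmx_cliff9 i : adjmx (cliff9 R i) = - cliff9 R i.
Proof.
rewrite /adjmx {1}/cliff9 map_mxZ.
have -> : map_mx (@conjc R) (mxC (sigma_clifford R i)) = mxC (sigma_clifford R i).
  by apply/matrixP=> k l; rewrite !mxE conjc_real.
rewrite [X in X *: _](_ : _ = - 'i%C); last first.
  by apply/eqP; rewrite eq_complex /= oppr0 !eqxx.
by rewrite scaleNr raddfN /= -[_ *: mxC _]/(cliff9 R i) cliff9_tr.
Qed.

End ExplicitMatrices.

(** * Commutation relations and generators of so(9, C) *)

Section LieAlgebra.
Variable R : realType.
Local Notation C := R[i].
Local Notation gmat := (@gmat R).

Lemma elemE i j : elem R i j = gmat 9 9 (gelem i j).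
Proof.
apply/matrixP=> k l; rewrite !mxE gget_tab emb_int rmorphB /=.
by rewrite !pmulrn.
Qed.

Lemma raisingE k : raising R k = gmat 9 9 (graising k).
Proof.
have iE : 'i = emb R (0, 1) by rewrite -complexiE.
have NE A : - gmat 9 9 A = gmat 9 9 (gscalemx 9 9 (-1, 0) A).
  by rewrite -gmatZ emb_int scaleN1r.
case: k => [|[|[|[|k]]]];
  by rewrite /raising !elemE iE ?NE !(gmatD, gmatZ, gmatB).
Qed.

Lemma loweringE k : lowering R k = gmat 9 9 (glowering k).
Proof. by rewrite /lowering raisingE gmat_conj. Qed.

Lemma cartanE j : cartan R j = gmat 9 9 (gcartan j).
Proof.
rewrite /cartan elemE; have -> : - 'i = emb R (0, -1).
  by rewrite -complexiE; apply/eqP; rewrite eq_complex /= oppr0 mulrN1z !eqxx.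
by rewrite gmatZ.
Qed.

Lemma skew_elem i j : skew (elem R i j).
Proof. by apply/matrixP=> k l; rewrite !mxE opprB ![(l.+1 == _) && _]andbC. Qed.

Lemma range2P (P : nat -> nat -> bool) m n m' n' :
  all (fun i => all (P i) (iota m' n')) (iota m n) ->
  forall i j, (m <= i < m + n)%N -> (m' <= j < m' + n')%N -> P i j.
Proof.
move=> /allP PP i j im jm'.
by have /allP := PP i (etrans (mem_iota _ _ _) im); apply; rewrite mem_iota.
Qed.

(** Coefficients of [[X_k, Y_k]], which is [-4 (h_k - h_{k+1})] for k < 4 and [-2 h_4] for k = 4.
    These are negative multiples of the coroots because the adjoint of X_k is -Y_k. *)
Definition coroot (k : nat) (j : 'I_4) : int :=
  if k == 4%N then - 2 * (val j == 3%N)%:Z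
  else 4 * ((val j == k)%:Z - (j.+1 == k)%:Z).

Lemma raising_lowering k l : (1 <= k <= 4)%N -> (1 <= l <= 4)%N ->
  raising R k *m lowering R l - lowering R l *m raising R k =
  (k == l)%:R *: \sum_j (coroot k j)%:~R *: cartan R j.
Proof.
pose gsum (f : nat -> int) := gaddmx 9 9 (gaddmx 9 9 (gaddmx 9 9
  (gscalemx 9 9 (f 0%N, 0) (gcartan 0)) (gscalemx 9 9 (f 1%N, 0) (gcartan 1)))
  (gscalemx 9 9 (f 2%N, 0) (gcartan 2))) (gscalemx 9 9 (f 3%N, 0) (gcartan 3)).
pose co k (j : nat) : int := if k == 4%N then - 2 * (j == 3%N)%:Z
  else 4 * ((j == k)%:Z - (j.+1 == k)%:Z).
have /range2P chk : all (fun k => all (fun l => geq 9 9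
    (gcommutator 9 (graising k) (glowering l))
    (gscalemx 9 9 ((k == l)%:Z, 0) (gsum (co k)))) (iota 1 4)) (iota 1 4).
  by vm_compute.
move=> hk hl; rewrite raisingE loweringE gmat_comm.
move/geqP: (chk k l hk hl) => ->; rewrite -gmatZ emb_int -pmulrn.
rewrite -!gmatD -!gmatZ !emb_int; congr (_ *: _).
have sum4 (F : 'I_4 -> 'M[C]_9) : \sum_j F j = F 0 + F 1 + F (inord 2) + F ord_max.
  by rewrite !big_ord_recr big_ord0 /= add0r; congr (F _ + F _ + F _ + F _);
    apply: val_inj; rewrite /= ?inordK.
by rewrite sum4 !cartanE /gcartan -!gmatZ /coroot /= !inordK.
Qed.

(** The index j counts from 0. For k = 4 the second indicator is always 0, as it should be for
    alpha_4 = v_4. *)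
Definition root (k : nat) (j : 'I_4) : int := (j.+1 == k)%:Z - (val j == k)%:Z.

Lemma cartan_lowering k j : (1 <= k <= 4)%N ->
  cartan R j *m lowering R k - lowering R k *m cartan R j =
  - (root k j)%:~R *: lowering R k.
Proof.
have /range2P chk : all (fun k => all (fun j => geq 9 9
    (gcommutator 9 (gcartan j) (glowering k))
    (gscalemx 9 9 (- ((j.+1 == k)%:Z - (j == k)%:Z), 0) (glowering k)))
    (iota 0 4)) (iota 1 4).
  by vm_compute.
move=> hk; rewrite cartanE loweringE gmat_comm.
move/geqP: (chk k j hk (ltn_ord j)) => ->; rewrite -gmatZ emb_int.
by rewrite rmorphN.
Qed.

(** Hence the E_{i9} generate so(9), and only planes through the ninth axis are needed for
    invariance. *)
Lemma elem_bracket i j : (i < 8)%N -> (j < 8)%N -> i != j ->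
  elem R i.+1 j.+1 =
  elem R i.+1 9 *m elem R j.+1 9 - elem R j.+1 9 *m elem R i.+1 9.
Proof.
have /range2P chk : all (fun i => all (fun j => (i == j) || geq 9 9 (gelem i.+1 j.+1)
    (gcommutator 9 (gelem i.+1 9) (gelem j.+1 9))) (iota 0 8)) (iota 0 8).
  by vm_compute.
move=> hi hj ij; rewrite !elemE gmat_comm; apply: geqP.
by have := chk i j hi hj; rewrite (negPf ij).
Qed.

Lemma elemC i j : elem R j i = - elem R i j.
Proof. by apply/matrixP=> k l; rewrite !mxE opprB. Qed.

Lemma elemii i : elem R i i = 0.
Proof. by apply/matrixP=> k l; rewrite !mxE subrr. Qed.

Lemma skew_elemE (A : 'M[C]_9) : skew A ->
  A = \sum_(i < 9) \sum_(j < 9) (A j i / 2%:R) *: elem R i.+1 j.+1.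
Proof.
move=> skA; have Aji i j : A j i = - A i j.
  by have /matrixP/(_ i j) := skA; rewrite !mxE.
apply/matrixP=> k l; rewrite summxE.
have -> : \sum_(i < 9) (\sum_(j < 9) (A j i / 2%:R) *: elem R i.+1 j.+1) k l =
    \sum_i ((A k i / 2%:R) * (l == i)%:R - \sum_j (A j i / 2%:R) * ((k == i) && (l == j))%:R).
  apply: eq_bigr=> i _; rewrite summxE.
  transitivity (\sum_j ((A j i / 2%:R * ((k == j) && (l == i))%:R)
                        - (A j i / 2%:R) * ((k == i) && (l == j))%:R)).
    by apply: eq_bigr=> j _; rewrite !mxE mulrBr !eqSS !val_eqE.
  rewrite sumrB; congr (_ - _); rewrite (bigD1 k) //= eqxx big1 ?addr0 // => j jk.
  by rewrite eq_sym (negPf jk) mulr0.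
rewrite sumrB (bigD1 l) //= eqxx mulr1 big1 ?addr0 => [|i il]; last first.
  by rewrite eq_sym (negPf il) mulr0.
rewrite (bigD1 k) //= (bigD1 l) //= !eqxx mulr1 !big1 ?addr0.
- by rewrite (Aji k l) mulNr opprK; field.
- by move=> i ik; apply: big1=> j _; rewrite eq_sym (negPf ik) mulr0.
by move=> i il; rewrite [l == i]eq_sym (negPf il) mulr0.
Qed.

Lemma skew_raising k : skew (raising R k).
Proof.
by case: k => [|[|[|[|k]]]]; rewrite /raising; do ?[exact: skew_elem |
  apply: skewD | apply: skewN | apply: skewZ].
Qed.

Lemma skew_lowering k : skew (lowering R k).
Proof.
rewrite /lowering; have skr := skew_raising k; apply/matrixP=> i j; rewrite !mxE.
by have /matrixP/(_ i j) := skr; rewrite !mxE => ->; rewrite rmorphN.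
Qed.

Lemma skew_cartan j : skew (cartan R j).
Proof. exact/skewZ/skew_elem. Qed.

Section Generation.
Variable P : 'M[C]_9 -> Prop.
Hypothesis P_lin : forall a A B, P A -> P B -> P (a *: A + B).
Hypothesis P_bracket : forall A B, skew A -> skew B -> P A -> P B -> P (A *m B - B *m A).

Lemma gen0 A : P A -> P 0.
Proof. by move=> PA; rewrite -[0](addNr A) -scaleN1r; apply: P_lin. Qed.

Lemma genZ a A : P A -> P (a *: A).
Proof. by move=> PA; rewrite -[_ *: _]addr0; apply: P_lin => //; apply: gen0 PA. Qed.

Lemma gen_elem9 : (forall i, (i < 8)%N -> P (elem R i.+1 9)) -> forall A, skew A -> P A.
Proof.
move=> P9 A skA; have P0 : P 0 by apply: gen0 (P9 0%N _).
have PD B D : P B -> P D -> P (B + D) by move=> PB PD; rewrite -[B]scale1r; apply: P_lin.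
rewrite (skew_elemE skA); apply: (big_ind P) => // i _; apply: (big_ind P) => // j _.
apply: genZ; have [->|ij] := eqVneq i j; first by rewrite elemii.
have [i8|i8] := ltnP i 8; have [j8|j8] := ltnP j 8.
- by rewrite elem_bracket //; apply: P_bracket; try exact: skew_elem; exact: P9.
- have -> : j = 8%N :> nat by apply/eqP; rewrite eqn_leq j8 -ltnS ltn_ord.
  exact: P9.
- have -> : i = 8%N :> nat by apply/eqP; rewrite eqn_leq i8 -ltnS ltn_ord.
  by rewrite elemC -scaleN1r; apply/genZ/P9.
- case/eqP: ij; apply: val_inj; apply/eqP.
  by rewrite eqn_leq !(leq_trans _ i8, leq_trans _ j8) // -ltnS ltn_ord.
Qed.

(* [E_{79}, E_{89}] come from X_4 and Y_4; bracketing them with X_k and Y_k for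
   k = 3, 2, 1 gives the other E_{j9}. *)
Lemma gen_raising_lowering :
  (forall k, (1 <= k <= 4)%N -> P (raising R k) /\ P (lowering R k)) ->
  forall A, skew A -> P A.
Proof.
move=> PXY; apply: gen_elem9.
have P0 : P 0 by apply: gen0 (PXY 1%N isT).1.
have lin2 a b A B : P A -> P B -> P (a *: A + b *: B).
  by move=> PA PB; apply: P_lin => //; apply: genZ.
have half (A : gmx) a (i j : nat) : (a != 0)%R -> P (gmat 9 9 A) ->
    geq 9 9 A (gscalemx 9 9 (a, 0) (gelem i j)) -> P (elem R i j).
  move=> a0 PA /geqP AE; have <- : a%:~R^-1 *: gmat 9 9 A = elem R i j.
    by rewrite AE -gmatZ emb_int elemE scalerA mulVf ?scale1r ?intr_eq0.
  exact: genZ.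
have P78 : P (elem R 7 9) /\ P (elem R 8 9).
  have [] := PXY 4%N isT; rewrite raisingE loweringE => PX PY.
  split; [pose a := (1, 0) : gint; pose b := (1, 0) : gint
         |pose a := (0, 1) : gint; pose b := (0, -1) : gint];
    (have := lin2 (emb R a) (emb R b) _ _ PX PY; rewrite !gmatZ gmatD => PZ;
     by apply: (half _ 2%:Z _ _ isT PZ); vm_compute).
have step k : (1 <= k < 1 + 3)%N -> P (elem R k.*2.+1 9) ->
    P (elem R k.*2.-1 9) /\ P (elem R k.*2 9).
  have /allP chk : all (fun k => geq 9 9
      (gaddmx 9 9 (gscalemx 9 9 (1, 0) (gcommutator 9 (graising k) (gelem k.*2.+1 9)))
                  (gscalemx 9 9 (1, 0) (gcommutator 9 (glowering k) (gelem k.*2.+1 9))))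
        (gscalemx 9 9 (-2, 0) (gelem k.*2.-1 9)) &&
      geq 9 9 (gaddmx 9 9
          (gscalemx 9 9 (0, 1) (gcommutator 9 (graising k) (gelem k.*2.+1 9)))
          (gscalemx 9 9 (0, -1) (gcommutator 9 (glowering k) (gelem k.*2.+1 9))))
        (gscalemx 9 9 (-2, 0) (gelem k.*2 9))) (iota 1 3) by vm_compute.
  move=> k3 PE; have /andP[chk1 chk2] := chk k (etrans (mem_iota _ _ _) k3).
  have k4 : (1 <= k <= 4)%N by case/andP: k3 => -> /ltnW.
  have [PX PY] := PXY k k4.
  have {PX} := P_bracket (skew_raising k) (skew_elem _ _) PX PE.
  have {PY} := P_bracket (skew_lowering k) (skew_elem _ _) PY PE.
  rewrite raisingE loweringE elemE !gmat_comm => PY PX.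
  split; [have := lin2 (emb R (1, 0)) (emb R (1, 0)) _ _ PX PY
         |have := lin2 (emb R (0, 1)) (emb R (0, -1)) _ _ PX PY];
    rewrite !gmatZ gmatD => PZ; [exact: (half _ (- 2%:Z) _ _ isT PZ chk1) | exact: (half _ (- 2%:Z) _ _ isT PZ chk2)].
have P56 := step 3%N isT P78.1; have P34 := step 2%N isT P56.1.
have P12 := step 1%N isT P34.1.
case=> [|[|[|[|[|[|[|[|i]]]]]]]] // _.
- exact: P12.1. - exact: P12.2. - exact: P34.1. - exact: P34.2.
- exact: P56.1. - exact: P56.2. - exact: P78.1. - exact: P78.2.
Qed.

End Generation.
End LieAlgebra.

(** * The Clifford module of R^16 *)

Section EvenClifford.
Variable R : realType.
Local Notation C := R[i].

Lemma conjc_im : conjc 'i = - 'i :> C.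
Proof. by rewrite -complexiE; apply/eqP; rewrite eq_complex /= oppr0 !eqxx. Qed.

Lemma kXX : (kX : 'M[C]_2) *m kX = 1%:M.
Proof.
apply/matrixP=> i j; rewrite !mxE !big_ord_recl big_ord0 !mxE.
by case: i j => [[|[|]] //= ?] [[|[|]] //= ?]; rewrite ?(mulr0, mulr1, addr0, add0r).
Qed.

Lemma kZZ : (kZ : 'M[C]_2) *m kZ = 1%:M.
Proof.
apply/matrixP=> i j; rewrite !mxE !big_ord_recl big_ord0 !mxE.
case: i j => [[|[|]] //= ?] [[|[|]] //= ?];
  by rewrite ?(mulr0, mulr1, mul0r, addr0, add0r, expr1, mulrNN).
Qed.

Lemma kEE : (kE : 'M[C]_2) *m kE = - 1%:M.
Proof.
apply/matrixP=> i j; rewrite !mxE !big_ord_recl big_ord0 !mxE.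
case: i j => [[|[|]] //= ?] [[|[|]] //= ?];
  by rewrite ?(mulr0, mulr1, mul0r, mul1r, addr0, add0r, expr1, oppr0).
Qed.

Lemma kZE : (kZ : 'M[C]_2) *m kE = - (kE *m kZ).
Proof.
apply/matrixP=> i j; rewrite !mxE !big_ord_recl !big_ord0 !mxE.
case: i j => [[|[|]] //= ?] [[|[|]] //= ?];
  by rewrite ?(mulr0, mulr1, mul0r, mul1r, addr0, add0r, expr1, oppr0, mulrNN, opprK).
Qed.

Lemma kZX : (kZ : 'M[C]_2) *m kX = - (kX *m kZ).
Proof.
apply/matrixP=> i j; rewrite !mxE !big_ord_recl !big_ord0 !mxE.
case: i j => [[|[|]] //= ?] [[|[|]] //= ?];
  by rewrite ?(mulr0, mulr1, mul0r, mul1r, addr0, add0r, expr1, oppr0, mulrNN, opprK).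
Qed.

Lemma kEX : (kE : 'M[C]_2) *m kX = - (kX *m kE).
Proof.
apply/matrixP=> i j; rewrite !mxE !big_ord_recl !big_ord0 !mxE.
case: i j => [[|[|]] //= ?] [[|[|]] //= ?];
  by rewrite ?(mulr0, mulr1, mul0r, mul1r, addr0, add0r, expr1, oppr0, mulrNN, opprK).
Qed.

Lemma trmx_kX : (kX : 'M[C]_2)^T = kX.
Proof. by apply/matrixP=> i j; rewrite !mxE eq_sym. Qed.

Lemma trmx_kZ : (kZ : 'M[C]_2)^T = kZ.
Proof.
apply/matrixP=> i j; rewrite !mxE [j == i]eq_sym.
by have [->|] := eqVneq i j; rewrite ?mulr0.
Qed.

Lemma trmx_kE : (kE : 'M[C]_2)^T = - kE.
Proof.
apply/matrixP=> i j; rewrite !mxE.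
by case: i j => [[|[|]] //= ?] [[|[|]] //= ?]; rewrite ?(mulr0, mulr1, expr1, oppr0, opprK).
Qed.

Lemma conj_kX : map_mx (@conjc R) kX = kX.
Proof. by apply/matrixP=> i j; rewrite !mxE rmorph_nat. Qed.

Lemma conj_kZ : map_mx (@conjc R) kZ = kZ.
Proof. by apply/matrixP=> i j; rewrite !mxE rmorphM rmorph_nat rmorphXn rmorphN1. Qed.

Lemma conj_kE : map_mx (@conjc R) kE = kE.
Proof. by apply/matrixP=> i j; rewrite !mxE rmorphM rmorph_nat rmorphXn rmorphN1. Qed.

Lemma clifford_evenS m i : (i < m.*2)%N ->
  clifford_even R m.+1 i = kZ *t clifford_even R m i.
Proof. by move=> /= ->. Qed.

Lemma clifford_even_pen m : clifford_even R m.+1 m.*2 = kE *t 1%:M.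
Proof. by rewrite /= ltnn eqxx. Qed.

Lemma clifford_even_last m i : (m.*2 < i)%N ->
  clifford_even R m.+1 i = 'i *: (kX *t 1%:M).
Proof.
move=> mi /=; rewrite ltnNge (ltnW mi) /= gtn_eqF // -tensmxZl.
by rewrite -complexiE.
Qed.

(** [kZ] squares to 1 and anticommutes with [kE] and [kX]: the old generators keep their relations
    and anticommute with the two new ones, for which [kE^2 = -1] and [(i kX)^2 = -1]. *)
Lemma clifford_even_clifford m i j : (i < m.*2)%N -> (j < m.*2)%N ->
  clifford_even R m i *m clifford_even R m j
  + clifford_even R m j *m clifford_even R m i = (- (i == j)%:R *+ 2)%:M.
Proof.
elim: m i j => [|m IH] i j //; rewrite doubleS.
wlog ij : i j / (i <= j)%N.
  move=> H hi hj; case: (leqP i j) => [|/ltnW] ij; first exact: H.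
  by rewrite addrC eq_sym H.
rewrite !ltnS leq_eqVlt => hi; rewrite leq_eqVlt => hj.
have scal a : a%:M = a *: (1%:M *t 1%:M) :> 'M[C]_(2 * spin_dim m).
  by rewrite tensmx11 scalemx1.
case/predU1P: hj ij => [->|hj] ij.
  rewrite (clifford_even_last (ltnSn _)); move: hi; rewrite ltnS => hi.
  case/predU1P: hi => [->|hi].
    rewrite (clifford_even_last (ltnSn _)) eqxx scal -!scalemxAl -!scalemxAr.
    rewrite !tensmx_mul kXX mulmx1 scalerA -expr2 sqrCi -scalerDl.
    by rewrite mulr2n.
  rewrite -scalemxAl -scalemxAr -scalerDr ltn_eqF 1?ltnS // oppr0 mul0rn scal scale0r.
  move: hi; rewrite leq_eqVlt => /predU1P[->|hi].
    by rewrite clifford_even_pen !tensmx_mul kEX tensmxNl mulmx1 addNr scaler0.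
  by rewrite clifford_evenS // !tensmx_mul kZX tensmxNl mulmx1 mul1mx addNr scaler0.
case/predU1P: hi => [ij'|hi].
  by move: ij; rewrite ij' leqNgt hj.
move: hj; rewrite ltnS leq_eqVlt => /predU1P[jm|hj].
  rewrite {}jm in ij *; rewrite clifford_even_pen; move: ij; rewrite leq_eqVlt.
  case/predU1P=> [->|im].
    rewrite eqxx clifford_even_pen !tensmx_mul kEE tensmxNl mulmx1 tensmx11.
    by rewrite -mulr2n -raddfN raddfMn.
  rewrite clifford_evenS // ltn_eqF // !tensmx_mul kZE tensmxNl mulmx1 mul1mx addNr.
  by rewrite oppr0 mul0rn scal scale0r.
have im := leq_ltn_trans ij hj.
rewrite !clifford_evenS // !tensmx_mul kZZ -tensmxDr IH //.
by rewrite scal -[X in _ *t X]scalemx1 tensmxZr.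
Qed.

Lemma adjmx_clifford_even m i : adjmx (clifford_even R m i) = - clifford_even R m i.
Proof.
elim: m i => [|m IH] i; first by rewrite /= oppr0 /adjmx map_mx0 trmx0.
rewrite /=; case: ifP => _; last case: ifP => _.
- by rewrite adjmx_tens IH tensmxNr /adjmx conj_kZ trmx_kZ.
- by rewrite adjmx_tens adjmx1 /adjmx conj_kE trmx_kE tensmxNl.
rewrite adjmx_tens adjmx1 adjmxZ conjc_im /adjmx conj_kX trmx_kX.
by rewrite scaleNr tensmxNl.
Qed.

Lemma cliff16_clifford : is_clifford (@cliff16 R).
Proof. by move=> i j; rewrite -!mulmxE clifford_even_clifford. Qed.

(* Transposition composed with conjugation by C is, up to sign, the reversal
   of the Clifford algebra. *)
Lemma clifford_even_transpose m : exists2 C0 : 'M[C]_(spin_dim m), C0 \in unitmx &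
  forall i, (i < m.*2)%N ->
  (clifford_even R m i)^T *m C0 = (-1) ^+ m *: (C0 *m clifford_even R m i).
Proof.
elim: m => [|m [C0 C0u IH]]; first by exists 1%:M; rewrite ?unitmx1.
(* [K] must give the sign [(-1)^(m+1)] with [kE] and [kX], and -1 with [kZ]; the parity of m decides
   which matrix does so. *)
pose K := if odd m then kX else kE : 'M[C]_2.
have s2 (a : C) : a ^+ 2 = 1 -> (a * a = 1) by rewrite expr2.
have Ku : K \in unitmx.
  rewrite /K; case: (odd m); first by case: (mulmx1_unit kXX).
  by case: (@mulmx1_unit _ _ (kE : 'M[C]_2) (- kE)) => //; rewrite mulmxN kEE opprK.
exists (K *t C0).
  by apply: tensmx_unit => //; elim: m {IH C0 C0u K Ku} => //= m; rewrite muln_eq0.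
have EK : (kE : 'M[C]_2)^T *m K = (-1) ^+ m.+1 *: (K *m kE).
  rewrite trmx_kE -signr_odd /= /K; case: (odd m) => /=.
    by rewrite expr0 scale1r mulNmx kEX opprK.
  by rewrite expr1 scaleN1r mulNmx.
have XK : (kX : 'M[C]_2)^T *m K = (-1) ^+ m.+1 *: (K *m kX).
  rewrite trmx_kX -signr_odd /= /K; case: (odd m) => /=.
    by rewrite expr0 scale1r.
  by rewrite expr1 scaleN1r kEX opprK.
have ZK : (kZ : 'M[C]_2)^T *m K = - (K *m kZ).
  by rewrite trmx_kZ /K; case: (odd m); rewrite ?kZX ?kZE.
move=> i; rewrite doubleS !ltnS leq_eqVlt => /predU1P[->|].
  rewrite (clifford_even_last (ltnSn _)) linearZ /= trmx_tens trmx1 -scalemxAl -scalemxAr.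
  by rewrite !tensmx_mul XK mul1mx mulmx1 tensmxZl !scalerA mulrC.
rewrite ltnS leq_eqVlt => /predU1P[->|im].
  by rewrite clifford_even_pen trmx_tens trmx1 !tensmx_mul EK mul1mx mulmx1 tensmxZl.
rewrite clifford_evenS // trmx_tens !tensmx_mul ZK IH // tensmxNl tensmxZr exprS.
by rewrite mulN1r scaleNr.
Qed.

End EvenClifford.

(** * Representations of so(9, C) and their tensor products *)

Lemma zmod_bracket (V : zmodType) (a b c d x y : V) :
  a + c + (d + x) - (b + d + (c + y)) = a - b + (x - y).
Proof.
have -> : a + c + (d + x) = (a + x) + (c + d) by rewrite [d + x]addrC addrACA.
have -> : b + d + (c + y) = (b + y) + (c + d) by rewrite [c + y]addrC addrACA [d + c]addrC.
by rewrite opprD [LHS]addrACA subrr addr0 opprD addrACA.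
Qed.

Section Representations.
Variable R : realType.
Local Notation C := R[i].
Implicit Types A B : 'M[C]_9.

(* A complex representation of so(9, C) that is unitary for the compact real
   form. *)
Definition so_rep d (rho : 'M[C]_9 -> 'M[C]_d) : Prop :=
  [/\ linear rho,
      forall A B, skew A -> skew B ->
        rho (A *m B - B *m A) = rho A *m rho B - rho B *m rho A
    & forall A, skew A -> adjmx (rho A) = rho (adjmx A)].

Definition tens_rep d e (rho : 'M[C]_9 -> 'M[C]_d) (tau : 'M[C]_9 -> 'M[C]_e) A :=
  rho A *t 1%:M + 1%:M *t tau A.

Lemma so_rep_tens d e (rho : 'M[C]_9 -> 'M[C]_d) (tau : 'M[C]_9 -> 'M[C]_e) :
  so_rep rho -> so_rep tau -> so_rep (tens_rep rho tau).
Proof.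
move=> [linr brr adr] [lint brt adt]; split.
- move=> a A B; rewrite /tens_rep linr lint tensmxDl tensmxDr tensmxZl tensmxZr.
  by rewrite scalerDr addrACA.
- move=> A B skA skB; rewrite /tens_rep brr // brt // !(mulmxDl, mulmxDr).
  rewrite !tensmx_mul !mul1mx !mulmx1 tensmxDl tensmxDr tensmxNl tensmxNr.
  (* The mixed terms [rho A *t tau B] and [rho B *t tau A] cancel. *)
  by rewrite zmod_bracket.
- move=> A skA; rewrite /tens_rep adjmxD !adjmx_tens !adjmx1.
  by rewrite adr // adt.
Qed.

Lemma rho9_rep : so_rep (@rho9 R).
Proof.
split; first exact: spin_act_linear.
  by move=> A B skA skB; apply: spin_act_bracket => //; exact: cliff9_clifford.
by move=> A _; apply: adjmx_spin_act; exact: adjmx_cliff9.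
Qed.

(** Symmetry of the [cliff9 R i] puts the image of [rho9] into so(16, C), so [rho16] is a
    composition of two Lie algebra homomorphisms. *)
Lemma skew_rho9 A : skew A -> skew (rho9 A).
Proof.
rewrite /skew => skA; rewrite /rho9 -[in RHS]scaleN1r -linearZ /= scaleN1r -skA.
rewrite /spin_act linearZ /=; congr (_ *: _); rewrite exchange_big linear_sum.
apply: eq_bigr=> i _; rewrite linear_sum; apply: eq_bigr=> j _.
by rewrite linearZ /= trmx_mul !cliff9_tr mxE.
Qed.

Lemma rho16_rep : so_rep (@rho16 R).
Proof.
have [lin9 br9 ad9] := rho9_rep; split.
- by move=> a A B; rewrite /rho16 lin9 spin_act_linear.
- move=> A B skA skB; rewrite /rho16 br9 // spin_act_bracket //.
  + exact: cliff16_clifford.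
  + exact: skew_rho9.
  + exact: skew_rho9.
- move=> A skA; rewrite /rho16 -ad9 //; apply: adjmx_spin_act.
  by move=> i; rewrite /cliff16 adjmx_clifford_even.
Qed.

Lemma rho9x3E A : rho9x3 A = tens_rep (tens_rep (@rho9 R) (@rho9 R)) (@rho9 R) A.
Proof. by rewrite /rho9x3 /tens_rep tensmxDl tensmx11. Qed.

Lemma rho9x3_rep : so_rep (@rho9x3 R).
Proof.
have [l b a] := so_rep_tens (so_rep_tens rho9_rep rho9_rep) rho9_rep.
split=> [x A B|A B skA skB|A skA]; rewrite !rho9x3E; first exact: l.
  exact: b.
exact: a.
Qed.

(** The adjoint is the transpose of the conjugate Y_k, and Y_k is skew. The sign reappears in the
    contravariant form. *)
Lemma adjmx_raising k : adjmx (raising R k) = - lowering R k.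
Proof. exact: skew_lowering. Qed.

Lemma adjmx_lowering k : adjmx (lowering R k) = - raising R k.
Proof. by rewrite -[lowering R k]opprK -adjmx_raising adjmxN adjmxK. Qed.

End Representations.

Section LinearProp.
Variables (K : pzRingType) (U V : lmodType K) (f : U -> V).
Hypothesis f_lin : linear f.

Lemma linear_prop0 : f 0 = 0.
Proof. by have := f_lin (-1) 0 0; rewrite scaler0 addr0 scaleN1r addNr. Qed.

Lemma linear_propZ a u : f (a *: u) = a *: f u.
Proof. by have := f_lin a u 0; rewrite linear_prop0 !addr0. Qed.

Lemma linear_propN u : f (- u) = - f u.
Proof. by rewrite -scaleN1r linear_propZ scaleN1r. Qed.

Lemma linear_propD u v : f (u + v) = f u + f v.
Proof. by have := f_lin 1 u v; rewrite !scale1r. Qed.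

Lemma linear_prop_sum (I : Type) (r : seq I) (P : pred I) (F : I -> U) :
  f (\sum_(i <- r | P i) F i) = \sum_(i <- r | P i) f (F i).
Proof. exact: (big_morph f linear_propD linear_prop0). Qed.

End LinearProp.

(** * Contravariant forms *)

Section Shapovalov.
Variable R : realType.
Local Notation C := R[i].

(** Outside 1, ..., 4 [raising] takes the default value X_4, and the commutation relations are
    stated in this range only. *)
Definition multi_index_ok (I : seq nat) : bool := all (fun i => 0 < i <= 4)%N I.

Definition lower_weight (mu : 'I_4 -> C) (I : seq nat) (j : 'I_4) : C :=
  mu j - \sum_(i <- I) (root i j)%:~R.

(* X_k Y_I w as a combination of vectors Y_J w, for any highest weight vector w
   of weight mu *)
Fixpoint raise_terms (mu : 'I_4 -> C) (k : nat) (I : seq nat) : seq (C * seq nat) :=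
  if I is i :: I' then
    [seq (t.1, i :: t.2) | t <- raise_terms mu k I'] ++
    nseq (k == i) (\sum_j (coroot k j)%:~R * lower_weight mu I' j, I')
  else [::].

(* The contravariant (Shapovalov) form on the Verma module of highest weight
   mu, normalised by its value 1 at the highest weight vector. *)
Fixpoint shapovalov (mu : 'I_4 -> C) (J I : seq nat) : C :=
  if J is j :: J' then
    - \sum_(t <- raise_terms mu j I) t.1 * shapovalov mu J' t.2
  else (I == [::])%:R.

Definition lower_comb d (rho : 'M[C]_9 -> 'M[C]_d) (p : seq (C * seq nat)) w :=
  \sum_(t <- p) t.1 *: lower rho t.2 w.

Lemma raise_terms_ok mu k I : multi_index_ok I ->
  all (fun t => multi_index_ok t.2) (raise_terms mu k I).
Proof.
elim: I => //= i I IH /andP[hi okI]; rewrite all_cat all_map /=; apply/andP; split.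
  by apply: sub_all (IH okI) => t /= ->; rewrite hi.
by rewrite all_nseq /= [multi_index_ok I]okI orbT.
Qed.

Section HighestWeight.
Variables (d : nat) (rho : 'M[C]_9 -> 'M[C]_d) (mu : 'I_4 -> C) (w : 'cV[C]_d).
Hypothesis rho_rep : so_rep rho.
Hypothesis w_highest : highest_weight_vector rho mu w.

Lemma so_rep_bracket A B : skew A -> skew B ->
  rho A *m rho B = rho B *m rho A + rho (A *m B - B *m A).
Proof. by move=> skA skB; have [_ -> //] := rho_rep; rewrite addrC subrK. Qed.

Lemma cartan_lower I j : multi_index_ok I ->
  rho (cartan R j) *m lower rho I w = lower_weight mu I j *: lower rho I w.
Proof.
have [lin br ad] := rho_rep; have [_ _ wh] := w_highest.
elim: I => [|i I IH] /=; first by rewrite /lower_weight big_nil subr0 wh.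
move=> /andP[hi okI]; rewrite mulmxA so_rep_bracket; last exact: skew_lowering.
  rewrite cartan_lowering // (linear_propZ lin _ (lowering R i)) mulmxDl -mulmxA IH //.
  rewrite -scalemxAr -scalemxAl -scalerDl /lower_weight big_cons opprD.
  by rewrite [- _ + _]addrC addrA.
exact: skew_cartan.
Qed.

(** Moving X_k past Y_i leaves [[X_k, Y_i]], which is 0 unless k = i and then acts by a scalar on a
    weight vector; at the end X_k kills w. Only the weight enters the coefficients. *)
Lemma raising_lower k I : (0 < k <= 4)%N -> multi_index_ok I ->
  rho (raising R k) *m lower rho I w = lower_comb rho (raise_terms mu k I) w.
Proof.
have [lin br ad] := rho_rep; have [_ wX _] := w_highest.
move=> hk; elim: I => [|i I IH] /=; first by rewrite wX // /lower_comb big_nil.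
move=> /andP[hi okI]; rewrite mulmxA so_rep_bracket.
- rewrite raising_lowering // mulmxDl -mulmxA IH // /lower_comb big_cat big_map /=.
  congr (_ + _).
    by rewrite mulmx_sumr; apply: eq_bigr=> t _; rewrite scalemxAr.
  case: eqP => /= [_|_]; last by rewrite scale0r (linear_prop0 lin) mul0mx big_nil.
  rewrite scale1r big_seq1 /= (linear_prop_sum lin) mulmx_suml scaler_suml.
  by apply: eq_bigr=> j _; rewrite (linear_propZ lin _ (cartan R j)) -scalemxAl cartan_lower // scalerA.
- exact: skew_raising.
exact: skew_lowering.
Qed.

(** Each Y_j of the left factor moves to the right as its adjoint -X_j. If J is exhausted before I,
    the product is 0, since the adjoint of Y_i kills w. *)
Lemma lower_gram J I : multi_index_ok J -> multi_index_ok I ->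
  adjmx (lower rho J w) *m lower rho I w = shapovalov mu J I *: (adjmx w *m w).
Proof.
have [lin br ad] := rho_rep; have [_ wX _] := w_highest.
elim: J I => [|j J IH] I /=.
  case: I => [|i I] _ /= okI; first by rewrite scale1r.
  have [hi _] := andP okI; rewrite scale0r mulmxA.
  rewrite -[rho _]adjmxK -adjmxM ad; last exact: skew_lowering.
  by rewrite adjmx_lowering (linear_propN lin) mulNmx wX // oppr0 /adjmx map_mx0 trmx0 mul0mx.
move=> /andP[hj okJ] okI; rewrite adjmxM -mulmxA ad; last exact: skew_lowering.
rewrite adjmx_lowering (linear_propN lin) mulNmx mulmxN raising_lower // scaleNr.
congr (- _); rewrite /lower_comb mulmx_sumr scaler_suml !big_seq.
apply: eq_bigr=> t tI; rewrite -scalemxAr IH ?scalerA //.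
by have /allP/(_ _ tI) := raise_terms_ok mu j okI.
Qed.

(** The squared norm of the combination is the double sum times the squared norm of w, and w is not
    0. *)
Lemma lower_comb_eq0 p : all (fun t => multi_index_ok t.2) p ->
  (lower_comb rho p w == 0) =
  (\sum_(s <- p) \sum_(t <- p) conjc s.1 * t.1 * shapovalov mu s.2 t.2 == 0).
Proof.
move=> /allP okp; have [w0 _ _] := w_highest.
rewrite -adjmx_mul_eq0 /lower_comb adjmx_sum mulmx_suml.
set S := \sum_(s <- p) _.
have -> : \sum_(s <- p) adjmx (s.1 *: lower rho s.2 w) *m
    (\sum_(t <- p) t.1 *: lower rho t.2 w) = S *: (adjmx w *m w).
  rewrite /S scaler_suml !big_seq; apply: eq_bigr=> s sp.
  rewrite mulmx_sumr scaler_suml !big_seq; apply: eq_bigr=> t tp.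
  by rewrite adjmxZ -scalemxAl -scalemxAr lower_gram ?okp // !scalerA.
by rewrite scaler_eq0 adjmx_mul_eq0 (negPf w0) orbF.
Qed.

End HighestWeight.

(* The Shapovalov form determines the norm of a combination of the Y_I w, and
   the norm is definite. *)
Lemma lower_comb_transfer d e (rho : 'M[C]_9 -> 'M[C]_d) (tau : 'M[C]_9 -> 'M[C]_e)
    mu v w p :
  so_rep rho -> so_rep tau ->
  highest_weight_vector rho mu v -> highest_weight_vector tau mu w ->
  all (fun t => multi_index_ok t.2) p ->
  lower_comb rho p v = 0 -> lower_comb tau p w = 0.
Proof.
move=> rrho rtau hv hw okp /eqP; rewrite (lower_comb_eq0 rrho hv okp).
by rewrite -(lower_comb_eq0 rtau hw okp) => /eqP.
Qed.

End Shapovalov.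

(** * Products of commuting complex structures *)

Section Torus.
Variables (R : realType) (N : nat).
Local Notation C := R[i].
Implicit Types (Q M : 'M[C]_N) (Qs : seq 'M[C]_N) (c s : C).

Definition torus_gen Qs : 'M[C]_N := \sum_(Q <- Qs) Q.
(** For commuting Q of square -1 and (c, s) = (cos t, sin t) this is the exponential of t times
    [torus_gen Qs], in algebraic form. *)
Definition torus_elt Qs c s : 'M[C]_N := \prod_(Q <- Qs) (c%:M + s *: Q).

Definition complex_structures Qs : Prop :=
  (forall Q, Q \in Qs -> Q * Q = -1) /\ (forall Q Q', Q \in Qs -> Q' \in Qs -> GRing.comm Q Q').

(* Pairs (m, P): P maps onto the common eigenspaces of Qs on which torus_gen is
   multiplication by m i. *)
Fixpoint torus_decomp Qs : seq (int * 'M[C]_N) :=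
  if Qs is Q :: Qs' then
    [seq (p.1 + 1, (2%:R^-1 *: (1 - 'i *: Q)) * p.2) | p <- torus_decomp Qs'] ++
    [seq (p.1 - 1, (2%:R^-1 *: (1 + 'i *: Q)) * p.2) | p <- torus_decomp Qs']
  else [:: (0, 1)].

Lemma commZ (a : C) M Q : GRing.comm M Q -> GRing.comm M (a *: Q).
Proof.
by move=> MQ; rewrite /GRing.comm -!mulmxE -scalemxAr -scalemxAl !mulmxE MQ.
Qed.

Lemma scalerMl (a : C) M Q : (a *: M) * Q = a *: (M * Q).
Proof. by rewrite -!mulmxE scalemxAl. Qed.

Lemma scalerMr (a : C) M Q : M * (a *: Q) = a *: (M * Q).
Proof. by rewrite -!mulmxE scalemxAr. Qed.

Lemma torus_decomp_sum Qs : \sum_(p <- torus_decomp Qs) p.2 = 1.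
Proof.
elim: Qs => [|Q Qs IH] /=; first by rewrite big_seq1.
rewrite big_cat !big_map /= -2!mulr_sumr IH 2!mulr1 -scalerDr addrACA addNr addr0.
have half2 : 2%:R^-1 + 2%:R^-1 = 1 :> C by field.
by rewrite scalerDr -scalerDl half2 scale1r.
Qed.

Lemma comm_torus_decomp Qs M p : (forall Q, Q \in Qs -> GRing.comm M Q) ->
  p \in torus_decomp Qs -> GRing.comm M p.2.
Proof.
elim: Qs p => [|Q Qs IH] p MQ /=; first by rewrite inE => /eqP->; apply: commr1.
have MQs Q' : Q' \in Qs -> GRing.comm M Q' by move=> Q'Qs; apply: MQ; rewrite inE Q'Qs orbT.
have {}MQ : GRing.comm M Q by apply: MQ; rewrite inE eqxx.
by rewrite mem_cat => /orP[] /mapP[q qp ->] /=; (apply: commrM; last exact: IH);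
  apply: commZ; [apply: commrB | apply: commrD]; try exact: commr1; exact: commZ.
Qed.

Lemma comm_torus_gen Qs M : (forall Q, Q \in Qs -> GRing.comm M Q) ->
  GRing.comm M (torus_gen Qs).
Proof.
move=> MQ; rewrite /torus_gen big_seq.
elim/big_rec: _ => [|Q D QQs MD]; first exact: commr0.
by apply: commrD => //; exact: MQ.
Qed.

Lemma comm_torus_elt Qs M c s : (forall Q, Q \in Qs -> GRing.comm M Q) ->
  GRing.comm M (torus_elt Qs c s).
Proof.
move=> MQ; rewrite /torus_elt big_seq.
elim/big_rec: _ => [|Q D QQs MD]; first exact: commr1.
apply: commrM => //; apply: commrD; last exact/commZ/MQ.
by rewrite /GRing.comm -!mulmxE scalar_mxC.
Qed.

Lemma complex_structures_cons Q Qs : complex_structures (Q :: Qs) ->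
  [/\ Q * Q = -1, forall Q', Q' \in Qs -> GRing.comm Q Q' & complex_structures Qs].
Proof.
move=> [sq cc]; split; first by apply: sq; rewrite inE eqxx.
  by move=> Q' Q'Qs; apply: cc; rewrite inE ?eqxx ?Q'Qs ?orbT.
split=> [Q' Q'Qs|Q' Q'' Q'Qs Q''Qs]; first by apply: sq; rewrite inE Q'Qs orbT.
by apply: cc; rewrite inE ?Q'Qs ?Q''Qs ?orbT.
Qed.

Lemma eigen_minus Q : Q * Q = -1 -> Q * (1 - 'i *: Q) = 'i *: (1 - 'i *: Q).
Proof.
move=> sqQ; rewrite mulrBr mulr1 scalerMr sqQ scalerBr scalerA -expr2 sqrCi.
by rewrite scalerN scaleN1r !opprK addrC.
Qed.

Lemma eigen_plus Q : Q * Q = -1 -> Q * (1 + 'i *: Q) = - 'i *: (1 + 'i *: Q).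
Proof.
move=> sqQ; rewrite mulrDr mulr1 scalerMr sqQ scalerDr scalerA mulNr -expr2 sqrCi.
by rewrite scalerN opprK scale1r scaleNr addrC.
Qed.

(** Both branches of the decomposition at once: [e] is the sign, and [E] projects onto the
    eigenspace of Q for [e i]. The last clause serves to move E past [torus_gen Qs] and
    [torus_elt Qs c s]. *)
Lemma torus_decomp_consP Q Qs p : complex_structures (Q :: Qs) ->
  p \in torus_decomp (Q :: Qs) ->
  exists2 q, q \in torus_decomp Qs & exists e E,
    [/\ e ^+ 2 = 1 :> int, p = (q.1 + e, E * q.2), Q * E = ('i * e%:~R) *: E,
       forall M, (forall Q', Q' \in Q :: Qs -> GRing.comm M Q') -> GRing.comm M E
     & forall M, (forall Q', Q' \in Qs -> GRing.comm M Q') -> GRing.comm M Q -> GRing.comm M E].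
Proof.
move=> /complex_structures_cons[sqQ cQ csQs] /=.
rewrite mem_cat => /orP[] /mapP[q qp ->] /=; exists q => //.
  exists 1, (2%:R^-1 *: (1 - 'i *: Q)); split=> //.
  - by rewrite scalerMr (eigen_minus sqQ) mulr1z mulr1 !scalerA [2%:R^-1 * _]mulrC.
  - move=> M MQ; apply/commZ/commrB; first exact: commr1.
    by apply/commZ/MQ; rewrite inE eqxx.
  - by move=> M _ MQ; apply/commZ/commrB; [exact: commr1 | apply/commZ].
exists (-1), (2%:R^-1 *: (1 + 'i *: Q)); split=> //.
- by rewrite scalerMr (eigen_plus sqQ) mulrN1z mulrN1 !scalerA [2%:R^-1 * _]mulrC.
- move=> M MQ; apply/commZ/commrD; first exact: commr1.
  by apply/commZ/MQ; rewrite inE eqxx.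
- by move=> M _ MQ; apply/commZ/commrD; [exact: commr1 | apply/commZ].
Qed.

Lemma torus_gen_decomp Qs p : complex_structures Qs -> p \in torus_decomp Qs ->
  torus_gen Qs * p.2 = ('i * p.1%:~R) *: p.2.
Proof.
elim: Qs p => [|Q Qs IH] p csQ.
  by rewrite inE => /eqP->; rewrite /torus_gen big_nil mul0r mulr0 scale0r.
have [_ cQ csQs] := complex_structures_cons csQ.
move=> /(torus_decomp_consP csQ)[q qQs [e [E [_ -> QE _ EM]]]] /=.
have DE : torus_gen Qs * E = E * torus_gen Qs.
  have QD := comm_torus_gen cQ.
  apply: EM; last exact: commr_sym.
  move=> Q' Q'Qs; apply/commr_sym/comm_torus_gen => Q'' Q''Qs.
  exact: csQs.2.
rewrite /torus_gen big_cons -/(torus_gen Qs) mulrDl mulrA QE mulrA DE -mulrA IH //.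
by rewrite scalerMl scalerMr -scalerDl -mulrDr -rmorphD addrC.
Qed.

Lemma unit_circle c s : c ^+ 2 + s ^+ 2 = 1 ->
  c + 'i * s != 0 /\ (c + 'i * s)^-1 = c - 'i * s.
Proof.
move=> cs1; have zz : (c + 'i * s) * (c - 'i * s) = 1.
  by rewrite mulrC -subr_sqr exprMn sqrCi mulN1r opprK.
have z0 : c + 'i * s != 0.
  by apply: contraTneq isT => z0; move/eqP: zz; rewrite z0 mul0r eq_sym oner_eq0.
by split=> //; rewrite -[LHS]mulr1 -zz mulKf.
Qed.

(** Where Q acts by i or -i, the factor c + s Q acts by z = c + i s or by c - i s, which is the
    inverse of z. *)
Lemma torus_elt_decomp Qs c s p : complex_structures Qs -> c ^+ 2 + s ^+ 2 = 1 ->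
  p \in torus_decomp Qs -> torus_elt Qs c s * p.2 = (c + 'i * s) ^ p.1 *: p.2.
Proof.
move=> csQs cs1; have [z0 zV] := unit_circle cs1.
elim: Qs csQs p => [|Q Qs IH] csQ p.
  by rewrite inE => /eqP->; rewrite /torus_elt big_nil mul1r expr0z scale1r.
have [_ cQ csQs] := complex_structures_cons csQ.
move=> /(torus_decomp_consP csQ)[q qQs [e [E [e1 -> QE _ EM]]]] /=.
have TE : torus_elt Qs c s * E = E * torus_elt Qs c s.
  have QD := comm_torus_elt c s cQ.
  apply: EM; last exact: commr_sym.
  move=> Q' Q'Qs; apply/commr_sym/comm_torus_elt => Q'' Q''Qs.
  exact: csQs.2.
have gE : (c%:M + s *: Q) * E = (c + 'i * s) ^ e *: E.
  rewrite mulrDl scalerMl QE -[c%:M * E]/(c%:M *m E) mul_scalar_mx scalerA -scalerDl.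
  congr (_ *: _); move/eqP: e1; rewrite sqrf_eq1 => /orP[] /eqP->.
    by rewrite mulr1 expr1z mulrC.
  by rewrite exprN1 zV mulrN1z mulrN1 mulrN mulrC.
rewrite /torus_elt big_cons -/(torus_elt Qs c s) -mulrA [torus_elt _ _ _ * _]mulrA TE.
rewrite -mulrA IH // mulrA gE !scalerMl scalerMr scalerA; congr (_ *: _).
by rewrite (expfzDr _ _ z0) [LHS]mulrC.
Qed.

(** Comparing eigenvalues of [torus_gen Qs], the components of y in the pieces other than m
    vanish. *)
Lemma torus_elt_eigen Qs c s (m : int) (y : 'cV[C]_N) :
  complex_structures Qs -> c ^+ 2 + s ^+ 2 = 1 ->
  torus_gen Qs *m y = ('i * m%:~R) *: y ->
  torus_elt Qs c s *m y = (c + 'i * s) ^ m *: y.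
Proof.
move=> csQs cs1 Dy; rewrite -[y in LHS]mul1mx -[y in RHS]mul1mx.
rewrite -[1%:M](torus_decomp_sum Qs) !mulmx_suml mulmx_sumr scaler_sumr.
rewrite !big_seq; apply: eq_bigr=> p pQs; rewrite mulmxA mulmxE torus_elt_decomp //.
rewrite -scalemxAl; have : torus_gen Qs *m (p.2 *m y) = p.2 *m (torus_gen Qs *m y).
  rewrite !mulmxA !mulmxE; congr (_ *m y); apply: (comm_torus_decomp _ pQs) => Q QQs.
  by apply/commr_sym/comm_torus_gen => Q' Q'Qs; apply: csQs.2.
rewrite mulmxA mulmxE torus_gen_decomp // Dy -scalemxAl -scalemxAr => /eqP.
rewrite -subr_eq0 -scalerBl scaler_eq0 => /orP[|/eqP->]; last by rewrite !scaler0.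
by rewrite -mulrBr mulf_eq0 (negPf (neq0Ci _)) subr_eq0 eqr_int => /eqP->.
Qed.

(** Being fixed by the square is what remains of being fixed up to sign. With z = c + i s, a nonzero
    component of y in the piece m satisfies [z^(2 m) = 1], so m = 0. *)
Lemma torus_gen_eq0 Qs c s (y : 'cV[C]_N) :
  complex_structures Qs -> c ^+ 2 + s ^+ 2 = 1 ->
  (forall m : int, (c + 'i * s) ^ m = 1 -> m = 0) ->
  torus_elt Qs c s *m (torus_elt Qs c s *m y) = y -> torus_gen Qs *m y = 0.
Proof.
move=> csQs cs1 zm Ty.
have [z0 _] := unit_circle cs1.
have -> : torus_gen Qs *m y = \sum_(p <- torus_decomp Qs) (torus_gen Qs * p.2) *m y.
  by rewrite -mulmx_suml -mulr_sumr torus_decomp_sum mulr1.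
rewrite big_seq big1 // => p pQs; rewrite (torus_gen_decomp csQs pQs) -scalemxAl.
have pT : torus_elt Qs c s *m p.2 = p.2 *m torus_elt Qs c s.
  apply: (comm_torus_decomp _ pQs) => Q QQs.
  by apply/commr_sym/comm_torus_elt => Q' Q'Qs; apply: csQs.2.
have Tp : torus_elt Qs c s *m (p.2 *m y) = (c + 'i * s) ^ p.1 *: (p.2 *m y).
  by rewrite mulmxA mulmxE torus_elt_decomp // scalemxAl.
have : torus_elt Qs c s *m (torus_elt Qs c s *m (p.2 *m y)) = p.2 *m y.
  rewrite (mulmxA (torus_elt Qs c s) p.2) pT -(mulmxA p.2).
  by rewrite (mulmxA (torus_elt Qs c s) p.2) pT -(mulmxA p.2) Ty.
rewrite Tp -scalemxAr Tp scalerA -expfzDr // => /eqP.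
rewrite -subr_eq0 -[X in _ - X]scale1r -scalerBl scaler_eq0 subr_eq0.
case/orP=> [/eqP/zm|/eqP->]; last by rewrite scaler0.
move=> p0; have -> : p.1 = 0 by lia.
by rewrite mulr0 scale0r.
Qed.

End Torus.

Section NotARoot.
Variable R : realType.
Local Notation C := R[i].

Lemma emb_inj : injective (emb R).
Proof. by move=> [a b] [a' b'] [] /intr_inj-> /intr_inj->. Qed.

(** Rests on [(3 + 4i)^2 = -7 + 24i], congruent to 3 + 4i modulo 5. *)
Lemma expr_34 n : exists a b : int, emb R (3, 4) ^+ n.+1 = emb R (5 * a + 3, 5 * b + 4).
Proof.
elim: n => [|n [a [b IH]]]; first by exists 0, 0; rewrite expr1 !mulr0 !add0r.
exists (3 * a - 4 * b - 2), (4 * a + 3 * b + 4); rewrite exprS IH -embM /gmul /=.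
by congr (emb R (_, _)); lia.
Qed.

(* Positive powers of 3 + 4i are congruent to 3 + 4i modulo 5, so they are not
   powers of 5. *)
Lemma circle_34_not_root (m : int) :
  ((3%:R / 5%:R : R)%:C%C + 'i * (4%:R / 5%:R : R)%:C%C : C) ^ m = 1 -> m = 0.
Proof.
set z := (X in X ^ m); have n5 : 5%:R != 0 :> C by rewrite pnatr_eq0.
have zE : z = emb R (3, 4) / 5%:R.
  have r5 : (5%:R : R)%:C%C = 5%:R :> C by rewrite rmorph_nat.
  apply: (canRL (mulfK n5)); rewrite /z -r5 mulrDl -mulrA -!rmorphM !divfK ?pnatr_eq0 //.
  by rewrite -complexiE; simpc.
have zn n : z ^+ n.+1 != 1.
  rewrite zE expr_div_n; apply/eqP=> /(canRL (divfK (expf_neq0 _ n5))).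
  have [a [b ->]] := expr_34 n.
  have -> : (5%:R : C) ^+ n.+1 = emb R (5 ^+ n.+1, 0) by rewrite emb_int rmorphXn.
  by rewrite mul1r => /emb_inj[]; rewrite exprS => h _; lia.
case: m => [[|n]|n] //.
  by rewrite -exprnP => /eqP; rewrite (negPf (zn n)).
by rewrite NegzE -exprnN => /eqP; rewrite invr_eq1 (negPf (zn n)).
Qed.

End NotARoot.

(** * Spin lifts of plane rotations *)

Section SpinIsometry.
Variables (R : realType) (n d : nat).
Local Notation C := R[i].
Variable c : 'I_n -> 'M[C]_d.
Hypothesis c_clifford : is_clifford c.

Lemma cliff_vec_anticomm (v : 'cV[C]_n) j :
  cliff_vec c v * c j + c j * cliff_vec c v = (- v j 0 *+ 2)%:M.
Proof.
rewrite /cliff_vec mulr_suml mulr_sumr -big_split (bigD1 j) //= big1 => [|i /negPf ij].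
  rewrite addr0 scalerMl scalerMr -scalerDr c_clifford eqxx -scalemx1 scalerA scalemx1.
  by rewrite mulrnAr mulrN1.
rewrite scalerMl scalerMr -scalerDr c_clifford ij oppr0 mul0rn -scalemx1 scalerA.
by rewrite mulr0 scale0r.
Qed.

(** Twice the square is a combination of anticommutators of V with the generators, which are
    scalars. *)
Lemma cliff_vec_sqr (v : 'cV[C]_n) :
  cliff_vec c v * cliff_vec c v = (- \sum_i v i 0 ^+ 2)%:M.
Proof.
have n2 : 2%:R != 0 :> C by rewrite pnatr_eq0.
apply: (scalerI n2); set V := cliff_vec c v.
transitivity (\sum_j v j 0 *: (V * c j + c j * V)).
  transitivity (\sum_j (V * (v j 0 *: c j) + (v j 0 *: c j) * V)).
    by rewrite big_split /= -mulr_sumr -mulr_suml scaler_nat mulr2n.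
  by apply: eq_bigr=> j _; rewrite scalerDr scalerMr scalerMl.
rewrite scale_scalar_mx -scalemx1 mulrN mulr_sumr -sumrN scaler_suml.
apply: eq_bigr=> j _; rewrite cliff_vec_anticomm scalemx1 [LHS]scale_scalar_mx.
by congr (_%:M); ring.
Qed.

Lemma clifford_mulE (v : 'cV[R]_n) : clifford_mul c v = cliff_vec c (mxC v).
Proof. by apply: eq_bigr=> i _; rewrite mxE. Qed.

Lemma clifford_mul_sqr (v : 'cV[R]_n) : \sum_i v i 0 ^+ 2 = 1 ->
  clifford_mul c v * clifford_mul c v = -1.
Proof.
move=> v1; rewrite clifford_mulE cliff_vec_sqr.
have -> : \sum_i (mxC v) i 0 ^+ 2 = 1 :> C.
  have -> : 1 = (\sum_i v i 0 ^+ 2)%:C%C :> C by rewrite v1.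
  by rewrite rmorph_sum; apply: eq_bigr=> i _; rewrite mxE rmorphXn.
by rewrite -scalemx1 scaleN1r.
Qed.

Lemma clifford_mul_delta i : clifford_mul c (delta_mx i 0) = c i.
Proof. by rewrite clifford_mulE /mxC map_delta_mx cliff_vec_delta. Qed.

Variables (C0 : 'M[C]_d) (s : C).
Hypothesis C0_unit : C0 \in unitmx.
Hypothesis s2 : s ^+ 2 = 1.
Hypothesis tr_cliff : forall i, (c i)^T *m C0 = s *: (C0 *m c i).

(** The rotation below an element determines it up to a scalar; invariance of the bilinear form [C0]
    cuts this down to a sign. *)
Definition preserves_form (g : 'M[C]_d) := g^T *m C0 *m g = C0.

Lemma preserves_formM g h : preserves_form g -> preserves_form h -> preserves_form (g * h).
Proof.
rewrite /preserves_form => gC hC; rewrite -mulmxE trmx_mul -!mulmxA.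
by rewrite (mulmxA C0) (mulmxA g^T) (mulmxA g^T) gC mulmxA.
Qed.

Lemma preserves_form1 : preserves_form 1.
Proof. by rewrite /preserves_form trmx1 mul1mx mulmx1. Qed.

Lemma preserves_form_prod (I : eqType) (r : seq I) (F : I -> 'M[C]_d) :
  (forall i, i \in r -> preserves_form (F i)) -> preserves_form (\prod_(i <- r) F i).
Proof.
move=> rF; rewrite big_seq; elim/big_rec: _ => [|i g ir gC]; first exact: preserves_form1.
by apply: preserves_formM => //; exact: rF.
Qed.

(** A unit vector multiplies the form by -s; an even number of them leaves it unchanged as
    [s^2 = 1]. *)
Lemma in_spin_preserves_form g : in_spin c g -> preserves_form g.
Proof.
case=> vs [ev v1 ->].
have vC (v : 'cV[R]_n) : \sum_i v i 0 ^+ 2 = 1 ->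
    (clifford_mul c v)^T *m C0 *m clifford_mul c v = (- s) *: C0.
  move=> /clifford_mul_sqr sq.
  have -> : (clifford_mul c v)^T *m C0 = s *: (C0 *m clifford_mul c v).
    rewrite /clifford_mul linear_sum mulmx_suml mulmx_sumr scaler_sumr.
    apply: eq_bigr=> i _; rewrite linearZ /= -scalemxAl -scalemxAr tr_cliff.
    by rewrite !scalerA mulrC.
  by rewrite -scalemxAl -mulmxA mulmxE sq mulrN1 scalerN scaleNr.
have : (\prod_(v <- vs) clifford_mul c v)^T *m C0 *m \prod_(v <- vs) clifford_mul c v
    = (- s) ^+ size vs *: C0.
  elim: vs {ev} v1 => [|v vs IH] v1.
    by rewrite big_nil trmx1 mul1mx mulmx1 expr0 scale1r.
  rewrite big_cons -mulmxE trmx_mul -!mulmxA (mulmxA C0) (mulmxA (clifford_mul c v)^T).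
  rewrite (mulmxA (clifford_mul c v)^T) vC ?v1 ?inE ?eqxx // -scalemxAl -scalemxAr.
  rewrite mulmxA IH; first by rewrite scalerA exprS.
  by move=> u uvs; apply: v1; rewrite inE uvs orbT.
rewrite /preserves_form => ->; rewrite -(odd_double_half (size vs)) (negPf ev) add0n -mul2n exprM.
by rewrite sqrrN s2 expr1n scale1r.
Qed.

Definition commutant_scalar : Prop :=
  forall M : 'M[C]_d, (forall i, M * c i = c i * M) -> exists a, M = a%:M.

(** The quotient of T by g commutes with all generators, so it is a scalar; the invariant form makes
    its square 1. *)
Lemma lies_over_unique g T A : (0 < d)%N -> commutant_scalar ->
  preserves_form g -> preserves_form T -> lies_over c g A -> lies_over c T A ->
  T = g \/ T = - g.
Proof.
move=> d0 schur gC TC gA TA.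
have gu : g \in unitmx.
  have : g^T *m C0 *m g \in unitmx by rewrite gC.
  by rewrite !unitmx_mul => /andP[].
have [a aE] : exists a, invmx g *m T = a%:M.
  apply: schur => i; rewrite -(clifford_mul_delta i) -!mulmxE.
  rewrite -mulmxA TA mulmxA [RHS]mulmxA; congr (_ *m T); apply: (canRL (mulmxK gu)).
  by rewrite -mulmxA -gA mulKmx.
have TE : T = a *: g by rewrite -(mulKVmx gu T) aE mul_mx_scalar.
have trZ : (a *: g)^T = a *: g^T by apply/matrixP=> i j; rewrite !mxE.
move: TC; rewrite /preserves_form TE trZ -!scalemxAl -scalemxAr gC scalerA => aC.
have : (a * a - 1) *: (1%:M : 'M[C]_d) = 0.
  by rewrite -(mulmxV C0_unit) scalemxAl scalerBl aC scale1r subrr mul0mx.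
move/matrixP/(_ (Ordinal d0) (Ordinal d0)); rewrite !mxE eqxx mulr1 => /eqP.
rewrite subr_eq0 -expr2 sqrf_eq1 => /orP[] /eqP->; rewrite ?scale1r ?scaleN1r; by [left|right].
Qed.

End SpinIsometry.

Section PlaneLift.
Variables (R : realType) (n d : nat).
Local Notation C := R[i].
Variable c : 'I_n -> 'M[C]_d.
Hypothesis c_clifford : is_clifford c.
Variables (p : 'I_n -> 'I_n) (e : 'I_n -> C).
Hypothesis pK : involutive p.
Hypothesis p_neq : forall a, p a != a.
Hypothesis e_p : forall a, e (p a) = - e a.
Hypothesis e_sqr : forall a, e a * e a = 1.

(** For the p and e at hand this is a complex structure J pairing the axis a with the axis [p a]. A
    rotation [X + Y J] turns all these planes at once, so its spin lift is a product of commuting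
    plane rotations. *)
Definition signed_perm_mx : 'M[C]_n := \matrix_(b, a) (e a * (b == p a)%:R).

Definition plane (a : 'I_n) : 'M[C]_d := e a *: (c a * c (p a)).
(** One plane from each pair {a, p a}, as [plane (p a) = plane a]. *)
Definition planes : seq 'M[C]_d := [seq plane a | a : 'I_n <- enum 'I_n & (a < p a)%N].

Lemma plane_p a : plane (p a) = plane a.
Proof.
rewrite /plane pK e_p scaleNr -scalerN; congr (_ *: _).
by rewrite (clifford_anti c_clifford (p_neq a)) opprK.
Qed.

Lemma plane_sqr a : plane a * plane a = -1.
Proof.
rewrite /plane scalerMl scalerMr scalerA e_sqr scale1r.
rewrite mulrA -[c a * c (p a) * c a]mulrA [c (p a) * c a]clifford_anti //.
by rewrite mulrN mulNr mulrA clifford_sqr // mulN1r mulNr opprK clifford_sqr.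
Qed.

Lemma plane_cliff a b : b != a -> b != p a -> GRing.comm (plane a) (c b).
Proof.
move=> ba bpa; apply: commr_sym; apply: commZ; rewrite /GRing.comm.
rewrite [LHS]mulrA (clifford_anti c_clifford ba) mulNr -[c a * c b * _]mulrA.
by rewrite (clifford_anti c_clifford bpa) mulrN opprK mulrA.
Qed.

Lemma plane_comm a b : GRing.comm (plane a) (plane b).
Proof.
have [->//|ba] := eqVneq b a; have [->|bpa] := eqVneq b (p a).
  by rewrite plane_p.
apply/commZ/commrM; apply: plane_cliff => //.
  by rewrite (can2_eq pK pK).
by rewrite (can_eq pK).
Qed.

Lemma planes_structure : complex_structures planes.
Proof.
split=> [Q /mapP[a _ ->]|Q Q' /mapP[a _ ->] /mapP[b _ ->]]; first exact: plane_sqr.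
exact: plane_comm.
Qed.

(** Every plane occurs twice in the sum over all axes, which turns the factor 1/4 of [spin_act] into
    1/2. *)
Lemma spin_act_planes : torus_gen planes = 2%:R *: spin_act c signed_perm_mx.
Proof.
have -> : torus_gen planes = \sum_(a : 'I_n | (a < p a)%N) plane a.
  by rewrite /torus_gen big_map big_filter big_enum_cond.
have -> : spin_act c signed_perm_mx = 4%:R^-1 *: \sum_a plane a.
  congr (_ *: _); apply: eq_bigr=> a _; rewrite (bigD1 (p a)) //= big1 => [|b bpa].
    by rewrite addr0 mxE eqxx mulr1.
  by rewrite mxE (negPf bpa) mulr0 scale0r.
rewrite [\sum_a plane a](bigID (fun a : 'I_n => (a < p a)%N)) /=.
rewrite [X in _ + X](_ : _ = \sum_(a : 'I_n | (a < p a)%N) plane a).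
  rewrite -mulr2n -[X in _ *: (_ *: X)]scaler_nat !scalerA -[LHS]scale1r;
  by congr (_ *: _); field.
rewrite (reindex_inj (inv_inj pK)) /=; apply: eq_big=> [a|a _]; last exact: plane_p.
rewrite pK -leqNgt leq_eqVlt val_eqE eq_sym.
by rewrite (negPf (p_neq a)).
Qed.

Section Rotation.
Variables x y : C.
Hypothesis xy1 : x ^+ 2 + y ^+ 2 = 1.

Let X := x ^+ 2 - y ^+ 2.
Let Y := 2%:R * x * y.
(** If x = cos t and y = sin t, then X = cos 2t and Y = sin 2t: the image of an axis under rotation
    by the double angle. *)
Definition rotated a : 'M[C]_d := X *: c a + (Y * e a) *: c (p a).

Lemma plane_rotated a b : b != a -> b != p a -> GRing.comm (plane a) (rotated b).
Proof.
move=> ba bpa; apply: commrD; apply: commZ; apply: plane_cliff => //.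
  by rewrite (can2_eq pK pK).
by rewrite (can_eq pK).
Qed.

Lemma comm_plane_elt M a : GRing.comm (plane a) M -> GRing.comm (x%:M + y *: plane a) M.
Proof.
move=> cM; apply/commr_sym/commrD; last exact/commZ/commr_sym.
by rewrite /GRing.comm -!mulmxE scalar_mxC.
Qed.

Lemma plane_elt_cliff a : (x%:M + y *: plane a) * c a = rotated a * (x%:M + y *: plane a).
Proof.
have Qc : plane a * c a = e a *: c (p a).
  rewrite /plane scalerMl -mulrA [c (p a) * c a]clifford_anti // mulrN mulrA.
  by rewrite clifford_sqr // mulN1r opprK.
have cQ : c a * plane a = - (e a *: c (p a)).
  by rewrite /plane scalerMr mulrA clifford_sqr // mulN1r scalerN.
have pQ : c (p a) * plane a = e a *: c a.
  rewrite /plane scalerMr mulrA [c (p a) * c a]clifford_anti // mulNr -mulrA.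
  by rewrite clifford_sqr // mulrN1 opprK.
rewrite /rotated mulrDl [RHS]mulrDl !mulrDr.
have xM M : x%:M * M = x *: M by rewrite -[LHS]/(x%:M *m M) mul_scalar_mx.
have Mx M : M * x%:M = x *: M by rewrite -[LHS]/(M *m x%:M) mul_mx_scalar.
move: (plane a) Qc cQ pQ => Q Qc cQ pQ.
rewrite xM !Mx !scalerMl !scalerMr Qc cQ pQ !scalerA scalerN.
have hX : X * x + Y * e a * y * e a = x.
  have -> : Y * e a * y * e a = Y * y * (e a * e a) by ring.
  rewrite e_sqr mulr1 -[RHS]mul1r -xy1 /X /Y; ring.
have hY : Y * e a * x - X * y * e a = y * e a.
  have -> : Y * e a * x - X * y * e a = (Y * x - X * y) * e a by ring.
  congr (_ * _); rewrite -[RHS]mul1r -xy1 /X /Y; ring.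
transitivity ((X * x + Y * e a * y * e a) *: c a + (Y * e a * x - X * y * e a) *: c (p a)).
  by rewrite hX hY.
rewrite !scalerDl scaleNr ![x * _]mulrC !scalerA.
set u := (X * x) *: _; set v := (Y * _ * y * _) *: _; set w := (Y * _ * x) *: _.
by rewrite [w - _]addrC addrACA [v + w]addrC.
Qed.

(** Only the factor of the plane containing a moves [c a]; the other factors commute with both [c a]
    and [rotated a]. *)
Lemma torus_planes_cliff a :
  torus_elt planes x y * c a = rotated a * torus_elt planes x y.
Proof.
pose q := if (a < p a)%N then a else p a.
have q_pos : (q < p q)%N.
  rewrite /q; case: (ltnP a (p a)) => //; rewrite pK leq_eqVlt val_eqE.
  by rewrite (negPf (p_neq a)).
have qP (b : 'I_n) : (b < p b)%N -> b != q -> a != b /\ a != p b.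
  move=> bp bq; split; apply: contraNneq bq => ab.
    by rewrite /q ab bp.
  by rewrite /q ab pK ltnNge (ltnW bp).
have gq : (x%:M + y *: plane q) * c a = rotated a * (x%:M + y *: plane q).
  by rewrite /q; case: ifP => _; rewrite ?plane_p plane_elt_cliff.
rewrite /torus_elt /planes big_map.
set r := [seq _ <- _ | _].
have r_pos (b : 'I_n) : b \in r -> (b < p b)%N by rewrite mem_filter => /andP[].
have r_uniq : uniq r by rewrite filter_uniq ?enum_uniq.
have qr : q \in r by rewrite mem_filter q_pos mem_enum.
(* Induction needs sublists, where the plane q of a may or may not have been met; absence of
   repetitions ensures that it acts only once. *)
suff H (s : seq 'I_n) : uniq s -> {subset s <= r} ->
    (\prod_(b <- s) (x%:M + y *: plane b)) * c a =
    (if q \in s then rotated a else c a) * \prod_(b <- s) (x%:M + y *: plane b).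
  by rewrite H // qr.
elim: s => [|b s IH] /=; first by rewrite big_nil mul1r mulr1.
move=> /andP[bs us] sr; have /IH{}IH := us.
have {}IH := IH (fun z zs => sr z (mem_behead (s := b :: s) zs)).
rewrite big_cons -mulrA IH !mulrA inE eq_sym; congr (_ * _).
have bp : (b < p b)%N by apply/r_pos/sr; rewrite inE eqxx.
have [bq|bq] := eqVneq b q; first by rewrite -bq (negPf bs) bq gq.
have [ab apb] := qP b bp bq; apply: comm_plane_elt.
by case: (q \in s); [exact: plane_rotated | exact: plane_cliff].
Qed.

Lemma torus_planes_cliff_vec v :
  torus_elt planes x y * cliff_vec c v =
  cliff_vec c ((X%:M + Y *: signed_perm_mx) *m v) * torus_elt planes x y.
Proof.
rewrite {1}/cliff_vec mulr_sumr.
have -> : cliff_vec c ((X%:M + Y *: signed_perm_mx) *m v) = \sum_a v a 0 *: rotated a.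
  rewrite mulmxDl mul_scalar_mx -scalemxAl linearD !linearZ /=.
  rewrite [RHS](eq_bigr (fun a => X *: (v a 0 *: c a) + (Y * (e a * v a 0)) *: c (p a))).
    rewrite big_split -scaler_sumr; congr (_ + _).
    rewrite /cliff_vec scaler_sumr [RHS](reindex_inj (inv_inj pK)) /=.
    apply: eq_bigr=> a _; rewrite mxE (bigD1 (p a)) //= big1 => [|b bpa].
      by rewrite addr0 mxE pK eqxx mulr1 scalerA.
    by rewrite mxE eq_sym (can2_eq pK pK) (negPf bpa) mulr0 mul0r.
  move=> a _; rewrite /rotated scalerDr !scalerA; congr (_ *: _ + _ *: _).
    exact: mulrC.
  by rewrite mulrC mulrA.
rewrite mulr_suml; apply: eq_bigr=> a _.
by rewrite scalerMr torus_planes_cliff scalerMl.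
Qed.

End Rotation.

(** Each plane Q is skew for the form, so x + y Q multiplies it by
    [(x - y Q) (x + y Q) = x^2 + y^2 = 1]. *)
Lemma preserves_planes (C0 : 'M[C]_d) s x y :
  (forall i, (c i)^T *m C0 = s *: (C0 *m c i)) -> s ^+ 2 = 1 -> x ^+ 2 + y ^+ 2 = 1 ->
  preserves_form C0 (torus_elt planes x y).
Proof.
move=> trc s2 xy1; apply: preserves_form_prod => _ /mapP[a _ ->].
have Qt : (plane a)^T *m C0 = - (C0 *m plane a).
  have -> : (plane a)^T = e a *: ((c (p a))^T *m (c a)^T).
    by rewrite -trmx_mul; apply/matrixP=> i j; rewrite !mxE.
  rewrite -scalemxAl -mulmxA trc -scalemxAr mulmxA trc -scalemxAl !scalerA.
  rewrite -mulmxA mulmxE (clifford_anti c_clifford (p_neq a)) mulrN scalerN.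
  by rewrite -expr2 s2 mulr1 /plane scalerMr.
move: (plane a) (plane_sqr a : plane a *m plane a = -1) Qt => Q Qsq Qt.
have trQ : (x%:M + y *: Q)^T = x%:M + y *: Q^T.
  by apply/matrixP=> i j; rewrite !mxE eq_sym.
rewrite /preserves_form trQ mulmxDl mul_scalar_mx -scalemxAl Qt.
rewrite mulmxDl !mulmxDr -!scalemxAl !mul_mx_scalar -!scalemxAr.
rewrite mulNmx -mulmxA Qsq mulmxN mulmx1 opprK scalerA.
rewrite !scalerN !scalerA [y * x]mulrC addrA addrK -scalerDl -!expr2 xy1.
by rewrite scale1r.
Qed.

End PlaneLift.

(** * Commutants *)

Section Schur.
Variable R : realType.
Local Notation C := R[i].

Lemma sum_mxtens m n (F : 'I_(m * n) -> C) :
  \sum_k F k = \sum_i \sum_j F (mxtens_index (i, j)).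
Proof.
rewrite pair_big /= (reindex (@mxtens_index m n)) /=; last first.
  by exists (@mxtens_unindex m n)=> k _; rewrite (mxtens_indexK, mxtens_unindexK).
by apply: eq_bigr=> -[i j] _.
Qed.

Lemma double_eq0 (x : C) : - x = x -> x = 0.
Proof.
move/eqP; rewrite eq_sym -addr_eq0 -mulr2n mulrn_eq0 /= => /eqP; exact.
Qed.

Lemma sum2 (F : 'I_2 -> C) : \sum_k F k = F 0 + F 1.
Proof. by rewrite !big_ord_recl big_ord0 addr0; congr (_ + F _); apply: val_inj. Qed.

(** In 2 by 2 blocks, commuting with [kZ] kills the off-diagonal blocks and commuting with [kX]
    equates the diagonal ones. *)
Lemma commute_tens1l n (M : 'M[C]_(2 * n)) :
  M *m (kX *t 1%:M) = (kX *t 1%:M) *m M -> M *m (kZ *t 1%:M) = (kZ *t 1%:M) *m M ->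
  exists M' : 'M[C]_n, M = 1%:M *t M'.
Proof.
have Mr A a i b j : (M *m (A *t 1%:M)) (mxtens_index (a, i)) (mxtens_index (b, j)) =
    M (mxtens_index (a, i)) (mxtens_index (0, j)) * A 0 b +
    M (mxtens_index (a, i)) (mxtens_index (1, j)) * A 1 b.
  rewrite mxE sum_mxtens -[RHS](sum2 (fun k => M _ (mxtens_index (k, j)) * A k b)).
  apply: eq_bigr=> k _; rewrite (bigD1 j) //= tensmxE mxE eqxx mulr1 big1 ?addr0 // => l lj.
  by rewrite tensmxE mxE (negPf lj) !mulr0.
have Ml A a i b j : ((A *t 1%:M) *m M) (mxtens_index (a, i)) (mxtens_index (b, j)) =
    A a 0 * M (mxtens_index (0, i)) (mxtens_index (b, j)) +
    A a 1 * M (mxtens_index (1, i)) (mxtens_index (b, j)).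
  rewrite mxE sum_mxtens -[RHS](sum2 (fun k => A a k * M (mxtens_index (k, i)) _)).
  apply: eq_bigr=> k _; rewrite (bigD1 i) //= tensmxE mxE eqxx mulr1 big1 ?addr0 // => l li.
  by rewrite tensmxE mxE eq_sym (negPf li) mulr0 mul0r.
move=> /matrixP MX /matrixP MZ.
have X01 i j : M (mxtens_index (0, i)) (mxtens_index (0, j)) =
    M (mxtens_index (1, i)) (mxtens_index (1, j)).
  have := MX (mxtens_index (0, i)) (mxtens_index (1, j)).
  by rewrite Mr Ml !mxE /= !(mulr0, mul0r, mulr1, mul1r, addr0, add0r).
have Z01 i j : M (mxtens_index (0, i)) (mxtens_index (1, j)) = 0.
  apply: double_eq0; have := MZ (mxtens_index (0, i)) (mxtens_index (1, j)).
  rewrite Mr Ml !mxE /= !(mulr0, mul0r, mulr1, mul1r, addr0, add0r).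
  by rewrite ?expr1 ?expr0 ?mulrN1 ?mulN1r ?mul1r ?mulr1.
have Z10 i j : M (mxtens_index (1, i)) (mxtens_index (0, j)) = 0.
  apply: double_eq0; have := MZ (mxtens_index (1, i)) (mxtens_index (0, j)).
  rewrite Mr Ml !mxE /= !(mulr0, mul0r, mulr1, mul1r, addr0, add0r).
  by rewrite ?expr1 ?expr0 ?mulrN1 ?mulN1r ?mul1r ?mulr1.
exists (\matrix_(i, j) M (mxtens_index (0, i)) (mxtens_index (0, j))).
apply/matrixP=> k l; case: (mxtens_indexP k)=> a i; case: (mxtens_indexP l)=> b j.
rewrite tensmxE !mxE.
have o2 (x : 'I_2) : x = 0 \/ x = 1.
  by case: x => [[|[|x]] hx] //; [left | right]; apply: val_inj.
have [->|->] := o2 a; have [->|->] := o2 b; rewrite ?(mul0r, mul1r) //.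
Qed.

Lemma commute_tens1r n (M : 'M[C]_(n * 2)) :
  M *m (1%:M *t kX) = (1%:M *t kX) *m M -> M *m (1%:M *t kZ) = (1%:M *t kZ) *m M ->
  exists M' : 'M[C]_n, M = M' *t 1%:M.
Proof.
have Mr A a i b j : (M *m (1%:M *t A)) (mxtens_index (i, a)) (mxtens_index (j, b)) =
    M (mxtens_index (i, a)) (mxtens_index (j, 0)) * A 0 b +
    M (mxtens_index (i, a)) (mxtens_index (j, 1)) * A 1 b.
  rewrite mxE sum_mxtens -[RHS](sum2 (fun k => M _ (mxtens_index (j, k)) * A k b)).
  rewrite exchange_big; apply: eq_bigr=> k _; rewrite (bigD1 j) //= tensmxE mxE eqxx mul1r.
  by rewrite big1 ?addr0 // => l lj; rewrite tensmxE mxE (negPf lj) mul0r mulr0.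
have Ml A a i b j : ((1%:M *t A) *m M) (mxtens_index (i, a)) (mxtens_index (j, b)) =
    A a 0 * M (mxtens_index (i, 0)) (mxtens_index (j, b)) +
    A a 1 * M (mxtens_index (i, 1)) (mxtens_index (j, b)).
  rewrite mxE sum_mxtens -[RHS](sum2 (fun k => A a k * M (mxtens_index (i, k)) _)).
  rewrite exchange_big; apply: eq_bigr=> k _; rewrite (bigD1 i) //= tensmxE mxE eqxx mul1r.
  by rewrite big1 ?addr0 // => l li; rewrite tensmxE mxE eq_sym (negPf li) !mul0r.
move=> /matrixP MX /matrixP MZ.
have X01 i j : M (mxtens_index (i, 0)) (mxtens_index (j, 0)) =
    M (mxtens_index (i, 1)) (mxtens_index (j, 1)).
  have := MX (mxtens_index (i, 0)) (mxtens_index (j, 1)).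
  by rewrite Mr Ml !mxE /= !(mulr0, mul0r, mulr1, mul1r, addr0, add0r).
have Z01 i j : M (mxtens_index (i, 0)) (mxtens_index (j, 1)) = 0.
  apply: double_eq0; have := MZ (mxtens_index (i, 0)) (mxtens_index (j, 1)).
  rewrite Mr Ml !mxE /= !(mulr0, mul0r, mulr1, mul1r, addr0, add0r).
  by rewrite ?expr1 ?expr0 ?mulrN1 ?mulN1r ?mul1r ?mulr1.
have Z10 i j : M (mxtens_index (i, 1)) (mxtens_index (j, 0)) = 0.
  apply: double_eq0; have := MZ (mxtens_index (i, 1)) (mxtens_index (j, 0)).
  rewrite Mr Ml !mxE /= !(mulr0, mul0r, mulr1, mul1r, addr0, add0r).
  by rewrite ?expr1 ?expr0 ?mulrN1 ?mulN1r ?mul1r ?mulr1.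
exists (\matrix_(i, j) M (mxtens_index (i, 0)) (mxtens_index (j, 0))).
apply/matrixP=> k l; case: (mxtens_indexP k)=> i a; case: (mxtens_indexP l)=> j b.
rewrite tensmxE !mxE.
have o2 (x : 'I_2) : x = 0 \/ x = 1.
  by case: x => [[|[|x]] hx] //; [left | right]; apply: val_inj.
have [->|->] := o2 a; have [->|->] := o2 b; rewrite ?(mulr0, mulr1) //.
Qed.

Lemma commute_XZ (M : 'M[C]_2) : M *m kX = kX *m M -> M *m kZ = kZ *m M ->
  exists a, M = a%:M.
Proof.
move=> /matrixP MX /matrixP MZ; exists (M 0 0).
have X01 : M 0 0 = M 1 1.
  have := MX 0 1; rewrite !mxE !sum2 !mxE /=.
  by rewrite !(mulr0, mul0r, mulr1, mul1r, addr0, add0r).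
have Z01 : M 0 1 = 0.
  apply: double_eq0; have := MZ 0 1; rewrite !mxE !sum2 !mxE /=.
  rewrite !(mulr0, mul0r, mulr1, mul1r, addr0, add0r).
  by rewrite ?expr1 ?expr0 ?mulrN1 ?mulN1r ?mul1r ?mulr1.
have Z10 : M 1 0 = 0.
  apply: double_eq0; have := MZ 1 0; rewrite !mxE !sum2 !mxE /=.
  rewrite !(mulr0, mul0r, mulr1, mul1r, addr0, add0r).
  by rewrite ?expr1 ?expr0 ?mulrN1 ?mulN1r ?mul1r ?mulr1.
apply/matrixP=> a b; rewrite !mxE.
have o2 (x : 'I_2) : x = 0 \/ x = 1.
  by case: x => [[|[|x]] hx] //; [left | right]; apply: val_inj.
by have [->|->] := o2 a; have [->|->] := o2 b.
Qed.

Lemma tens1r_inj n : injective (fun A : 'M[C]_n => A *t (1%:M : 'M_2)).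
Proof.
move=> A B /matrixP AB; apply/matrixP=> i j.
by have := AB (mxtens_index (i, 0)) (mxtens_index (j, 0)); rewrite !tensmxE !mxE !mulr1.
Qed.

Lemma kZ_tens_inj n : injective (fun A : 'M[C]_n => kZ *t A).
Proof.
move=> A B /matrixP AB; apply/matrixP=> i j.
have := AB (mxtens_index (0, i)) (mxtens_index (0, j)); rewrite !tensmxE !mxE /= mulr1.
by rewrite expr0 !mul1r.
Qed.

Lemma kXE : (kX : 'M[C]_2) *m kE = - kZ.
Proof.
apply/matrixP=> i j; rewrite !mxE !big_ord_recl !big_ord0 !mxE.
case: i j => [[|[|]] //= ?] [[|[|]] //= ?];
  by rewrite ?(mulr0, mulr1, mul0r, mul1r, addr0, add0r, expr1, oppr0, mulrNN, opprK).
Qed.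

Lemma kXZ : (kX : 'M[C]_2) *m kZ = - kE.
Proof. by rewrite -[kZ]opprK -kXE mulmxN mulmxA kXX mul1mx. Qed.

(** The last two generators provide [kE], [kX] and hence [kZ] on the first tensor factor, which
    peels it off; the other generators then act on the rest. *)
Lemma clifford_even_commutant m (M : 'M[C]_(spin_dim m)) :
  (forall i, (i < m.*2)%N -> M *m clifford_even R m i = clifford_even R m i *m M) ->
  exists a, M = a%:M.
Proof.
elim: m M => [|m IH] M; first by move=> _; exists (M 0 0); exact: mx11_scalar.
move=> cM; have ME : M *m (kE *t 1%:M) = (kE *t 1%:M) *m M.
  by have := cM m.*2; rewrite clifford_even_pen doubleS; apply; rewrite ltnS leqnSn.
have MX : M *m (kX *t 1%:M) = (kX *t 1%:M) *m M.
  have := cM m.*2.+1; rewrite clifford_even_last // doubleS ltnSn => /(_ isT).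
  by rewrite -scalemxAr -scalemxAl => /(scalerI (neq0Ci _)).
have MZ : M *m (kZ *t 1%:M) = (kZ *t 1%:M) *m M.
  have -> : kZ *t 1%:M = - ((kX *t 1%:M) *m (kE *t 1%:M)) :> 'M[C]_(2 * spin_dim m).
    by rewrite tensmx_mul kXE mulmx1 tensmxNl opprK.
  by rewrite mulmxN mulNmx mulmxA MX -mulmxA ME mulmxA.
have [M' ME'] := commute_tens1l MX MZ.
have [a aE] : exists a, M' = a%:M.
  apply: IH => i im; apply: kZ_tens_inj.
  have := cM i; rewrite doubleS !ltnS => /(_ (leq_trans (ltnW im) (leqnSn _))).
  by rewrite ME' clifford_evenS // !tensmx_mul mulmx1 mul1mx.
by exists a; rewrite ME' aE -[X in _ *t X]scalemx1 tensmxZr tensmx11 scalemx1.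
Qed.

Lemma cliff16_commutant : commutant_scalar (@cliff16 R).
Proof.
by move=> M cM; apply: clifford_even_commutant => i i16; exact: (cM (Ordinal i16)).
Qed.

Definition tens4 (A B D E : 'M[C]_2) : 'M[C]_(2 * 2 * 2 * 2) := A *t B *t D *t E.

Lemma tens4_mul A B D E A' B' D' E' :
  tens4 A B D E *m tens4 A' B' D' E' = tens4 (A *m A') (B *m B') (D *m D') (E *m E').
Proof. by rewrite /tens4 !tensmx_mul. Qed.

Lemma tens4N A B D E :
  [/\ tens4 (- A) B D E = - tens4 A B D E, tens4 A (- B) D E = - tens4 A B D E,
      tens4 A B (- D) E = - tens4 A B D E & tens4 A B D (- E) = - tens4 A B D E].
Proof. by split; rewrite /tens4 ?(tensmxNl, tensmxNr). Qed.

Definition tens4_cliff (i : nat) : 'M[C]_(2 * 2 * 2 * 2) :=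
  nth 0 [:: tens4 kE kE kX 1%:M; tens4 kE kE kE kE; tens4 kE kE kZ 1%:M;
            tens4 kE kX 1%:M kE; tens4 kE 1%:M kE kX; tens4 kE 1%:M kE kZ;
            tens4 kE kZ 1%:M kE; tens4 kX 1%:M 1%:M 1%:M; tens4 kZ 1%:M 1%:M 1%:M] i.

Lemma cliff9_tens4 i : cliff9 R i = 'i *: tens4_cliff i.
Proof.
have rX : map_mx (real_complex_def (Phant R)) kX = kX.
  by apply/matrixP=> k l; rewrite !mxE rmorph_nat.
have rE : map_mx (real_complex_def (Phant R)) kE = kE.
  by apply/matrixP=> k l; rewrite !mxE rmorphM rmorph_nat rmorphXn rmorphN1.
have rZ : map_mx (real_complex_def (Phant R)) kZ = kZ.
  by apply/matrixP=> k l; rewrite !mxE rmorphM rmorph_nat rmorphXn rmorphN1.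
have rI : map_mx (real_complex_def (Phant R)) kI = 1%:M by rewrite map_mx1.
have rt A B D E : mxC (A *t B *t D *t E) =
    tens4 (map_mx (real_complex_def (Phant R)) A) (map_mx (real_complex_def (Phant R)) B)
      (map_mx (real_complex_def (Phant R)) D) (map_mx (real_complex_def (Phant R)) E).
  by rewrite /mxC !(map_mxT (real_complex_def (Phant R))).
rewrite /cliff9; congr (_ *: _); rewrite /sigma_clifford /tens4_cliff.
case: i => [[|[|[|[|[|[|[|[|[|i]]]]]]]]] hi] //=; apply: etrans (rt _ _ _ _) _;
  by rewrite ?rX ?rE ?rZ ?rI.
Qed.

(** Products of the nine generators give [kX] and [kZ] in each of the four tensor slots alone; the
    slots are peeled off from the right. *)
Lemma tens4_commutant (M : 'M[C]_(2 * 2 * 2 * 2)) :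
  (forall i, (i < 9)%N -> M *m tens4_cliff i = tens4_cliff i *m M) ->
  exists a, M = a%:M.
Proof.
pose com N := M *m N = N *m M; move=> comc; rewrite -/(com _) in comc.
have comM A B : com A -> com B -> com (A *m B).
  by rewrite /com => cA cB; rewrite mulmxA cA -mulmxA cB mulmxA.
have comN A : com (- A) -> com A by rewrite /com mulmxN mulNmx => /oppr_inj.
have [c0 c1 c2] := And3 (comc 0%N isT) (comc 1%N isT) (comc 2%N isT).
have [c3 c4 c5] := And3 (comc 3%N isT) (comc 4%N isT) (comc 5%N isT).
have [c6 c7 c8] := And3 (comc 6%N isT) (comc 7%N isT) (comc 8%N isT).
rewrite /tens4_cliff /= in c0 c1 c2 c3 c4 c5 c6 c7 c8.
have N4 A B D E := tens4N A B D E.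
have N1 A B D E : tens4 (- A) B D E = - tens4 A B D E by case: (N4 A B D E).
have N2 A B D E : tens4 A (- B) D E = - tens4 A B D E by case: (N4 A B D E).
have N3 A B D E : tens4 A B (- D) E = - tens4 A B D E by case: (N4 A B D E).
have {}N4 A B D E : tens4 A B D (- E) = - tens4 A B D E by case: (N4 A B D E).
pose simp := (tens4_mul, kEE, kXX, kZZ, kXZ, mul1mx, mulmx1, N1, N2, N3, N4, opprK).
have e1 : com (tens4 kE 1%:M 1%:M 1%:M).
  by apply: comN; have := comM _ _ c7 c8; rewrite !simp.
have e4 : com (tens4 1%:M 1%:M 1%:M kE).
  by apply: comN; have := comM _ _ c4 c5; rewrite !simp.
have e3 : com (tens4 1%:M 1%:M kE 1%:M).
  by apply: comN; have := comM _ _ c0 c2; rewrite !simp.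
have e2 : com (tens4 1%:M kE 1%:M 1%:M).
  by apply: comN; have := comM _ _ (comM _ _ (comM _ _ c1 e1) e3) e4; rewrite !simp.
have x4 : com (tens4 1%:M 1%:M 1%:M kX).
  by have := comM _ _ (comM _ _ c4 e1) e3; rewrite !simp.
have z4 : com (tens4 1%:M 1%:M 1%:M kZ).
  by have := comM _ _ (comM _ _ c5 e1) e3; rewrite !simp.
have x3 : com (tens4 1%:M 1%:M kX 1%:M).
  by have := comM _ _ (comM _ _ c0 e1) e2; rewrite !simp.
have z3 : com (tens4 1%:M 1%:M kZ 1%:M).
  by have := comM _ _ (comM _ _ c2 e1) e2; rewrite !simp.
have x2 : com (tens4 1%:M kX 1%:M 1%:M).
  by have := comM _ _ (comM _ _ c3 e1) e4; rewrite !simp.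
have z2 : com (tens4 1%:M kZ 1%:M 1%:M).
  by have := comM _ _ (comM _ _ c6 e1) e4; rewrite !simp.
have peel n (N : 'M[C]_n) (A : 'M[C]_n) : (N *t (1%:M : 'M[C]_2)) *m (A *t 1%:M) =
    (A *t 1%:M) *m (N *t 1%:M) -> N *m A = A *m N.
  by rewrite !tensmx_mul mulmx1 => /tens1r_inj.
rewrite /com /tens4 !tensmx11 in x4 z4 x3 z3 x2 z2 c7 c8.
have [M1 ME] := commute_tens1r x4 z4; subst M.
move: x3 z3 x2 z2 c7 c8 => /peel x3 /peel z3 /peel x2 /peel z2 /peel x1 /peel z1.
have [M2 ME] := commute_tens1r x3 z3; subst M1.
move: x2 z2 x1 z1 => /peel x2 /peel z2 /peel x1 /peel z1.
have [M3 ME] := commute_tens1r x2 z2; subst M2.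
move: x1 z1 => /peel x1 /peel z1.
have [a ->] := commute_XZ x1 z1; exists a.
have scalE n : (a%:M : 'M[C]_n) *t (1%:M : 'M_2) = a%:M.
  by rewrite -[X in X *t _]scalemx1 tensmxZl tensmx11 scalemx1.
by rewrite !scalE.
Qed.

Lemma cliff9_commutant : commutant_scalar (@cliff9 R).
Proof.
move=> M cM; apply: (@tens4_commutant M) => i i9.
have := cM (Ordinal i9); rewrite cliff9_tens4 -!mulmxE.
by rewrite -scalemxAr -scalemxAl => /(scalerI (neq0Ci _)).
Qed.

End Schur.

(** * Generation of Spin(n) by plane rotations *)

Section HalfAngle.
Variable R : rcfType.

(** Half-angle formulas: x and y are the square roots of (1 + X) / 2 and (1 - X) / 2, with y
    carrying the sign of Y. *)
Lemma half_angle (X Y : R) : X ^+ 2 + Y ^+ 2 = 1 ->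
  exists x y, [/\ x ^+ 2 + y ^+ 2 = 1, X = x ^+ 2 - y ^+ 2 & Y = 2%:R * x * y].
Proof.
move=> XY1; have X1 : `|X| <= 1.
  by rewrite -(ler_pXn2r (n := 2)) ?nnegrE ?ler01 // expr1n real_normK ?num_real // -XY1 lerDl sqr_ge0.
have [Xl Xr] : -1 <= X /\ X <= 1 by apply/andP; rewrite -ler_norml.
have a0 : 0 <= (1 + X) / 2%:R by lra.
have b0 : 0 <= (1 - X) / 2%:R by lra.
pose x := Num.sqrt ((1 + X) / 2%:R); pose y := Num.sqrt ((1 - X) / 2%:R).
have x2 : x ^+ 2 = (1 + X) / 2%:R by rewrite sqr_sqrtr.
have y2 : y ^+ 2 = (1 - X) / 2%:R by rewrite sqr_sqrtr.
have xy0 : 0 <= 2%:R * x * y by rewrite !mulr_ge0 ?sqrtr_ge0 ?ler0n.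
have xyY : (2%:R * x * y) ^+ 2 = Y ^+ 2.
  rewrite !exprMn x2 y2; have -> : Y ^+ 2 = 1 - X ^+ 2 by rewrite -XY1; ring.
  by field.
have [Y0|Y0] := leP 0 Y.
  exists x, y; rewrite x2 y2; split; [by field | by field |].
  by apply/eqP; rewrite -(eqrXn2 (n := 2)) ?xyY.
exists x, (- y); rewrite sqrrN x2 y2; split; [by field | by field |].
apply/oppr_inj/eqP; rewrite mulrN opprK -(eqrXn2 (n := 2)) ?sqrrN ?xyY //.
by rewrite oppr_ge0 ltW.
Qed.

End HalfAngle.

Lemma lmod_rotation (K : comPzRingType) (V : lmodType K) (A B a b : K) (u v : V) :
  (A * a + B * b) *: u - (B * a - A * b) *: v =
  (a * A) *: u + (A * b) *: v + (- ((a * B) *: v) + (B * b) *: u).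
Proof.
rewrite scalerDl scalerBl ![a * _]mulrC opprB addrACA.
by rewrite [X in _ = _ + X]addrC.
Qed.

Section SpinGeneration.
Variables (R : realType) (n d : nat).
Local Notation C := R[i].
Variable c : 'I_n -> 'M[C]_d.
Hypothesis c_clifford : is_clifford c.

Definition real_coef (x : R) : C := x%:C%C.
Local Notation rc := real_coef.

Lemma rcM a b : rc (a * b) = rc a * rc b. Proof. exact: rmorphM. Qed.
Lemma rcD a b : rc (a + b) = rc a + rc b. Proof. exact: rmorphD. Qed.
Lemma rcN a : rc (- a) = - rc a. Proof. exact: rmorphN. Qed.
Lemma rc1 : rc 1 = 1. Proof. by []. Qed.
Lemma rc0 : rc 0 = 0. Proof. by []. Qed.

Definition rotor (i j : 'I_n) (X Y : R) : 'M[C]_d :=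
  (rc X)%:M + rc Y *: (c i * c j).

Lemma in_spinM g h : in_spin c g -> in_spin c h -> in_spin c (g * h).
Proof.
move=> [vs [ev v1 ->]] [us [eu u1 ->]]; exists (vs ++ us).
rewrite size_cat oddD (negPf ev) eu big_cat; split=> // v.
by rewrite mem_cat => /orP[/v1|/u1].
Qed.

Lemma clifford_mulD (u v : 'cV[R]_n) :
  clifford_mul c (u + v) = clifford_mul c u + clifford_mul c v.
Proof. by rewrite !clifford_mulE /mxC map_mxD linearD. Qed.

Lemma clifford_mulZ a (v : 'cV[R]_n) :
  clifford_mul c (a *: v) = rc a *: clifford_mul c v.
Proof. by rewrite !clifford_mulE /mxC map_mxZ linearZ. Qed.

Lemma rotor_in_spin i j X Y : i != j -> X ^+ 2 + Y ^+ 2 = 1 -> in_spin c (rotor i j X Y).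
Proof.
(* [e_i (- X e_i + Y e_j) = X + Y e_i e_j], because [e_i^2 = -1]. *)
move=> ij XY1; exists [:: delta_mx i 0; - X *: delta_mx i 0 + Y *: delta_mx j 0].
split=> //.
  move=> v; rewrite !inE => /orP[] /eqP->.
    rewrite (bigD1 i) //= big1 ?addr0 ?mxE ?eqxx ?expr1n // => k ki.
    by rewrite mxE (negPf ki) expr0n.
  rewrite (bigD1 i) //= (bigD1 j) 1?eq_sym //= big1 ?addr0 => [|k /andP[ki kj]].
    by rewrite !mxE !eqxx [j == i]eq_sym (negPf ij) /= !(mulr0, mulr1) addr0 add0r sqrrN.
  by rewrite !mxE (negPf ki) (negPf kj) /= !mulr0 addr0 expr0n.
rewrite !big_cons big_nil mulr1 clifford_mulD !clifford_mulZ !clifford_mul_delta.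
rewrite mulrDr !scalerMr clifford_sqr //.
by rewrite /rotor rcN scaleNr scalerN opprK scalemx1.
Qed.

Lemma cliff_pair_sqr i j : i != j -> (c i * c j) * (c i * c j) = -1.
Proof.
move=> ij.
rewrite mulrA -[c i * c j * c i]mulrA [c j * c i]clifford_anti 1?eq_sym //.
by rewrite mulrN mulNr mulrA clifford_sqr // mulN1r mulNr opprK clifford_sqr.
Qed.

Lemma rotor_mul i j X Y X' Y' : i != j ->
  rotor i j X Y * rotor i j X' Y' = rotor i j (X * X' - Y * Y') (X * Y' + Y * X').
Proof.
move=> ij; have sq := cliff_pair_sqr ij.
rewrite /rotor; move: (c i * c j) sq => Q sq.
rewrite mulrDl !mulrDr !scalerMl !scalerMr sq.
have aM a (N : 'M[C]_d) : a%:M * N = a *: N by rewrite -[LHS]/(a%:M *m N) mul_scalar_mx.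
have Ma a (N : 'M[C]_d) : N * a%:M = a *: N by rewrite -[LHS]/(N *m a%:M) mul_mx_scalar.
rewrite !aM !Ma scale_scalar_mx !scalerA !rcD rcN !rcM scalerN.
rewrite -[(_ - _)%:M]scalemx1 -[(_ * _)%:M]scalemx1 !scalerDl scaleNr.
by rewrite [rc Y' * _]mulrC [X in _ + X = _]addrC addrACA.
Qed.

Lemma rotor1 i j : rotor i j 1 0 = 1.
Proof. by rewrite /rotor rc0 rc1 scale0r addr0. Qed.

Lemma rotorN1 i j : rotor i j (-1) 0 = -1.
Proof. by rewrite /rotor rc0 rcN rc1 scale0r addr0 -scalemx1 scaleN1r. Qed.

Lemma rotor_conj i j X Y : i != j -> c j * rotor i j X Y = rotor i j X (- Y) * c j.
Proof.
move=> ij; rewrite /rotor mulrDr mulrDl; congr (_ + _).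
  by rewrite -!mulmxE scalar_mxC.
rewrite scalerMr scalerMl rcN scaleNr -scalerN; congr (_ *: _).
by rewrite mulrA -mulNr -clifford_anti // eq_sym.
Qed.

Lemma rotor_cliff i j k X Y : k != i -> k != j -> GRing.comm (rotor i j X Y) (c k).
Proof.
move=> ki kj; apply: commr_sym; apply: commrD.
  by rewrite /GRing.comm -!mulmxE scalar_mxC.
apply: commZ; rewrite /GRing.comm [LHS]mulrA (clifford_anti c_clifford ki) mulNr.
by rewrite -[c i * c k * _]mulrA (clifford_anti c_clifford kj) mulrN opprK mulrA.
Qed.

Lemma rotor_rotates i j x y : i != j -> x ^+ 2 + y ^+ 2 = 1 ->
  rotor i j x y * c j =
  (rc (x ^+ 2 - y ^+ 2) *: c j - rc (2%:R * x * y) *: c i) * rotor i j x y.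
Proof.
move=> ij xy1.
have Qj : c i * c j * c j = - c i by rewrite -mulrA clifford_sqr // mulrN1.
have iQ : c i * (c i * c j) = - c j by rewrite clifford_sqrK.
have jQ : c j * (c i * c j) = c i.
  have ji : c j * c i = - (c i * c j) by rewrite clifford_anti // eq_sym.
  by rewrite mulrA ji mulNr Qj opprK.
rewrite /rotor; move: (c i * c j) Qj iQ jQ => Q Qj iQ jQ.
have aM a (N : 'M[C]_d) : a%:M * N = a *: N by rewrite -[LHS]/(a%:M *m N) mul_scalar_mx.
have Ma a (N : 'M[C]_d) : N * a%:M = a *: N by rewrite -[LHS]/(N *m a%:M) mul_mx_scalar.
rewrite mulrDl mulrBl !mulrDr !Ma aM !scalerMl !scalerMr Qj iQ jQ !scalerA !scalerN.
have hx : rc x = rc (x ^+ 2 - y ^+ 2) * rc x + rc (2%:R * x * y) * rc y.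
  rewrite -!rcM -rcD; congr (rc _).
  by rewrite -[LHS]mul1r -[X in X * _ = _]xy1; ring.
have hy : rc y = rc (2%:R * x * y) * rc x - rc (x ^+ 2 - y ^+ 2) * rc y.
  rewrite -!rcM -rcN -rcD; congr (rc _).
  by rewrite -[LHS]mul1r -[X in X * _ = _]xy1; ring.
move: (rc x) (rc y) (rc (x ^+ 2 - y ^+ 2)) (rc (2%:R * x * y)) hx hy.
move=> a b A B hx hy; have := lmod_rotation A B a b (c j) (c i).
by rewrite -hx -hy => ->; rewrite opprD opprK.
Qed.

(** Rotors in planes through o carry e_o to any unit vector, so two unit vectors have a product
    [g1 e_o g1' g2 e_o g2'] with g's made of rotors. Moving e_o past a rotor only conjugates the
    rotor, and the two e_o meet to give -1, itself a rotor. *)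
Lemma spin_generated (o : 'I_n) (k0 : 'I_n) (P : 'M[C]_d -> Prop) : k0 != o ->
  (forall g h, in_spin c g -> in_spin c h -> P g -> P h -> P (g * h)) ->
  (forall k X Y, k != o -> X ^+ 2 + Y ^+ 2 = 1 -> P (rotor k o X Y)) ->
  forall g, in_spin c g -> P g.
Proof.
move=> k0o PM Prot; pose Q g := in_spin c g /\ P g.
have QM g h : Q g -> Q h -> Q (g * h).
  by move=> [sg Pg] [sh Ph]; split; [exact: in_spinM | exact: PM].
have Qrot k X Y : k != o -> X ^+ 2 + Y ^+ 2 = 1 -> Q (rotor k o X Y).
  by move=> ko XY1; split; [exact: rotor_in_spin | exact: Prot].
have Q1 : Q 1 by rewrite -(rotor1 k0 o); apply: Qrot => //; rewrite expr1n expr0n addr0.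
have QN1 : Q (-1).
  by rewrite -(rotorN1 k0 o); apply: Qrot => //; rewrite sqrrN expr1n expr0n addr0.
(* P is assumed stable under products only, so an inverse of g is carried along, together with what
   g and the inverse become when [c o] is moved past them. *)
pose good g := exists g' h h', [/\ Q g, Q g', Q h & Q h'] /\
  [/\ g * g' = 1, g' * g = 1, c o * g = h * c o & c o * g' = h' * c o].
have goodM g1 g2 : good g1 -> good g2 -> good (g1 * g2).
  move=> [g1' [h1 [h1' [[q1 q1' qh1 qh1'] [i1 i1' o1 o1']]]]].
  move=> [g2' [h2 [h2' [[q2 q2' qh2 qh2'] [i2 i2' o2 o2']]]]].
  exists (g2' * g1'), (h1 * h2), (h2' * h1'); split; first by split; exact: QM.
  split.
  - by rewrite mulrA -[g1 * g2 * g2']mulrA i2 mulr1.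
  - by rewrite mulrA -[g2' * g1' * g1]mulrA i1' mulr1.
  - by rewrite mulrA o1 -mulrA o2 mulrA.
  - by rewrite mulrA o2' -mulrA o1' mulrA.
have good1 : good 1.
  by exists 1, 1, 1; rewrite !mulr1 !mul1r.
have goodrot k X Y : k != o -> X ^+ 2 + Y ^+ 2 = 1 -> good (rotor k o X Y).
  move=> ko XY1; have XY1' : X ^+ 2 + (- Y) ^+ 2 = 1 by rewrite sqrrN.
  exists (rotor k o X (- Y)), (rotor k o X (- Y)), (rotor k o X Y).
  split; first by split; exact: Qrot.
  have inv Z : X ^+ 2 + Z ^+ 2 = 1 -> rotor k o X Z * rotor k o X (- Z) = 1.
    move=> XZ1; rewrite (rotor_mul _ _ _ _ ko).
    have -> : X * X - Z * - Z = 1 by rewrite -XZ1; ring.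
    have -> : X * - Z + Z * X = 0 by ring.
    exact: rotor1.
  split; rewrite -?(rotor_conj _ _ ko) //; first exact: inv.
  - by have := inv _ XY1'; rewrite opprK.
  - by rewrite (rotor_conj _ _ ko) opprK.
(* As with Givens rotations, coordinates other than o are eliminated one at a time; what remains is
   e_o up to sign. *)
have to_o m (v : 'cV[R]_n) : (forall i : 'I_n, i != o -> (m <= i)%N -> v i 0 = 0) ->
    \sum_i v i 0 ^+ 2 = 1 ->
    exists2 g, good g & g * c o = clifford_mul c v * g.
  elim: m v => [|m IH] v v0 v1.
    have vE : v = v o 0 *: delta_mx o 0.
      apply/colP=> i; rewrite !mxE; have [->|io] := eqVneq i o; first by rewrite mulr1.
      by rewrite mulr0 v0.
    have : v o 0 ^+ 2 = 1.
      rewrite -v1 (bigD1 o) //= big1 ?addr0 // => i io.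
      by rewrite v0 // expr0n.
    move=> /eqP; rewrite sqrf_eq1 => /orP[] /eqP vo; rewrite vE vo.
      by exists 1; rewrite // scale1r clifford_mul_delta mulr1 mul1r.
    (* The case v = -e_o: with x = 0 and y = 1 the rotor sends e_o to [x^2 - y^2 = -1] times
       itself. *)
    exists (rotor k0 o 0 1); first by apply: goodrot => //; rewrite expr0n expr1n add0r.
    rewrite rotor_rotates //; last by rewrite expr0n expr1n add0r.
    rewrite mulr0 mul0r rc0 scale0r subr0 clifford_mulZ clifford_mul_delta.
    by rewrite expr0n expr1n sub0r.
  have [mn|mn] := ltnP m n; last first.
    by apply: IH v1 => i io mi; apply: v0 => //; have := ltn_ord i; rewrite ltnNge (leq_trans mn).
  pose k := Ordinal mn; have [ko|ko] := eqVneq k o.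
    by apply: IH v1 => i io mi; apply: v0 => //; rewrite ltn_neqAle mi andbT;
      apply: contraNneq io => mi'; rewrite -ko; apply/eqP/val_inj.
  have [vk0|vk0] := eqVneq (v k 0) 0.
    apply: IH v1 => i io; rewrite leq_eqVlt => /predU1P[mi|]; last exact: v0.
    by rewrite -vk0; congr (v _ 0); apply: val_inj.
  (* r is the length of the component of v in the plane of k and o. A rotor carries [W + r e_o] to
     v, and the induction hypothesis applies to that vector. *)
  pose r := Num.sqrt (v k 0 ^+ 2 + v o 0 ^+ 2).
  have r2 : r ^+ 2 = v k 0 ^+ 2 + v o 0 ^+ 2 by rewrite sqr_sqrtr // addr_ge0 ?sqr_ge0.
  have r0 : r != 0.
    rewrite -sqrf_eq0 r2 paddr_eq0 ?sqr_ge0 // !sqrf_eq0 negb_and vk0 //.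
  have [x [y [xy1 xo yk]]] : exists x y, [/\ x ^+ 2 + y ^+ 2 = 1,
      v o 0 / r = x ^+ 2 - y ^+ 2 & - v k 0 / r = 2%:R * x * y].
    apply: half_angle; rewrite !expr_div_n sqrrN -mulrDl addrC -r2.
    by rewrite divff // sqrf_eq0.
  pose W := \col_i (if (i == k) || (i == o) then 0 else v i 0).
  have vE : v = W + (v o 0 *: delta_mx o 0 + v k 0 *: delta_mx k 0).
    apply/colP=> i; rewrite !mxE; have [->|ik] := eqVneq i k.
      by rewrite (negPf ko) mulr0 add0r mulr1 add0r.
    by have [->|io] := eqVneq i o; rewrite ?(mulr0, mulr1, addr0, add0r).
  have gW : GRing.comm (rotor k o x y) (clifford_mul c W).
    apply: commr_sym; rewrite clifford_mulE; apply: commr_sym.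
    rewrite /cliff_vec; apply: commr_sum => i _; rewrite !mxE.
    case: ifP => [_|/norP[ik io]]; first by rewrite -[_%:C%C]/(rc 0) rc0 scale0r; exact: commr0.
    exact/commZ/rotor_cliff.
  have [||g' good' g'E] := IH (W + r *: delta_mx o 0).
  - move=> i io mi; rewrite !mxE (negPf io) mulr0 addr0; case: ifP => // /norP[ik _].
    apply: v0 => //; rewrite ltn_neqAle mi andbT; apply: contraNneq ik => mi'.
    exact/eqP/val_inj.
  - rewrite -v1 [RHS](bigD1 o) //= [LHS](bigD1 o) //= [X in _ + X = _](bigD1 k) //=.
    rewrite [X in _ = _ + X](bigD1 k) //= !mxE !eqxx (negPf ko) /= orbT.
    rewrite !(mulr0, mulr1, addr0, add0r) expr0n add0r r2 addrA [v o 0 ^+ 2 + _]addrC.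
    congr (_ + _); apply: eq_bigr => i /andP[io ik].
    by rewrite !mxE (negPf io) (negPf ik) mulr0 addr0.
  exists (rotor k o x y * g'); first by apply: goodM => //; exact: goodrot.
  rewrite -mulrA g'E mulrA [RHS]mulrA; congr (_ * g').
  rewrite {1}vE !clifford_mulD !clifford_mulZ !clifford_mul_delta mulrDr gW [RHS]mulrDl.
  congr (_ + _); rewrite scalerMr rotor_rotates // -scalerMl; congr (_ * _).
  rewrite -xo -yk scalerBr !scalerA -!rcM mulrC divfK // mulrC divfK // rcN scaleNr opprK.
  by [].
have pair (u v : 'cV[R]_n) : \sum_i u i 0 ^+ 2 = 1 -> \sum_i v i 0 ^+ 2 = 1 ->
    Q (clifford_mul c u * clifford_mul c v).
  have far (z : 'cV[R]_n) (i : 'I_n) : i != o -> (n <= i)%N -> z i 0 = 0.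
    by move=> _; rewrite leqNgt ltn_ord.
  move=> /(to_o n u (far u))[g1 [g1' [h1 [h1' [[q1 _ _ qh1'] [i1 _ _ o1']]]]] cu].
  move=> /(to_o n v (far v))[g2 [g2' [h2 [h2' [[_ q2' qh2 _] [i2 _ o2 _]]]]] cv].
  have -> : clifford_mul c u = g1 * c o * g1' by rewrite cu -mulrA i1 mulr1.
  have -> : clifford_mul c v = g2 * c o * g2' by rewrite cv -mulrA i2 mulr1.
  rewrite -[g1 * c o * g1']mulrA o1' !mulrA -[_ * c o * g2]mulrA o2 mulrA.
  rewrite -[_ * c o * c o]mulrA clifford_sqr // mulrN1.
  rewrite -[- (g1 * h1' * h2)]mulN1r.
  exact: QM _ _ (QM _ _ QN1 (QM _ _ (QM _ _ q1 qh1') qh2)) q2'.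
move=> g [vs [ev v1 ->]]; suff : Q (\prod_(v <- vs) clifford_mul c v) by case.
have [m sm] : exists m, size vs = m.*2 by exists (size vs)./2; rewrite even_halfK.
elim: m vs {ev} sm v1 => [|m IH] [|u [|v ws]] //=; first by rewrite big_nil.
rewrite doubleS => -[sm] v1; rewrite !big_cons mulrA; apply: QM.
  by apply: pair; apply: v1; rewrite !inE eqxx ?orbT.
by apply: IH => // z zws; apply: v1; rewrite !inE zws !orbT.
Qed.

End SpinGeneration.

(** * Complex structures on tensor products *)

Section TensorTorus.
Variables (R : realType).
Local Notation C := R[i].

Lemma tens_scalarl d e (a : C) : a%:M = (a%:M : 'M[C]_d) *t (1%:M : 'M[C]_e).
Proof. by rewrite -[X in X *t _]scalemx1 tensmxZl tensmx11 scalemx1. Qed.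

Lemma tens_scalarr d e (a : C) : a%:M = (1%:M : 'M[C]_d) *t (a%:M : 'M[C]_e).
Proof. by rewrite -[X in _ *t X]scalemx1 tensmxZr tensmx11 scalemx1. Qed.

Lemma tens1rM d e (A B : 'M[C]_d) :
  (A * B) *t (1%:M : 'M[C]_e) = (A *t 1%:M) * (B *t 1%:M).
Proof. by rewrite -!mulmxE tensmx_mul mulmx1. Qed.

Lemma tens1lM d e (A B : 'M[C]_e) :
  (1%:M : 'M[C]_d) *t (A * B) = (1%:M *t A) * (1%:M *t B).
Proof. by rewrite -!mulmxE tensmx_mul mulmx1. Qed.

Lemma torus_elt_cat N (s1 s2 : seq 'M[C]_N) x y :
  torus_elt (s1 ++ s2) x y = torus_elt s1 x y * torus_elt s2 x y.
Proof. by rewrite /torus_elt big_cat. Qed.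

Lemma torus_gen_cat N (s1 s2 : seq 'M[C]_N) :
  torus_gen (s1 ++ s2) = torus_gen s1 + torus_gen s2.
Proof. by rewrite /torus_gen big_cat. Qed.

Lemma torus_elt_tensl d e (s : seq 'M[C]_d) x y :
  torus_elt [seq Q *t (1%:M : 'M[C]_e) | Q <- s] x y = torus_elt s x y *t 1%:M.
Proof.
rewrite /torus_elt big_map; elim: s => [|Q s IH].
  by rewrite !big_nil -[1]/(1%:M) -[X in _ = X *t _]/(1%:M) tensmx11.
by rewrite !big_cons IH tens1rM tensmxDl -tens_scalarl tensmxZl.
Qed.

Lemma torus_gen_tensl d e (s : seq 'M[C]_d) :
  torus_gen [seq Q *t (1%:M : 'M[C]_e) | Q <- s] = torus_gen s *t 1%:M.
Proof. by rewrite /torus_gen big_map tensmx_suml. Qed.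

Lemma torus_elt_tensr d e (s : seq 'M[C]_e) x y :
  torus_elt [seq (1%:M : 'M[C]_d) *t Q | Q <- s] x y = 1%:M *t torus_elt s x y.
Proof.
rewrite /torus_elt big_map; elim: s => [|Q s IH].
  by rewrite !big_nil -[1]/(1%:M) -[X in _ = _ *t X]/(1%:M) tensmx11.
by rewrite !big_cons IH tens1lM tensmxDr -tens_scalarr tensmxZr.
Qed.

Lemma torus_gen_tensr d e (s : seq 'M[C]_e) :
  torus_gen [seq (1%:M : 'M[C]_d) *t Q | Q <- s] = 1%:M *t torus_gen s.
Proof.
rewrite /torus_gen big_map; elim: s => [|Q s IH]; first by rewrite !big_nil tensmx0.
by rewrite !big_cons IH tensmxDr.
Qed.

Definition tens_structures d e (s : seq 'M[C]_d) (t : seq 'M[C]_e) : seq 'M[C]_(d * e) :=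
  [seq Q *t 1%:M | Q <- s] ++ [seq 1%:M *t Q | Q <- t].

Lemma tens_structuresP d e (s : seq 'M[C]_d) (t : seq 'M[C]_e) :
  complex_structures s -> complex_structures t -> complex_structures (tens_structures s t).
Proof.
have N1l a b : ((-1 : 'M[C]_a) *t (1%:M : 'M[C]_b)) = -1 by rewrite tensmxNl tensmx11.
have N1r a b : ((1%:M : 'M[C]_a) *t (-1 : 'M[C]_b)) = -1 by rewrite tensmxNr tensmx11.
move=> [sqs cs] [sqt ct]; split=> [Q|Q Q']; rewrite !mem_cat.
  by case/orP=> /mapP[P PP ->]; rewrite -?tens1rM -?tens1lM ?sqs ?sqt ?N1l ?N1r.
rewrite /GRing.comm -!mulmxE.
case/orP=> /mapP[P PP ->]; case/orP=> /mapP[P' PP' ->];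
  rewrite !tensmx_mul ?mul1mx ?mulmx1 //; [have := cs _ _ PP PP' | have := ct _ _ PP PP'];
  by rewrite /GRing.comm -!mulmxE => ->.
Qed.

Lemma torus_elt_tens d e (s : seq 'M[C]_d) (t : seq 'M[C]_e) x y :
  torus_elt (tens_structures s t) x y = torus_elt s x y *t torus_elt t x y.
Proof.
rewrite /tens_structures torus_elt_cat torus_elt_tensl torus_elt_tensr -mulmxE.
by rewrite tensmx_mul mulmx1 mul1mx.
Qed.

Lemma torus_gen_tens d e (s : seq 'M[C]_d) (t : seq 'M[C]_e) :
  torus_gen (tens_structures s t) = torus_gen s *t 1%:M + 1%:M *t torus_gen t.
Proof. by rewrite /tens_structures torus_gen_cat torus_gen_tensl torus_gen_tensr. Qed.

(* The complex structure J generates rotations twice as fast as the planes of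
   its spin lift, whence its two occurrences. *)
Definition double_structure e (J : 'M[C]_e) := [:: J; J].
Definition cube_structures e (J : 'M[C]_e) : seq 'M[C]_(e * e * e) :=
  tens_structures (tens_structures (double_structure J) (double_structure J))
                  (double_structure J).

Lemma double_structureP e (J : 'M[C]_e) : J * J = -1 ->
  complex_structures (double_structure J).
Proof.
move=> J2; split=> [Q|Q Q']; rewrite !inE !orbb; first by move/eqP->.
by move=> /eqP-> /eqP->.
Qed.

Lemma torus_elt_double e (J : 'M[C]_e) x y : J * J = -1 ->
  torus_elt (double_structure J) x y = (x ^+ 2 - y ^+ 2)%:M + (2%:R * x * y) *: J.
Proof.
move=> J2; rewrite /torus_elt !big_cons big_nil mulr1 mulrDl !mulrDr.
have aM a (N : 'M[C]_e) : a%:M * N = a *: N by rewrite -[LHS]/(a%:M *m N) mul_scalar_mx.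
have Ma a (N : 'M[C]_e) : N * a%:M = a *: N by rewrite -[LHS]/(N *m a%:M) mul_mx_scalar.
rewrite !aM Ma !scalerMl !scalerMr J2 !scalerA scale_scalar_mx scalerN scalemx1.
have -> : (x ^+ 2 - y ^+ 2)%:M = (x * x)%:M - (y * y)%:M :> 'M[C]_e.
  by apply/matrixP=> i j; rewrite !mxE -mulrnBl.
have -> : (2%:R * x * y) *: J = (x * y) *: J + (x * y) *: J.
  by rewrite -scalerDl; congr (_ *: _); ring.
by rewrite [X in _ + X = _]addrC addrACA.
Qed.

Lemma torus_elt_cube e (J : 'M[C]_e) x y : J * J = -1 ->
  let g := (x ^+ 2 - y ^+ 2)%:M + (2%:R * x * y) *: J in
  torus_elt (cube_structures J) x y = g *t g *t g.
Proof. by move=> J2 g; rewrite /cube_structures !torus_elt_tens torus_elt_double. Qed.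

Lemma cube_structuresP e (J : 'M[C]_e) : J * J = -1 ->
  complex_structures (cube_structures J).
Proof. by move=> J2; do ?apply: tens_structuresP; exact: double_structureP. Qed.

Lemma torus_gen_cube e (J : 'M[C]_e) :
  torus_gen (cube_structures J) =
  2%:R *: (J *t 1%:M *t 1%:M + 1%:M *t J *t 1%:M + 1%:M *t 1%:M *t J).
Proof.
have JJ : torus_gen (double_structure J) = 2%:R *: J.
  by rewrite /torus_gen !big_cons big_nil addr0 scaler_nat mulr2n.
rewrite /cube_structures !torus_gen_tens JJ tensmxZl tensmxZr tensmxZr.
by rewrite -scalerDr tensmxZl -scalerDr tensmxDl tensmx11.
Qed.

End TensorTorus.

(** * Products of two generators of Spin(9) as signed permutations *)

Definition gperm (G : gmx) (a : nat) : nat :=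
  find (fun b => gget G b a != (0, 0)) (iota 0 16).

(** The conditions on p and e for lifting plane rotations: a fixed-point free involution, opposite
    entries at a and p a, entries of square 1, and no others. [gperm] is 16 on a zero column, which
    the first test excludes. *)
Definition gperm_ok (G : gmx) : bool :=
  all (fun a => [&& (gperm G a < 16)%N, gperm G (gperm G a) == a, gperm G a != a,
     gadd (gget G (gperm G (gperm G a)) (gperm G a)) (gget G (gperm G a) a) == (0, 0)
   & (gmul (gget G (gperm G a) a) (gget G (gperm G a) a) == (1, 0)) &&
     all (fun b => gget G b a == if b == gperm G a then gget G (gperm G a) a else (0, 0))
       (iota 0 16)])
  (iota 0 16).

(** The planes through the ninth axis serve to generate Spin(9) and so(9); the pair (6, 7), counted
    from 0, is the plane of h_4 and serves for chirality. *)
Definition good_pair (i j : nat) : bool := (i < 8)%N && (j == 8) || (i == 6) && (j == 7).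

Section PairPerm.
Variable R : realType.
Local Notation C := R[i].
Local Notation c := (@cliff9 R).

Lemma gperm_okP (G : gmx) : gperm_ok G ->
  exists (p : 'I_16 -> 'I_16) (e : 'I_16 -> C),
    [/\ involutive p, forall a, p a != a, forall a, e (p a) = - e a,
        forall a, e a * e a = 1 & gmat R 16 16 G = signed_perm_mx p e].
Proof.
move=> /allP okG; set q := gperm G.
have io (l : 'I_16) : val l \in iota 0 16 by rewrite mem_iota ltn_ord.
have ok (a : 'I_16) := okG a (io a).
have q16 (a : 'I_16) : (q a < 16)%N by have /and5P[] := ok a.
pose p a := Ordinal (q16 a); pose e (a : 'I_16) := emb R (gget G (q a) a).
exists p, e; split.
- by move=> a; apply: val_inj; have /and5P[_ /eqP] := ok a.
- by move=> a; have /and5P[_ _] := ok a.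
- move=> a; have /and5P[_ _ _ /eqP ep _] := ok a.
  by apply/eqP; rewrite -addr_eq0 /e /= -embD [gadd _ _]ep emb_int.
- move=> a; have /and5P[_ _ _ _ /andP[/eqP e1 _]] := ok a.
  by rewrite /e -embM [gmul _ _]e1 emb_int.
apply/matrixP=> b a; rewrite !mxE; have /and5P[_ _ _ _ /andP[_ /allP Gb]] := ok a.
have /eqP-> := Gb b (io b).
rewrite -[b == p a]val_eqE /=; case: eqP => _; first by rewrite mulr1.
by rewrite mulr0 emb_int.
Qed.

Lemma cliff9_pair_perm (i j : 'I_9) : good_pair i j ->
  exists (p : 'I_16 -> 'I_16) (e : 'I_16 -> C),
    [/\ involutive p, forall a, p a != a, forall a, e (p a) = - e a,
        forall a, e a * e a = 1 & c i * c j = signed_perm_mx p e].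
Proof.
have chk : all (fun i => all (fun j => good_pair i j ==>
    gperm_ok (gmulmx 16 16 16 (gcliff i) (gcliff j))) (iota 0 9)) (iota 0 9).
  by vm_compute.
move=> ij; rewrite -mulmxE !cliff9E gmatM; apply: gperm_okP.
by have := range2P chk (i := i) (j := j) (ltn_ord i) (ltn_ord j); rewrite ij.
Qed.

Lemma cliff9_pair_real i j : map_mx (@conjc R) (c i * c j) = c i * c j.
Proof.
rewrite -mulmxE map_mxM -[map_mx _ _]trmxK -/(adjmx _) adjmx_cliff9 raddfN /= cliff9_tr.
by rewrite -[map_mx _ (c j)]trmxK -/(adjmx _) adjmx_cliff9 raddfN /= cliff9_tr mulNmx mulmxN opprK.
Qed.

End PairPerm.

(** * Invariance under Spin(9) and so(9) *)

Section InvariantSpinors.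
Variable R : realType.
Local Notation C := R[i].
Local Notation c := (@cliff9 R).
Local Notation rc := (@real_coef R).

Lemma rho9_elem (i j : 'I_9) : i != j ->
  rho9 (2%:R *: elem R i.+1 j.+1) = c i * c j.
Proof.
move=> ij; rewrite /rho9 /spin_act.
have n2 : 2%:R != 0 :> C by rewrite pnatr_eq0.
have E k l : (2%:R *: elem R i.+1 j.+1) l k =
    2%:R * ((k == i) && (l == j))%:R - 2%:R * ((k == j) && (l == i))%:R.
  by rewrite !mxE !eqSS !val_eqE mulrBr [(l == j) && _]andbC [(l == i) && _]andbC.
have sumE (a b : 'I_9) (f : 'I_9 -> 'I_9 -> 'M[C]_16) :
    \sum_k \sum_l (2%:R * ((k == a) && (l == b))%:R) *: f k l = 2%:R *: f a b.
  rewrite (bigD1 a) //= [X in _ + X]big1 ?addr0 => [|k /negPf ka]; last first.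
    by apply: big1=> l _; rewrite ka mulr0 scale0r.
  rewrite (bigD1 b) //= big1 ?addr0 => [|l /negPf lb]; last by rewrite lb andbF mulr0 scale0r.
  by rewrite !eqxx mulr1.
transitivity (4%:R^-1 *: (2%:R *: (c i *m c j) - 2%:R *: (c j *m c i))).
  congr (_ *: _); rewrite -[X in X - _](sumE i j (fun k l => c k *m c l)).
  rewrite -[X in _ - X](sumE j i (fun k l => c k *m c l)).
  rewrite -sumrB; apply: eq_bigr=> k _; rewrite -sumrB; apply: eq_bigr=> l _.
  by rewrite E scalerBl.
rewrite [c j *m c i](clifford_anti (cliff9_clifford R)) 1?eq_sym // scalerN opprK.
rewrite -scalerDl scalerA; have -> : 4%:R^-1 * (2%:R + 2%:R) = 1 :> C by field.
by rewrite scale1r.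
Qed.

Lemma mxC_sigma (M : 'M[C]_16) : map_mx (@conjc R) M = M -> mxC (sigma M) = M.
Proof.
move=> /matrixP cM; apply/matrixP=> k l; have := cM k l; rewrite !mxE.
case: (M k l) => a b /= [] /eqP; rewrite eq_sym -addr_eq0 -mulr2n mulrn_eq0 /= => /eqP->.
by [].
Qed.

Lemma rotor9_real i j X Y : map_mx (@conjc R) (rotor c i j X Y) = rotor c i j X Y.
Proof.
have cr z : conjc (rc z) = rc z := conjc_real z.
rewrite /rotor map_mxD map_mxZ map_scalar_mx cliff9_pair_real; congr (_%:M + _ *: _); exact: cr.
Qed.

Lemma in_spin9_form g : in_spin c g -> preserves_form (1%:M : 'M[C]_16) g.
Proof.
apply: (in_spin_preserves_form (@cliff9_clifford R) (expr1n _ 2)) => k.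
by rewrite cliff9_tr mul1mx mulmx1 scale1r.
Qed.

Section Lift.
Variable phi : 'M[C]_16 -> 'M[C]_dim16 * 'M[C]_16.
Hypothesis phi_lift : is_spin9_lift phi.

Definition spinor_action g : 'M[C]_(dim16 * (16 * 16 * 16)) :=
  (phi g).1 *t ((phi g).2 *t (phi g).2 *t (phi g).2).

Lemma spinor_actionM g h : in_spin c g -> in_spin c h ->
  spinor_action (g *m h) = spinor_action g *m spinor_action h.
Proof.
move=> sg sh; rewrite /spinor_action !tensmx_mul.
have [_ /(_ g h sg sh)] := phi_lift; case=> ->; first by [].
by rewrite /= !(tensmxNl, tensmxNr) !opprK.
Qed.

(** [phi g] lies over the same rotations as the explicit T and g and preserves the same forms. On
    R^16, g acts by [cos 2t + sin 2t J], so its lift T has the half angle t, where x = cos t and y =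
    sin t. *)
Lemma phi_rotor (i j : 'I_9) (x y : R) (p : 'I_16 -> 'I_16) (e : 'I_16 -> C) :
  i != j -> involutive p -> (forall a, p a != a) -> (forall a, e (p a) = - e a) ->
  (forall a, e a * e a = 1) -> c i * c j = signed_perm_mx p e ->
  x ^+ 2 + y ^+ 2 = 1 ->
  let g := rotor c i j (x ^+ 2 - y ^+ 2) (2%:R * x * y) in
  let T := torus_elt (planes (@cliff16 R) p e) (rc x) (rc y) in
  ((phi g).1 = T \/ (phi g).1 = - T) /\ ((phi g).2 = g \/ (phi g).2 = - g).
Proof.
move=> ij pK pn ep e2 cJ xy1 g T.
have xy1C : rc x ^+ 2 + rc y ^+ 2 = 1 by rewrite !expr2 -!rcM -rcD -!expr2 xy1.
have XY1 : (x ^+ 2 - y ^+ 2) ^+ 2 + (2%:R * x * y) ^+ 2 = 1.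
  by transitivity ((x ^+ 2 + y ^+ 2) ^+ 2); [ring | rewrite xy1 expr1n].
have sg : in_spin c g := rotor_in_spin (@cliff9_clifford R) ij XY1.
have [s1 s2 l1 [A lg l2]] := phi_lift.1 g sg; split; last first.
  apply: (lies_over_unique _ _ (@cliff9_commutant R) _ _ lg l2) => //.
  - exact: unitmx1.
  - exact: in_spin9_form.
  - exact: in_spin9_form.
have [C0 C0u trC] := clifford_even_transpose R 8.
have trC' (k : 'I_16) : (@cliff16 R k)^T *m C0 = (-1) ^+ 8 *: (C0 *m @cliff16 R k).
  by rewrite /cliff16 trC.
have sgn2 : ((-1) ^+ 8 : C) ^+ 2 = 1 by rewrite sqrr_sign.
have gC := in_spin_preserves_form (@cliff16_clifford R) sgn2 trC' s1.
have TC : preserves_form C0 T.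
  exact: (preserves_planes (@cliff16_clifford R) pn e2 trC' sgn2 xy1C).
have gE : mxC (sigma g) = (rc x ^+ 2 - rc y ^+ 2)%:M + (2%:R * rc x * rc y) *: signed_perm_mx p e.
  rewrite mxC_sigma; last exact: rotor9_real.
  have rc2 : rc 2%:R = 2%:R by rewrite /real_coef rmorph_nat.
  by rewrite /g /rotor cJ !expr2 rcD rcN !rcM rc2.
have lT : lies_over (@cliff16 R) T (sigma g).
  move=> v; rewrite !clifford_mulE mulmxE.
  rewrite (torus_planes_cliff_vec (@cliff16_clifford R) pK pn ep e2 xy1C) -gE.
  by rewrite /mxC map_mxM.
exact: (lies_over_unique C0u _ (@cliff16_commutant R) TC gC lT l1).
Qed.

Notation spinor_rep := (tens_rep (@rho16 R) (@rho9x3 R)).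

(** The unknown signs of the two components of [phi g] combine into one overall sign. *)
Lemma spinor_action_rotor (i j : 'I_9) : i != j -> good_pair i j ->
  exists Qs : seq 'M[C]_(dim16 * (16 * 16 * 16)),
  [/\ complex_structures Qs,
      torus_gen Qs = 2%:R *: spinor_rep (2%:R *: elem R i.+1 j.+1)
    & forall x y, x ^+ 2 + y ^+ 2 = 1 ->
      let g := rotor c i j (x ^+ 2 - y ^+ 2) (2%:R * x * y) in
      spinor_action g = torus_elt Qs (rc x) (rc y) \/
      spinor_action g = - torus_elt Qs (rc x) (rc y)].
Proof.
move=> ij gij; have [p [e [pK pn ep e2 cJ]]] := cliff9_pair_perm R gij.
have J2 := cliff_pair_sqr (@cliff9_clifford R) ij.
exists (tens_structures (planes (@cliff16 R) p e) (cube_structures (c i * c j))).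
split.
- apply: tens_structuresP; last exact: cube_structuresP.
  exact: (planes_structure (@cliff16_clifford R) pK pn ep e2).
- rewrite torus_gen_tens torus_gen_cube (spin_act_planes (@cliff16_clifford R) pK pn ep).
  rewrite -cJ -(rho9_elem ij) tensmxZl tensmxZr -scalerDr.
  by [].
move=> x y xy1 g; have [p1 p2] := phi_rotor ij pK pn ep e2 cJ xy1.
rewrite torus_elt_tens torus_elt_cube // /spinor_action.
have rc2 : rc 2%:R = 2%:R by rewrite /real_coef rmorph_nat.
have <- : g = (rc x ^+ 2 - rc y ^+ 2)%:M + (2%:R * rc x * rc y) *: (c i * c j).
  by rewrite /g /rotor !expr2 rcD rcN !rcM rc2.
by case: p1 => ->; case: p2 => ->; rewrite ?(tensmxNl, tensmxNr) ?opprK; [left|right|right|left].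
Qed.

(** The rotor is the square of the one with half the angle, and squaring removes the sign. The angle
    is halved once more because torus elements use half the angle of a rotor. *)
Lemma spinor_action_rotor_fix (i j : 'I_9) X Y (psi : Spinors R) : i != j -> good_pair i j ->
  X ^+ 2 + Y ^+ 2 = 1 -> spinor_rep (elem R i.+1 j.+1) *m psi = 0 ->
  spinor_action (rotor c i j X Y) *m psi = psi.
Proof.
move=> ij gij XY1 Dpsi.
have [x' [y' [xy1' xE yE]]] := half_angle XY1.
have [x [y [xy1 x'E y'E]]] := half_angle xy1'.
have [Qs [csQs gQs TQs]] := spinor_action_rotor ij gij.
have sg : in_spin c (rotor c i j x' y') := rotor_in_spin (@cliff9_clifford R) ij xy1'.
have -> : rotor c i j X Y = rotor c i j x' y' *m rotor c i j x' y'.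
  rewrite -[RHS]/(_ * _) (rotor_mul (@cliff9_clifford R) _ _ _ _ ij) xE yE -!expr2.
  by congr (rotor c i j _ _); ring.
rewrite spinor_actionM // -mulmxA.
have xy1C : rc x ^+ 2 + rc y ^+ 2 = 1 by rewrite !expr2 -!rcM -rcD -!expr2 xy1.
have [lin _ _] := so_rep_tens (rho16_rep R) (rho9x3_rep R).
have Tpsi : torus_elt Qs (rc x) (rc y) *m psi = psi.
  rewrite -[RHS]scale1r -(expr0z (rc x + 'i * rc y)); apply: torus_elt_eigen => //.
  rewrite gQs (linear_propZ lin) -!scalemxAl Dpsi !scaler0 mulr0 scale0r.
  by [].
have := TQs x y xy1; rewrite /= -x'E -y'E => -[] ->; first by rewrite !Tpsi.
by rewrite !mulNmx !mulmxN Tpsi opprK Tpsi.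
Qed.

Lemma spinor_action_rotor_gen (i j : 'I_9) (psi : Spinors R) : i != j -> good_pair i j ->
  (forall g, in_spin c g -> spinor_action g *m psi = psi) ->
  spinor_rep (elem R i.+1 j.+1) *m psi = 0.
Proof.
move=> ij gij inv; have [Qs [csQs gQs TQs]] := spinor_action_rotor ij gij.
pose x : R := 3%:R / 5%:R; pose y : R := 4%:R / 5%:R.
have xy1 : x ^+ 2 + y ^+ 2 = 1 by rewrite /x /y; field.
have xy1C : rc x ^+ 2 + rc y ^+ 2 = 1 by rewrite !expr2 -!rcM -rcD -!expr2 xy1.
have XY1 : (x ^+ 2 - y ^+ 2) ^+ 2 + (2%:R * x * y) ^+ 2 = 1.
  by transitivity ((x ^+ 2 + y ^+ 2) ^+ 2); [ring | rewrite xy1 expr1n].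
have sg := rotor_in_spin (@cliff9_clifford R) ij XY1.
have gpsi := inv _ sg.
have TT : torus_elt Qs (rc x) (rc y) *m (torus_elt Qs (rc x) (rc y) *m psi) = psi.
  have := TQs x y xy1; move: gpsi => /=; set g := rotor _ _ _ _ _ => gpsi [] gT.
    by rewrite -gT gpsi gpsi.
  by move: gpsi; rewrite gT mulNmx => /(canRL (@opprK _)) gpsi; rewrite gpsi mulmxN gpsi opprK.
have := torus_gen_eq0 csQs xy1C (@circle_34_not_root R) TT.
have [lin _ _] := so_rep_tens (rho16_rep R) (rho9x3_rep R).
rewrite gQs (linear_propZ lin) -!scalemxAl => /eqP; rewrite !scaler_eq0 pnatr_eq0 /=.
by move/eqP.
Qed.

Lemma rep_eq0_gen d (rho : 'M[C]_9 -> 'M[C]_d) (x : 'cV[C]_d) : so_rep rho ->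
  (forall a A B, rho A *m x = 0 -> rho B *m x = 0 -> rho (a *: A + B) *m x = 0) /\
  (forall A B, skew A -> skew B -> rho A *m x = 0 -> rho B *m x = 0 ->
     rho (A *m B - B *m A) *m x = 0).
Proof.
move=> [lin br _]; split=> [a A B Ax Bx|A B skA skB Ax Bx].
  by rewrite lin mulmxDl -scalemxAl Ax Bx scaler0 addr0.
by rewrite br // mulmxBl -!mulmxA Ax Bx !mulmx0 subr0.
Qed.

(** Both directions reduce to planes through the ninth axis: their E_{k9} generate so(9), and their
    rotors generate Spin(9). *)
Lemma invariant_spinorP (x : Spinors R) :
  invariant_spinor phi x <-> forall A, skew A -> spinor_rep A *m x = 0.
Proof.
have rep := so_rep_tens (rho16_rep R) (rho9x3_rep R).
have [Plin Pbr] := rep_eq0_gen x rep.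
have good8 (k : 'I_9) : k != ord_max -> good_pair k (@ord_max 8).
  rewrite -val_eqE /= => k8; rewrite /good_pair eqxx andbT ltn_neqAle -ltnS ltn_ord andbT.
  by rewrite k8.
split=> [inv|inv].
  apply: (gen_elem9 Plin Pbr) => k k8.
  pose k' : 'I_9 := Ordinal (leqW k8).
  have k'8 : k' != ord_max by rewrite -val_eqE /= ltn_eqF.
  exact: (spinor_action_rotor_gen k'8 (good8 _ k'8) inv).
apply: (spin_generated (o := ord_max) (k0 := 0) (@cliff9_clifford R)).
- by [].
- move=> g h sg sh gx hx; change (spinor_action (g *m h) *m x = x).
  by rewrite (spinor_actionM sg sh) -mulmxA; move: hx => /= ->.
move=> k X Y k8 XY1; apply: spinor_action_rotor_fix => //; first exact: good8.
exact/inv/skew_elem.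
Qed.

End Lift.
End InvariantSpinors.

(** * Highest weight vectors in the triple tensor product *)

(* Weight coordinates on Sigma_9: the rows of gF are common left eigenvectors
   of the Cartan elements. The minus signs of the weight of row a are in the
   positions of the following subset of [{2, 3, 4}] (all other rows have a minus
   sign in position 1):  9: {},  1: {4},  2: {3},  5: {2},  10: {3,4},
   13: {2,4},  14: {2,3},  6: {2,3,4}. *)
Definition gF : gmx := gtens4 gI gI gI [:: [:: (1, 0); (0, 1)]; [:: (1, 0); (0, -1)]].
Definition gFinv : gmx := gtens4 gI gI gI [:: [:: (1, 0); (1, 0)]; [:: (0, -1); (0, 1)]].

(* Twice the weight of row a *)
Definition sign_weight (j a : nat) : int :=
  nth 0 (nth [::]
    [:: [:: -1; 1; 1; -1; -1; 1; 1; -1; -1; 1; 1; -1; -1; 1; 1; -1];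
        [:: -1; 1; 1; -1; 1; -1; -1; 1; -1; 1; 1; -1; 1; -1; -1; 1];
        [:: -1; 1; -1; 1; -1; 1; -1; 1; -1; 1; -1; 1; -1; 1; -1; 1];
        [:: 1; -1; 1; -1; -1; 1; -1; 1; -1; 1; -1; 1; 1; -1; 1; -1]] j) a.

(** The factor 4 of [grho] times the weight, which is half of [sign_weight]. *)
Definition weight_entry (j a : nat) : nat * gint := (a, (2 * sign_weight j a, 0)).

(* The nonzero entry of row a of X_k in weight coordinates *)
Definition raise_entry (k a : nat) : nat * gint :=
  match k, a with
  | 1, 5 => (7%N, (2, 0)) | 1, 6 => (4%N, (-2, 0)) | 1, 13 => (15%N, (2, 0)) | 1, 14 => (12%N, (-2, 0))
  | 2, 2 => (5%N, (0, 2)) | 2, 4 => (3%N, (0, -2)) | 2, 10 => (13%N, (0, 2)) | 2, 12 => (11%N, (0, -2))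
  | 3, 1 => (2%N, (-2, 0)) | 3, 3 => (0%N, (2, 0)) | 3, 13 => (14%N, (2, 0)) | 3, 15 => (12%N, (-2, 0))
  | 4, 0 => (8%N, (0, -1)) | 4, 2 => (10%N, (0, -1)) | 4, 5 => (13%N, (0, -1)) | 4, 7 => (15%N, (0, -1))
  | 4, 9 => (1%N, (0, 1)) | 4, 11 => (3%N, (0, 1)) | 4, 12 => (4%N, (0, 1)) | 4, 14 => (6%N, (0, 1))
  | _, _ => (0%N, (0, 0))
  end.

Definition gsparse (f : nat -> nat * gint) : gmx :=
  gtab 16 16 (fun a b => if b == (f a).1 then (f a).2 else (0, 0)).

Definition triple : Type := (nat * nat * nat)%type.

Definition in_range (t : triple) : bool := [&& t.1.1 < 16, t.1.2 < 16 & t.2 < 16]%N.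

(** One row of the action on the threefold tensor product, by the Leibniz rule, for an operator with
    a single entry per row. *)
Definition triple_terms (f : nat -> nat * gint) (t : triple) : seq (triple * gint) :=
  [:: (((f t.1.1).1, t.1.2, t.2), (f t.1.1).2);
      ((t.1.1, (f t.1.2).1, t.2), (f t.1.2).2);
      ((t.1.1, t.1.2, (f t.2).1), (f t.2).2)].

(* If all the other terms of an equation vanish, so does the term number i. *)
Definition propagate (known : seq triple) (step : nat * triple * nat) : seq triple :=
  let: (k, t, i) := step in
  let s := triple_terms (raise_entry k) t in
  if [&& (0 < k <= 4)%N, in_range t, (nth (t, (0, 0)) s i).2 != (0, 0), (i < 3)%N &
      all (fun j => (j == i) || ((nth (t, (0, 0)) s j).1 \in known) ||
                    ((nth (t, (0, 0)) s j).2 == (0, 0))) (iota 0 3)]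
  then (nth (t, (0, 0)) s i).1 :: known else known.

(* The four coordinates that determine a highest weight vector of weight
   omega_1 + omega_4, and the order in which their vanishing propagates to the
   27 coordinates of that weight *)
Definition free_coords : seq triple := [:: (14, 1, 9); (14, 9, 1); (9, 14, 1); (5, 2, 1)]%N.

Definition propagation : seq (nat * triple * nat) :=
  [:: (2, (2, 2, 1), 1); (3, (9, 13, 1), 2); (3, (1, 5, 1), 2); (3, (5, 1, 1), 2);
      (3, (13, 9, 1), 2); (3, (13, 1, 9), 1); (4, (9, 5, 2), 2); (4, (5, 9, 2), 2);
      (4, (5, 2, 9), 1); (4, (14, 9, 9), 0); (2, (9, 2, 10), 2); (2, (9, 10, 2), 2);
      (2, (1, 2, 2), 2); (2, (2, 9, 10), 2); (2, (2, 1, 2), 2); (2, (2, 10, 9), 1);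
      (2, (10, 9, 2), 2); (2, (10, 2, 9), 1); (3, (9, 1, 13), 2); (3, (1, 9, 13), 2);
      (3, (1, 13, 9), 1); (4, (9, 9, 14), 2); (4, (9, 14, 9), 1)]%N.

(** Twice omega_1 + omega_4 is (3, 1, 1, 1). *)
Definition on_weight (t : triple) : bool :=
  all (fun j => sign_weight j t.1.1 + sign_weight j t.1.2 + sign_weight j t.2
                == (if j == 0 then 3 else 1)) (iota 0 4).

Lemma gF_inv : geq 16 16 (gmulmx 16 16 16 gFinv gF) (gscalar 16 (2, 0)).
Proof. by vm_compute. Qed.

Lemma gF_cartan j : (j < 4)%N -> geq 16 16 (gmulmx 16 16 16 gF (grho (gcartan j)))
  (gmulmx 16 16 16 (gsparse (weight_entry j)) gF).
Proof.
have chk : all (fun j => geq 16 16 (gmulmx 16 16 16 gF (grho (gcartan j)))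
  (gmulmx 16 16 16 (gsparse (weight_entry j)) gF)) (iota 0 4).
  by vm_compute.
by move=> j4; move/allP: chk; apply; rewrite mem_iota.
Qed.

Lemma gF_raising k : (0 < k <= 4)%N -> geq 16 16 (gmulmx 16 16 16 gF (grho (graising k)))
  (gscalemx 16 16 (4, 0) (gmulmx 16 16 16 (gsparse (raise_entry k)) gF)).
Proof.
have chk : all (fun k => geq 16 16 (gmulmx 16 16 16 gF (grho (graising k)))
  (gscalemx 16 16 (4, 0) (gmulmx 16 16 16 (gsparse (raise_entry k)) gF))) (iota 1 4).
  by vm_compute.
by move=> k4; move/allP: chk; apply; rewrite mem_iota.
Qed.

(** The 23 steps reach all 27 triples of the weight, so highest weight vectors of this weight form a
    space of dimension at most 4. *)
Lemma propagation_complete :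
  let known := foldl propagate free_coords propagation in
  all (fun a => all (fun b => all (fun d =>
    on_weight (a, b, d) ==> ((a, b, d) \in known)) (iota 0 16)) (iota 0 16)) (iota 0 16).
Proof. by vm_compute. Qed.

Lemma raise_entry_range k a : ((raise_entry k a).1 < 16)%N.
Proof.
by case: k => [|[|[|[|[|k]]]]] //; do 16?[case: a => [|a] //].
Qed.

Section FreeFamily.
Variables (K : fieldType) (V : vectType K) (n : nat).
Implicit Type f : 'I_n -> V.

Lemma free_famP f :
  free [seq f i | i : 'I_n] <-> (forall k : 'I_n -> K, \sum_i k i *: f i = 0 -> forall i, k i = 0).
Proof.
have -> : [seq f i | i : 'I_n] = [tuple f i | i < n] by [].
split=> [/freeP H k k0 i|H].
  apply: H; rewrite -[RHS]k0; apply: eq_bigr=> j _; congr (_ *: _).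
  by rewrite -tnth_nth tnth_mktuple.
apply/freeP=> k k0 i; apply: H; rewrite -[RHS]k0; apply: eq_bigr=> j _; congr (_ *: _).
by rewrite -tnth_nth tnth_mktuple.
Qed.

Lemma span_famP f x :
  x \in <<[seq f i | i : 'I_n]>>%VS <-> exists k : 'I_n -> K, x = \sum_i k i *: f i.
Proof.
have -> : [seq f i | i : 'I_n] = [tuple f i | i < n] by [].
split=> [xs|[k ->]].
  exists (fun i => coord [tuple f i | i < n] i x); rewrite {1}(coord_span xs).
  by apply: eq_bigr=> i _; rewrite -tnth_nth tnth_mktuple.
apply: memv_suml => i _; apply/memvZ/memv_span.
by apply/tnthP; exists i; rewrite tnth_mktuple.
Qed.

(** A dimension count for a subspace given as a predicate: the n forms separate it, so the matrix of
    their values on n independent vectors is invertible. *)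
Lemma free_spans_by_forms (P : V -> Prop) (phi : 'I_n -> V -> K) f :
  (forall i, scalar (phi i)) -> (forall a u v, P u -> P v -> P (a *: u + v)) ->
  (forall u, P u -> (forall i, phi i u = 0) -> u = 0) ->
  (forall i, P (f i)) -> (forall k : 'I_n -> K, \sum_i k i *: f i = 0 -> forall i, k i = 0) ->
  forall u, P u -> exists k : 'I_n -> K, u = \sum_i k i *: f i.
Proof.
move=> lin PD P0 Pf free_f u Pu.
have Psum (k : 'I_n -> K) : P (\sum_i k i *: f i).
  have PZero : P 0 by rewrite -[0](addNr u) -scaleN1r; apply: PD.
  apply: (big_ind P) => // [v w Pv Pw|i _]; first by rewrite -[v]scale1r; apply: PD.
  by rewrite -[_ *: _]addr0; apply: PD.
have linr i : linear (phi i : V -> K^o) := lin i.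
have phi_sum i (k : 'I_n -> K) : phi i (\sum_j k j *: f j) = \sum_j k j * phi i (f j).
  rewrite (linear_prop_sum (linr i)); apply: eq_bigr=> j _.
  by rewrite (linear_propZ (linr i)).
pose G : 'M[K]_n := \matrix_(i, j) phi j (f i).
have Gu : G \in unitmx.
  rewrite -row_free_unit -kermx_eq0; apply/rowV0P => r /sub_kermxP rG.
  apply/rowP=> i; rewrite mxE; apply: (free_f (fun i => r 0 i)).
  apply: P0 => // j; rewrite phi_sum; have /rowP/(_ j) := rG; rewrite !mxE => {2}<-.
  by apply: eq_bigr=> l _; rewrite mxE.
pose k : 'rV_n := (\row_j phi j u) *m invmx G.
exists (fun i => k 0 i); apply/eqP; rewrite -subr_eq0; apply/eqP/P0.
  by rewrite addrC -scaleN1r; apply: PD.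
move=> j; rewrite (linear_propD (linr j)) (linear_propN (linr j)) phi_sum.
have /rowP/(_ j) : k *m G = \row_j phi j u by rewrite mulmxKV.
rewrite !mxE => <-; apply/eqP; rewrite subr_eq0; apply/eqP; apply: eq_bigr=> l _.
by rewrite [G _ _]mxE.
Qed.

End FreeFamily.

Section Multiplicity.
Variable R : realType.
Local Notation C := R[i].
Local Notation gm := (gmat R 16 16).
Local Notation F := (gmat R 16 16 gF).
Local Notation FFF := (F *t F *t F).

Lemma rho9_gmat A : rho9 (gmat R 9 9 A) = 4%:R^-1 *: gm (grho A).
Proof.
rewrite /rho9 /spin_act; congr (_ *: _).
have foldr_cons (T S : Type) (f : T -> S -> S) z x r :
  foldr f z (x :: r) = f x (foldr f z r) by [].
have term i j B : gm (grho_term A i j B) =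
    emb R (gget A j i) *: (gm (gcliff i) *m gm (gcliff j)) + gm B.
  rewrite /grho_term; case: eqP => [->|_]; first by rewrite emb_int scale0r add0r.
  by rewrite -gmatD -gmatZ gmatM.
have inner i s (r : seq nat) : gm (foldr (grho_term A i) s r) =
   \sum_(j <- r) emb R (gget A j i) *: (gm (gcliff i) *m gm (gcliff j)) + gm s.
  elim: r => [|j r IH]; first by rewrite big_nil add0r.
  by rewrite big_cons -addrA -IH foldr_cons term.
have outer (r r' : seq nat) :
    gm (foldr (fun i B => foldr (grho_term A i) B r') (gscalar 16 (0, 0)) r) =
   \sum_(i <- r) \sum_(j <- r') emb R (gget A j i) *: (gm (gcliff i) *m gm (gcliff j)).
  elim: r => [|i r IH]; last by rewrite big_cons -IH foldr_cons inner.
  by rewrite big_nil gmat_scalar emb_int -scalemx1 scale0r.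
rewrite /grho outer -[iota 0 9]/(index_iota 0 9) big_mkord; apply: eq_bigr=> i _.
by rewrite big_mkord; apply: eq_bigr=> j _; rewrite mxE !cliff9E.
Qed.

Definition coord3 (u : Sigma9x3 R) (t : triple) : C :=
  (FFF *m u) (mxtens_index (mxtens_index (inord t.1.1, inord t.1.2), inord t.2)) 0.

Lemma gsparseE (f : nat -> nat * gint) (a b : 'I_16) : ((f a).1 < 16)%N -> gm (gsparse f) a b =
  emb R (f a).2 * (b == inord (f a).1)%:R.
Proof.
move=> fa; rewrite mxE gget_tab -[b == _]val_eqE /= inordK //.
by case: eqP => _; rewrite ?mulr1 // mulr0 emb_int.
Qed.

Lemma tens3_sparse n (A B D : 'M[C]_n) (z : 'cV[C]_(n * n * n)) a b d a' b' d' x y v :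
  (forall k, A a k = x * (k == a')%:R) -> (forall k, B b k = y * (k == b')%:R) ->
  (forall k, D d k = v * (k == d')%:R) ->
  ((A *t B *t D) *m z) (mxtens_index (mxtens_index (a, b), d)) 0 =
  x * y * v * z (mxtens_index (mxtens_index (a', b'), d')) 0.
Proof.
move=> AE BE DE; rewrite mxE sum_mxtens sum_mxtens.
rewrite (bigD1 a') //= [X in _ + X]big1 ?addr0 => [|k /negPf ka]; last first.
  by apply: big1=> l _; apply: big1=> m _; rewrite !tensmxE AE ka mulr0 !mul0r.
rewrite (bigD1 b') //= [X in _ + X]big1 ?addr0 => [|k /negPf kb]; last first.
  by apply: big1=> l _; rewrite !tensmxE BE kb !mulr0 !mul0r.
rewrite (bigD1 d') //= [X in _ + X]big1 ?addr0 => [|k /negPf kd]; last first.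
  by rewrite !tensmxE DE kd !mulr0 !mul0r.
by rewrite !tensmxE AE BE DE !eqxx !mulr1.
Qed.

Lemma coord3_act (x : C) (A : 'M[C]_9) (f : nat -> nat * gint) u t :
  (forall a : nat, (a < 16)%N -> ((f a).1 < 16)%N) -> in_range t ->
  F *m rho9 A = x *: (gm (gsparse f) *m F) ->
  coord3 (rho9x3 A *m u) t =
  x * \sum_(s <- triple_terms f t) emb R s.2 * coord3 u s.1.
Proof.
move=> f16; case: t => [[a b] d] /and3P[/= a16 b16 d16]; rewrite scalemxAl => FA.
set S := x *: gm (gsparse f) in FA.
have FE : FFF *m (rho9x3 A *m u) = (S *t 1%:M *t 1%:M + 1%:M *t S *t 1%:M
    + 1%:M *t 1%:M *t S) *m (FFF *m u).
  rewrite /rho9x3; move: (rho9 A) S FA => M S FA.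
  by rewrite !mulmxA mulmxDr mulmxDr !mulmxDl !tensmx_mul FA !mulmx1 !mul1mx.
rewrite /coord3 FE !mulmxDl /triple_terms !big_cons big_nil addr0 /=.
have SE (k : nat) : (k < 16)%N -> forall l : 'I_16, S (inord k) l =
    x * emb R (f k).2 * (l == inord (f k).1)%:R.
  by move=> k16 l; rewrite mxE gsparseE inordK ?mulrA // f16.
have IE (k : 'I_16) : forall l, (1%:M : 'M[C]_16) k l = 1 * (l == k)%:R.
  by move=> l; rewrite mxE mul1r eq_sym.
rewrite mxE [X in X + _]mxE !mulrDr addrA; congr (_ + _ + _).
- by rewrite (tens3_sparse _ (SE _ a16) (IE _) (IE _)) !mulr1 mulrA.
- by rewrite (tens3_sparse _ (IE _) (SE _ b16) (IE _)) mul1r mulr1 mulrA.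
- by rewrite (tens3_sparse _ (IE _) (IE _) (SE _ d16)) !mul1r mulrA.
Qed.

Lemma coord3Z x u t : coord3 (x *: u) t = x * coord3 u t.
Proof. by rewrite /coord3 -scalemxAr mxE. Qed.

Lemma coord3_linear t : scalar (coord3^~ t).
Proof. by move=> a u v; rewrite /coord3 mulmxDr -scalemxAr mxE [X in X + _]mxE. Qed.

Lemma coord3_eq0 u : (forall t, in_range t -> coord3 u t = 0) -> u = 0.
Proof.
move=> u0; have z0 : FFF *m u = 0.
  apply/colP=> k; rewrite [RHS]mxE; case: (mxtens_indexP k) => i d.
  case: (mxtens_indexP i) => a b.
  have := u0 (val a, val b, val d); rewrite /in_range /= !ltn_ord => /(_ isT).
  by rewrite /coord3 /= !inord_val.
have inv : gm gFinv *m F = 2%:R%:M by rewrite gmatM (geqP _ gF_inv) gmat_scalar emb_int.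
have : (gm gFinv *t gm gFinv *t gm gFinv) *m (FFF *m u) = 0 by rewrite z0 mulmx0.
rewrite mulmxA !tensmx_mul inv.
have scal2 n m (x y : C) : (x%:M : 'M[C]_n) *t (y%:M : 'M[C]_m) = (x * y)%:M.
  by rewrite -[X in X *t _]scalemx1 -[X in _ *t X]scalemx1 tensmxZl tensmxZr tensmx11 scalerA scalemx1.
rewrite !scal2 mul_scalar_mx => /eqP; rewrite scaler_eq0 !mulf_eq0 pnatr_eq0 /=.
by move/eqP.
Qed.

Lemma highest_coord_weight u t :
  (forall j, rho9x3 (cartan R j) *m u = weight_1_4 R j *: u) ->
  in_range t -> ~~ on_weight t -> coord3 u t = 0.
Proof.
move=> hu tr /allPn[j]; rewrite mem_iota => /= j4 jt.
have f16 (a : nat) : (a < 16)%N -> ((weight_entry j a).1 < 16)%N by [].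
have FA : F *m rho9 (cartan R (Ordinal j4)) = 4%:R^-1 *: (gm (gsparse (weight_entry j)) *m F).
  rewrite cartanE rho9_gmat -scalemxAr !gmatM; apply: (congr1 (GRing.scale 4%:R^-1)).
  apply: (geqP R (gF_cartan j4)).
have wE : weight_1_4 R (Ordinal j4) = (if j == 0%N then 3 else 1 : int)%:~R / 2%:R.
  rewrite /weight_1_4 /fundamental_weight /= ltnS leqn0.
  by case: eqP => _; [rewrite -[3%:~R]/(3%:R : C) -[true%:R]/(1 : C); field | rewrite add0r mul1r].
have := coord3_act u f16 tr FA; rewrite hu coord3Z wE.
case: t tr jt => [[a b] d] /= tr jt.
rewrite /triple_terms !big_cons big_nil addr0 /= !emb_int -!mulrDl !rmorphM -!mulrDr.
rewrite addrA -!rmorphD; set n := _ + _ in jt *; move/eqP.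
rewrite !mulrA -subr_eq0 -mulrBl mulf_eq0 => /orP[|/eqP//].
have -> : 4%:R^-1 * 2%:~R = 2%:R^-1 :> C by field.
rewrite [X in X - _]mulrC -mulrBr mulf_eq0 invr_eq0 pnatr_eq0 /= subr_eq0 eqr_int eq_sym.
by rewrite (negPf jt).
Qed.

Lemma highest_coord_raising u k t :
  (0 < k <= 4)%N -> rho9x3 (raising R k) *m u = 0 -> in_range t ->
  \sum_(s <- triple_terms (raise_entry k) t) emb R s.2 * coord3 u s.1 = 0.
Proof.
move=> k4 ku tr.
have FA : F *m rho9 (raising R k) = 1 *: (gm (gsparse (raise_entry k)) *m F).
  rewrite scale1r raisingE rho9_gmat -scalemxAr !gmatM (geqP _ (gF_raising k4)) -gmatZ.
  by rewrite emb_int scalerA mulVf ?scale1r // pnatr_eq0.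
have := coord3_act u (fun a _ => raise_entry_range k a) tr FA.
by rewrite ku mul1r /coord3 mulmx0 mxE => <-.
Qed.

Lemma propagateP u known step :
  (forall k, (0 < k <= 4)%N -> rho9x3 (raising R k) *m u = 0) ->
  (forall t, t \in known -> coord3 u t = 0) ->
  forall t, t \in propagate known step -> coord3 u t = 0.
Proof.
move=> Xu known0; case: step => [[k t] i]; rewrite /propagate; set s := triple_terms _ _.
case: ifP => // /and5P[k4 tr si i3 /allP other] t'.
rewrite inE => /predU1P[->|]; last exact: known0.
have := highest_coord_raising k4 (Xu k k4) tr; rewrite -/s.
rewrite (big_nth (t, (0, 0))) big_mkord (bigD1 (Ordinal i3)) //= big1 ?addr0.
  move/eqP; rewrite mulf_eq0 => /orP[|/eqP//].
  have emb0 : emb R (0, 0) = 0 by rewrite emb_int.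
  by rewrite -[X in _ == X]emb0 (inj_eq (@emb_inj R)) (negPf si).
move=> j ji; have j3 : val j \in iota 0 3 by rewrite mem_iota; exact: (ltn_ord j).
have /orP[/orP[/eqP ji'|/known0->]|/eqP->] := other _ j3; last by rewrite emb_int mul0r.
  by case/eqP: ji; apply: val_inj.
by rewrite mulr0.
Qed.

Lemma highest_eq0 u :
  (forall k, (0 < k <= 4)%N -> rho9x3 (raising R k) *m u = 0) ->
  (forall j, rho9x3 (cartan R j) *m u = weight_1_4 R j *: u) ->
  (forall t, t \in free_coords -> coord3 u t = 0) -> u = 0.
Proof.
move=> Xu hu u0; have all0 steps known : (forall t, t \in known -> coord3 u t = 0) ->
    forall t, t \in foldl propagate known steps -> coord3 u t = 0.
  elim: steps known => // st steps IH known k0; apply: IH; exact: propagateP.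
apply: coord3_eq0 => -[[a b] d] tr; have [a16 b16 d16] := and3P tr.
have [on|off] := boolP (on_weight (a, b, d)); last exact: highest_coord_weight off.
apply: (all0 propagation _ u0).
have io x : (x < 16)%N -> x \in iota 0 16 by move=> x16; rewrite mem_iota.
have := propagation_complete; cbv zeta => /allP allA; have /allP allB := allA a (io a a16).
have /allP allD := allB b (io b b16).
exact: (implyP (allD d (io d d16)) on).
Qed.

Lemma highest_weight_span (w : 'I_4 -> Sigma9x3 R) u :
  (forall p, highest_weight_vector (@rho9x3 R) (@weight_1_4 R) (w p)) ->
  free [seq w p | p : 'I_4] ->
  (forall k, (0 < k <= 4)%N -> rho9x3 (raising R k) *m u = 0) ->
  (forall j, rho9x3 (cartan R j) *m u = weight_1_4 R j *: u) ->
  exists k : 'I_4 -> C, u = \sum_p k p *: w p.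
Proof.
move=> hw /free_famP free_w Xu hu.
pose P (v : Sigma9x3 R) := (forall k, (0 < k <= 4)%N -> rho9x3 (raising R k) *m v = 0) /\
  (forall j, rho9x3 (cartan R j) *m v = weight_1_4 R j *: v).
apply: (@free_spans_by_forms _ _ _ P
  (fun p : 'I_4 => coord3^~ (nth (0, 0, 0)%N free_coords p)) w) => //.
- by move=> p; apply: coord3_linear.
- move=> a v v' [Xv hv] [Xv' hv']; split=> [k k4|j].
    by rewrite mulmxDr -scalemxAr Xv // Xv' // scaler0 addr0.
  by rewrite mulmxDr -scalemxAr hv hv' scalerDr !scalerA mulrC.
- move=> v [Xv hv] v0; apply: highest_eq0 => // t /(nthP (0, 0, 0)%N)[i i4 <-].
  exact: (v0 (Ordinal i4)).
by move=> p; have [_ Xw hp] := hw p.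
Qed.

End Multiplicity.

(** * Chirality *)

Section Volume.
Variables (R : realType) (n d : nat).
Local Notation C := R[i].
Variable c : 'I_n -> 'M[C]_d.
Hypothesis c_clifford : is_clifford c.

(** Moving [c k] through the product changes the sign at each of the n - 1 other factors. *)
Lemma volume_anticomm k : \prod_i c i * c k = (-1) ^+ n.-1 *: (c k * \prod_i c i).
Proof.
pose s i : C := if i == k then 1 else -1.
have H (r : seq 'I_n) : \prod_(i <- r) c i * c k =
    (\prod_(i <- r) s i) *: (c k * \prod_(i <- r) c i).
  elim: r => [|i r IH]; first by rewrite !big_nil mulr1 mul1r scale1r.
  rewrite !big_cons [s i * _]mulrC -scalerA -mulrA IH scalerMr; congr (_ *: _).
  rewrite !mulrA -scalerMl; congr (_ * _); rewrite /s.
  have [->|ik] := eqVneq i k; first by rewrite scale1r.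
  by rewrite (clifford_anti c_clifford ik) scaleN1r.
rewrite H; congr (_ *: _); rewrite (bigD1 k) //= {1}/s eqxx mul1r.
rewrite (eq_bigr (fun=> -1)) => [|i /negPf ik]; last by rewrite /s ik.
by rewrite prodr_const cardC1 card_ord.
Qed.

End Volume.

Lemma neq_inord67 : (inord 6 : 'I_9) != inord 7. Proof. by rewrite -val_eqE /= !inordK. Qed.

Section Chirality.
Variable R : realType.
Local Notation C := R[i].
Local Notation c := (@cliff9 R).
Local Notation c16 := (@cliff16 R).
Local Notation i7 := (inord 6 : 'I_9).
Local Notation i8 := (inord 7 : 'I_9).

Lemma cartan_plane : elem R i7.+1 i8.+1 = 'i *: cartan R ord_max.
Proof.
rewrite /cartan scalerA mulrN -expr2 sqrCi opprK scale1r !inordK //.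
Qed.

(* On a vector of weight omega_1 + omega_4 the central element -1 of Spin(9)
   acts by exp(2 pi i / 2) = -1; it also acts on Sigma_16 as the volume element,
   up to sign. *)
Lemma volume_planes (w0 : Sigma16 R) :
  in_Sigma16_minus w0 -> highest_weight_vector (@rho16 R) (@weight_1_4 R) w0 ->
  exists Qs : seq 'M[C]_dim16, [/\ complex_structures Qs,
    torus_gen Qs = 4%:R *: rho16 (elem R i7.+1 i8.+1),
    torus_elt Qs 0 1 = volume16 R & volume16 R *m volume16 R = 1%:M].
Proof.
move=> w0m [w0n _ w0h].
have g78 : good_pair i7 i8 by rewrite /good_pair !inordK.
have [p [e [pK pn ep e2 cJ]]] := cliff9_pair_perm R g78.
have cl := @cliff16_clifford R; have [lin _ _] := rho16_rep R.
have csQ := planes_structure cl pK pn ep e2.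
have gQ : torus_gen (planes c16 p e) = 4%:R *: rho16 (elem R i7.+1 i8.+1).
  rewrite (spin_act_planes cl pK pn ep) -cJ -(rho9_elem R neq_inord67).
  rewrite -[spin_act _ _]/(rho16 (2%:R *: elem R i7.+1 i8.+1)) (linear_propZ lin) scalerA.
  by rewrite -natrM.
exists (planes c16 p e).
have [W WE] : exists W, W = torus_elt (planes c16 p e) 0 1 by eexists.
(* The weight 1/2 of w_0 on h_4 gives the eigenvalue [4 i / 2 = 2 i] of [torus_gen], hence
   [i^2 = -1] for W. *)
have W0 : W *m w0 = - w0.
  have := @torus_elt_eigen _ _ (planes c16 p e) 0 1 2 w0 csQ; rewrite -WE.
  rewrite add0r mulr1 -exprnP sqrCi scaleN1r; apply.
    by rewrite expr0n expr1n add0r.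
  rewrite gQ cartan_plane (linear_propZ lin 'i (cartan R ord_max)) scalerA -scalemxAl w0h.
  rewrite scalerA; congr (_ *: _).
  by rewrite /weight_1_4 /fundamental_weight /= add0r -[2%:~R]/(2%:R : C); field.
have Wc k : W *m c16 k = - (c16 k *m W).
  have xy1 : (0 : C) ^+ 2 + 1 ^+ 2 = 1 by rewrite expr0n expr1n add0r.
  have := torus_planes_cliff cl pK pn ep e2 xy1 k.
  rewrite -WE /rotated expr0n expr1n sub0r !mulr0 !mul0r.
  by rewrite scale0r addr0 scaleN1r mulNr.
have vc k : volume16 R *m c16 k = - (c16 k *m volume16 R).
  by rewrite !mulmxE (volume_anticomm cl) -signr_odd /= expr1 scaleN1r.
(* W and the volume element anticommute with every generator and act on w_0 by -1, so [W W] and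
   [W V] are scalars fixing w_0. *)
have scal (M : 'M[C]_dim16) : (forall k, M * c16 k = c16 k * M) -> M *m w0 = w0 -> M = 1%:M.
  move=> /(@cliff16_commutant R)[a ->]; rewrite mul_scalar_mx => /eqP.
  by rewrite -subr_eq0 -[X in _ - X]scale1r -scalerBl scaler_eq0 (negPf w0n) orbF subr_eq0 => /eqP->.
have WW : W *m W = 1%:M.
  apply: scal => [k|]; last by rewrite -mulmxA W0 mulmxN W0 opprK.
  change (W *m W *m c16 k = c16 k *m (W *m W)).
  by rewrite -mulmxA (Wc k) mulmxN (mulmxA W) (Wc k) mulNmx opprK mulmxA.
have Wv : W *m volume16 R = 1%:M.
  apply: scal => [k|]; last by rewrite -mulmxA w0m mulmxN W0 opprK.
  change (W *m volume16 R *m c16 k = c16 k *m (W *m volume16 R)).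
  by rewrite -mulmxA (vc k) mulmxN (mulmxA W) (Wc k) mulNmx opprK mulmxA.
have vW : volume16 R = W by rewrite -[LHS]mul1mx -WW -mulmxA Wv mulmx1.
by split; rewrite -?WE ?vW.
Qed.

Lemma rho16_volume A : rho16 A *m volume16 R = volume16 R *m rho16 A.
Proof.
have vc k : volume16 R *m c16 k = - (c16 k *m volume16 R).
  by rewrite !mulmxE (volume_anticomm (@cliff16_clifford R)) -signr_odd /= expr1 scaleN1r.
rewrite /rho16 /spin_act -scalemxAl -scalemxAr; congr (_ *: _).
rewrite mulmx_suml mulmx_sumr; apply: eq_bigr=> i _.
rewrite mulmx_suml mulmx_sumr; apply: eq_bigr=> j _.
rewrite -scalemxAl -scalemxAr; congr (_ *: _).
have cv k : c16 k *m volume16 R = - (volume16 R *m c16 k) by rewrite vc opprK.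
by rewrite -mulmxA (cv j) mulmxN (mulmxA (c16 i)) (cv i) mulNmx opprK mulmxA.
Qed.

(** Clifford multiplication by one vector exchanges 1 - V and 1 + V, so their ranks agree; their
    product is 0 in dimension 256. *)
Lemma rank_minus : volume16 R *m volume16 R = 1%:M ->
  (\rank (1%:M - volume16 R)%R <= 128)%N.
Proof.
move=> vv; set P := 1%:M - volume16 R; set P' := 1%:M + volume16 R.
have vc : volume16 R *m c16 0 = - (c16 0 *m volume16 R).
  by rewrite !mulmxE (volume_anticomm (@cliff16_clifford R)) -signr_odd /= expr1 scaleN1r.
have cu : c16 0 \in unitmx.
  have : (- c16 0) *m c16 0 = 1%:M.
    by rewrite mulNmx mulmxE (clifford_sqr (@cliff16_clifford R)) opprK.
  by case/mulmx1_unit.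
have rP : \rank P' = \rank P.
  have E : P' *m c16 0 = c16 0 *m P.
    by rewrite /P /P' mulmxDl mulmxBr mul1mx mulmx1 vc.
  by rewrite -(mxrankMfree P' (_ : row_free (c16 0))) ?row_free_unit // E eqmxMfull // row_full_unit.
have PP : P' *m P = 0.
  by rewrite /P /P' mulmxDl !mulmxBr mul1mx !mulmx1 vv mul1mx addrA subrK subrr.
have := mxrank_mul_min P' P; rewrite PP mxrank0 rP leqn0 subn_eq0.
by rewrite addnn => r2; rewrite -leq_double; apply: leq_trans r2 _.
Qed.

End Chirality.

(** * The basis of Sigma_16^- and its dual forms *)

Lemma multi_index_table_ok : all (all multi_index_ok) multi_index_table.
Proof. by vm_compute. Qed.

Lemma multi_index_all_ok k l : multi_index_ok (multi_index k l).
Proof.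
rewrite /multi_index; have [hk|hk] := ltnP k (size multi_index_table); last first.
  by rewrite (nth_default _ hk) nth_nil.
have := all_nthP [::] multi_index_table_ok k hk => /(all_nthP [::]) row.
by have [/row|hl] := ltnP l (size (nth [::] multi_index_table k)); last rewrite nth_default.
Qed.

Section Intertwiners.
Variable R : realType.
Local Notation C := R[i].
Variables (phi : 'M[C]_16 -> 'M[C]_dim16 * 'M[C]_16) (B : 'M[C]_dim16).
Variables (w0 : Sigma16 R) (eta : nat -> nat -> 'rV[C]_dim16).
Hypothesis B_unit : B \in unitmx.
Hypothesis B_invariant : invariant_form B.
Hypothesis w0_minus : in_Sigma16_minus w0.
Hypothesis w0_highest : highest_weight_vector (@rho16 R) (@weight_1_4 R) w0.
Hypothesis eta_dual : dual_forms w0 eta.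

Local Notation V := (volume16 R).
Local Notation spinor_rep := (tens_rep (@rho16 R) (@rho9x3 R)).

Definition basis_index : finType := {k : 'I_19 & 'I_(mu k)}.

Lemma card_basis_index : #|basis_index| = 128%N.
Proof.
rewrite /basis_index card_tagged sumnE big_map big_enum /=.
under eq_bigr do rewrite card_ord.
by rewrite !big_ord_recl big_ord0.
Qed.

Implicit Types s t : basis_index.
Definition index_of t : seq nat := multi_index (tag t) (tagged t).
Definition form_of t : 'rV[C]_dim16 := eta (tag t) (tagged t).
Definition basis_vec t : Sigma16 R := lower (@rho16 R) (index_of t) w0.

Lemma form_basis s t : form_of s *m basis_vec t = (s == t)%:R%:M.
Proof.
have [E _] := eta_dual (ltn_ord (tag s)) (ltn_ord (tagged s)).
rewrite [LHS](E _ _ (ltn_ord (tag t)) (ltn_ord (tagged t))).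
have -> : (s == t) = (tag s == tag t :> nat) && (tagged s == tagged t :> nat); last by [].
case: s t {E} => k l [k' l']; rewrite /=.
have [kk|kk] := eqVneq k k'; first by subst k'; rewrite eqxx eq_Tagged.
rewrite val_eqE (negPf kk) /=; apply/negP => /eqP E.
by move/eqP: kk; apply; exact: (congr1 tag E).
Qed.

Lemma form_plus s (v : Sigma16 R) : V *m v = v -> form_of s *m v = 0.
Proof. by have [_] := eta_dual (ltn_ord (tag s)) (ltn_ord (tagged s)); apply. Qed.

Lemma lower_minus I : V *m lower (@rho16 R) I w0 = - lower (@rho16 R) I w0.
Proof.
elim: I => [|i I IH] /=; first exact: w0_minus.
by rewrite mulmxA -rho16_volume -mulmxA IH mulmxN.
Qed.

(* The 128 vectors are independent since they have dual forms, and Sigma_16^-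
   has dimension at most 128. *)
Lemma minus_basis (v : Sigma16 R) : V *m v = - v ->
  v = \sum_t (form_of t *m v) 0 0 *: basis_vec t.
Proof.
move=> Vv; have [_ [_ _ _ VV]] := volume_planes w0_minus w0_highest.
pose E := \matrix_(i < #|basis_index|) form_of (enum_val i).
pose M : 'M[C]_(dim16, #|basis_index|) := \matrix_(i, j) basis_vec (enum_val j) i 0.
have EM : E *m M = 1%:M.
  apply/matrixP=> i j; have /matrixP/(_ 0 0) := form_basis (enum_val i) (enum_val j).
  rewrite [in X in X -> _]mxE [X in _ = X -> _]mxE (inj_eq enum_val_inj) eqxx mulr1n => E1.
  by rewrite mxE [RHS]mxE -E1; apply: eq_bigr=> k _; rewrite !mxE.
have n2 : 2%:R != 0 :> C by rewrite pnatr_eq0.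
pose P := 1%:M - V.
have PM : P *m M = 2%:R *: M.
  rewrite mulmxBl mul1mx; have -> : V *m M = - M.
    apply/matrixP=> i j; have /matrixP/(_ i 0) := lower_minus (index_of (enum_val j)).
    rewrite !mxE => <-; apply: eq_bigr=> k _; rewrite !mxE //.
  by rewrite opprK scaler_nat mulr2n.
(* Transposes turn column spaces into row spaces. The columns of M lie in the image of P; as M has
   rank at least 128 and P at most 128, the images agree. *)
have MP : (M^T <= P^T)%MS.
  apply/submxP; exists (2%:R^-1 *: M^T); rewrite -scalemxAl -trmx_mul PM.
  by rewrite linearZ /= scalerA mulVf // scale1r.
have PM' : (P^T <= M^T)%MS.
  have := mxrank_leqif_sup MP; case=> _ <-; rewrite eqn_leq mxrankS //= !mxrank_tr.
  apply: leq_trans (rank_minus VV) _; rewrite -card_basis_index.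
  by have := mxrankM_maxr E M; rewrite EM mxrank1.
have [D DE] := submxP PM'.
have PE : P = M *m D^T by rewrite -[P]trmxK DE trmx_mul trmxK.
have vM : v = M *m (E *m v).
  have Pv : P *m v = 2%:R *: v by rewrite mulmxBl mul1mx Vv opprK scaler_nat mulr2n.
  have PEP : P = M *m (E *m P) by rewrite PE (mulmxA E) EM mul1mx.
  by apply: (scalerI n2); rewrite -Pv {1}PEP -!mulmxA Pv -!scalemxAr.
rewrite {1}vM; apply/colP=> i; rewrite mxE summxE.
rewrite [RHS](reindex _ (onW_bij _ (enum_val_bij _))) /=.
apply: eq_bigr=> j _; rewrite !mxE mulrC; congr (_ * _).
by apply: eq_bigr=> k _; rewrite !mxE.
Qed.

End Intertwiners.

(** * Spinors as intertwiners *)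

Section SpinorMaps.
Variable R : realType.
Local Notation C := R[i].
Variable B : 'M[C]_dim16.
Hypothesis B_unit : B \in unitmx.
Hypothesis B_invariant : invariant_form B.
Local Notation spinor_rep := (tens_rep (@rho16 R) (@rho9x3 R)).
Local Notation Hom := 'M[C]_(16 * 16 * 16, dim16).

(* B identifies Sigma_16 with its dual, so an element of the tensor product is a
   linear map from Sigma_16 to Sigma_9^3. *)
Definition spinor_map (x : Spinors R) : Hom := (unvec x)^T *m B.

Lemma spinor_map_linear : linear spinor_map.
Proof.
by move=> a x y; rewrite /spinor_map linearP linearP mulmxDl -scalemxAl.
Qed.

Lemma spinor_map_inj : injective spinor_map.
Proof.
move=> x y /(congr1 (mulmx^~ (invmx B))); rewrite /spinor_map /=.
rewrite !mulmxK // => /trmx_inj; exact: unvec_inj.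
Qed.

Definition intertwines (X : Hom) (A : 'M[C]_9) : Prop :=
  rho9x3 A *m X = X *m rho16 A.

(** Invariance of B exchanges the transposed action on Sigma_16 for minus the action, so the tensor
    product action becomes [X |-> rho9x3 A X - X rho16 A]. *)
Lemma spinor_map_intertwines x A : skew A ->
  spinor_rep A *m x = 0 <-> intertwines (spinor_map x) A.
Proof.
move=> skA; rewrite /intertwines.
have E : spinor_map (spinor_rep A *m x) = rho9x3 A *m spinor_map x - spinor_map x *m rho16 A.
  have BA : (rho16 A)^T *m B = - (B *m rho16 A) by apply/eqP; rewrite -addr_eq0 B_invariant.
  rewrite /spinor_map /tens_rep; move: BA.
  move: (rho16 A) (rho9x3 A) => M N BA.
  rewrite mulmxDl linearD /= !unvec_tens trmx1 mulmx1 mul1mx linearD /= !trmx_mul trmxK.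
  by rewrite mulmxDl -!mulmxA BA !mulmxN addrC.
split=> [x0|X].
  by apply/eqP; rewrite -subr_eq0 -E x0 (linear_prop0 spinor_map_linear).
by apply: spinor_map_inj; rewrite E X subrr (linear_prop0 spinor_map_linear).
Qed.

Variables (eta : nat -> nat -> 'rV[C]_dim16).

Definition lowering_map (w : Sigma9x3 R) : Hom :=
  \sum_(t : basis_index) lower (@rho9x3 R) (index_of t) w *m form_of eta t.

(** The inverse of B in [sharp] cancels the factor B of [spinor_map]. *)
Lemma spinor_map_psi w : spinor_map (psi B eta w) = lowering_map w.
Proof.
rewrite /psi (linear_prop_sum spinor_map_linear).
under eq_bigr do rewrite (linear_prop_sum spinor_map_linear).
rewrite sig_big_dep /=; apply: eq_big => // t _.
rewrite /spinor_map unvec_tens_col trmx_mul trmxK /sharp trmxK -mulmxA mulmxKV //.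
Qed.

Section Closure.
Variable X : Hom.

Lemma intertwines_lin a A A' : intertwines X A -> intertwines X A' ->
  intertwines X (a *: A + A').
Proof.
have [lin16 _ _] := rho16_rep R; have [lin9 _ _] := rho9x3_rep R.
rewrite /intertwines lin9 lin16; move: (rho9x3 A) (rho9x3 A') (rho16 A) (rho16 A').
move=> M M' N N' XA XA'.
by rewrite mulmxDl mulmxDr -scalemxAl -scalemxAr XA XA'.
Qed.

Lemma intertwines_bracket A A' : skew A -> skew A' ->
  intertwines X A -> intertwines X A' -> intertwines X (A *m A' - A' *m A).
Proof.
have [_ br16 _] := rho16_rep R; have [_ br9 _] := rho9x3_rep R.
move=> skA skA'; rewrite /intertwines (br9 A A' skA skA') (br16 A A' skA skA').
move: (rho9x3 A) (rho9x3 A') (rho16 A) (rho16 A') => M M' N N' XA XA'.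
by rewrite mulmxBl mulmxBr -!mulmxA XA XA' !mulmxA XA XA'.
Qed.

End Closure.
End SpinorMaps.

(** * The maps Y_I w_0 |-> Y_I w *)

Section LoweringMaps.
Variable R : realType.
Local Notation C := R[i].
Variables (w0 : Sigma16 R) (eta : nat -> nat -> 'rV[C]_dim16).
Hypothesis w0_minus : in_Sigma16_minus w0.
Hypothesis w0_highest : highest_weight_vector (@rho16 R) (@weight_1_4 R) w0.
Hypothesis eta_dual : dual_forms w0 eta.
Local Notation V := (volume16 R).
Local Notation Hom := 'M[C]_(16 * 16 * 16, dim16).
Local Notation is_highest w := (highest_weight_vector (@rho9x3 R) (@weight_1_4 R) w).

Lemma lowering_map_plus w (v : Sigma16 R) : V *m v = v -> lowering_map eta w *m v = 0.
Proof.
move=> Vv; rewrite /lowering_map mulmx_suml big1 // => t _.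
by rewrite -mulmxA (form_plus eta_dual t Vv) mulmx0.
Qed.

Lemma lowering_map_sum w (v : Sigma16 R) :
  lowering_map eta w *m v =
  \sum_t (form_of eta t *m v) 0 0 *: lower (@rho9x3 R) (index_of t) w.
Proof.
rewrite /lowering_map mulmx_suml; apply: eq_bigr=> t _.
by rewrite -mulmxA [form_of _ _ *m _]mx11_scalar mul_mx_scalar !mxE.
Qed.

(* The expansion of Y_I w0 in the basis of Sigma_16^- is a linear relation
   between the vectors Y_J w0, so it also holds for w. *)
Lemma lowering_map_lower w I : is_highest w -> multi_index_ok I ->
  lowering_map eta w *m lower (@rho16 R) I w0 = lower (@rho9x3 R) I w.
Proof.
move=> hw okI; rewrite lowering_map_sum.
pose k t := (form_of eta t *m lower (@rho16 R) I w0) 0 0.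
pose p := (1, I) :: [seq (- k t, index_of t) | t <- index_enum basis_index].
have okp : all (fun t => multi_index_ok t.2) p.
  by rewrite /= okI all_map; apply/allP=> t _; apply: multi_index_all_ok.
have comb d (rho : 'M[C]_9 -> 'M[C]_d) u : lower_comb rho p u =
    lower rho I u - \sum_t k t *: lower rho (index_of t) u.
  rewrite /lower_comb big_cons big_map scale1r -sumrN; congr (_ + _).
  by apply: eq_bigr=> t _; rewrite scaleNr.
have := lower_comb_transfer (rho16_rep R) (rho9x3_rep R) w0_highest hw okp.
rewrite -[\sum_t _]/(\sum_t k t *: lower (@rho9x3 R) (index_of t) w).
rewrite !comb => E; apply/esym/eqP; rewrite -subr_eq0; apply/eqP/E.
rewrite {1}(minus_basis w0_minus w0_highest eta_dual (lower_minus w0_minus I)).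
by rewrite subrr.
Qed.

(** Every vector is a sum of eigenvectors of the volume element, [2 v = (v + V v) + (v - V v)], and
    the Y_I w_0 span the eigenspace for -1. *)
Lemma hom_ext (X Y : Hom) :
  (forall v : Sigma16 R, V *m v = v -> X *m v = Y *m v) ->
  (forall I, multi_index_ok I ->
     X *m lower (@rho16 R) I w0 = Y *m lower (@rho16 R) I w0) -> X = Y.
Proof.
move=> plus minus; have [_ [_ _ _ VV]] := volume_planes w0_minus w0_highest.
have minus' (v : Sigma16 R) : V *m v = - v -> X *m v = Y *m v.
  move=> Vv; rewrite (minus_basis w0_minus w0_highest eta_dual Vv).
  rewrite !mulmx_sumr; apply: eq_bigr=> t _; rewrite -!scalemxAr; congr (_ *: _).
  by apply: minus; apply: multi_index_all_ok.
have n2 : 2%:R != 0 :> C by rewrite pnatr_eq0.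
have XY (v : Sigma16 R) : X *m v = Y *m v.
  apply: (scalerI n2); rewrite 2!scalemxAr.
  have -> : 2%:R *: v = (v + V *m v) + (v - V *m v).
    by rewrite addrACA subrr addr0 scaler_nat mulr2n.
  rewrite [LHS]mulmxDr [RHS]mulmxDr plus ?minus' //.
    by rewrite mulmxBr mulmxA VV mul1mx opprB.
  by rewrite mulmxDr mulmxA VV mul1mx addrC.
apply/matrixP=> i j; have /matrixP/(_ i 0) := XY (delta_mx j 0).
by rewrite -!colE !mxE.
Qed.

(** It suffices to treat X_k and Y_k, which generate. For X_k, the expansion by [raise_terms]
    depends only on the weight, which w_0 and w share. *)
Lemma lowering_map_intertwines w : is_highest w ->
  forall A, skew A -> intertwines (lowering_map eta w) A.
Proof.
move=> hw; apply: gen_raising_lowering.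
- by move=> a A A'; apply: intertwines_lin.
- by move=> A A'; apply: intertwines_bracket.
have plus A (v : Sigma16 R) : V *m v = v ->
    rho9x3 A *m lowering_map eta w *m v = lowering_map eta w *m rho16 A *m v.
  move=> Vv; rewrite -mulmxA (lowering_map_plus w Vv) mulmx0 -mulmxA lowering_map_plus //.
  by rewrite mulmxA -rho16_volume -mulmxA Vv.
move=> k hk; split; (apply: hom_ext; first by move=> v; apply: plus) => I okI.
  rewrite -mulmxA lowering_map_lower // -mulmxA.
  rewrite (raising_lower (rho9x3_rep R) hw hk okI).
  rewrite (raising_lower (rho16_rep R) w0_highest hk okI) /lower_comb mulmx_sumr.
  rewrite !big_seq; apply: eq_bigr=> t tI; rewrite -scalemxAr lowering_map_lower //.
  by have /allP/(_ _ tI) := raise_terms_ok (@weight_1_4 R) k okI.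
rewrite -mulmxA lowering_map_lower // -mulmxA.
by rewrite (lowering_map_lower (I := k :: I)) //= hk.
Qed.

End LoweringMaps.

(** * Classification of the intertwiners *)

Section Intertwiners.
Variable R : realType.
Local Notation C := R[i].
Variables (w0 : Sigma16 R) (eta : nat -> nat -> 'rV[C]_dim16).
Hypothesis w0_minus : in_Sigma16_minus w0.
Hypothesis w0_highest : highest_weight_vector (@rho16 R) (@weight_1_4 R) w0.
Hypothesis eta_dual : dual_forms w0 eta.
Local Notation V := (volume16 R).
Local Notation Hom := 'M[C]_(16 * 16 * 16, dim16).
Local Notation is_highest w := (highest_weight_vector (@rho9x3 R) (@weight_1_4 R) w).

Section Intertwiner.
Variable X : Hom.
Hypothesis X_int : forall A, skew A -> intertwines X A.

(* The central element -1 of Spin(9) acts by the volume element on Sigma_16, and by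
   -1 on the threefold tensor product. *)
Lemma intertwiner_plus (v : Sigma16 R) : V *m v = v -> X *m v = 0.
Proof.
move=> Vv; have [Qs [csQ gQ eQ _]] := volume_planes w0_minus w0_highest.
set E := elem R _ _ in gQ.
have [J JE] : exists J, J = cliff9 R (inord 6) *m cliff9 R (inord 7) by eexists.
have cl := @cliff9_clifford R.
have J2 : J * J = -1.
  by have := cliff_pair_sqr cl neq_inord67; rewrite JE mulmxE => ->.
have gJ : torus_gen (cube_structures J) = 4%:R *: rho9x3 E.
  rewrite torus_gen_cube JE mulmxE -(rho9_elem R neq_inord67) -/E.
  have [lin _ _] := rho9_rep R.
  rewrite (linear_propZ lin) /rho9x3; move: (rho9 E) => M.
  rewrite !tensmxZl !tensmxZr !tensmxZl -!scalerDr scalerA -natrM //.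
(* Each of the three tensor factors contributes [0^2 - 1^2 = -1]. *)
have eJ : torus_elt (cube_structures J) 0 1 = - 1.
  rewrite (torus_elt_cube _ _ J2) expr0n expr1n sub0r mulr0 mul0r scale0r addr0.
  have -> : (- 1 : C)%:M = - 1%:M :> 'M[C]_16 by rewrite raddfN.
  by rewrite !tensmxNl !tensmxNr opprK !tensmx11 tensmxNl tensmx11.
have XE : X *m torus_gen Qs = torus_gen (cube_structures J) *m X.
  rewrite gQ gJ -scalemxAl -scalemxAr; congr (_ *: _); apply/esym/X_int.
  exact: skew_elem.
have xy1 : (0 : C) ^+ 2 + 1 ^+ 2 = 1 by rewrite expr0n expr1n add0r.
(* On the component y of v in the piece m, [V v = v] gives [i^m y = y]. The vector X y has the same
   eigenvalue for [torus_gen (cube_structures J)], so [- X y = i^m X y = X y]. *)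
rewrite -[v]mul1mx -[1%:M](torus_decomp_sum Qs) mulmx_suml mulmx_sumr big_seq.
apply: big1 => p pQ; pose y := p.2 *m v.
have Dy : torus_gen Qs *m y = ('i * p.1%:~R) *: y.
  by rewrite /y mulmxA mulmxE (torus_gen_decomp csQ pQ) scalemxAl.
have Ey : y = (0 + 'i * 1) ^ p.1 *: y.
  rewrite -(torus_elt_eigen csQ xy1 Dy) eQ /y mulmxA.
  have -> : V *m p.2 = p.2 *m V.
    rewrite -eQ !mulmxE; apply: (comm_torus_decomp _ pQ) => Q QQs.
    by apply/commr_sym/comm_torus_elt => Q' Q'Qs; apply: csQ.2.
  by rewrite -mulmxA Vv.
have DXy : torus_gen (cube_structures J) *m (X *m y) = ('i * p.1%:~R) *: (X *m y).
  by rewrite mulmxA -XE -mulmxA Dy -scalemxAr.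
have := torus_elt_eigen (cube_structuresP J2) xy1 DXy.
rewrite eJ scalemxAr -Ey mulNmx mul1mx => /eqP.
rewrite -subr_eq0 -opprD oppr_eq0 -mulr2n -scaler_nat scaler_eq0 pnatr_eq0 /= => /eqP.
by rewrite /y.
Qed.

Lemma intertwiner_lower I :
  X *m lower (@rho16 R) I w0 = lower (@rho9x3 R) I (X *m w0).
Proof.
elim: I => //= i I <-; rewrite mulmxA -X_int ?mulmxA //; exact: skew_lowering.
Qed.

End Intertwiner.

Lemma intertwinerP (w : 'I_4 -> Sigma9x3 R) (X : Hom) :
  (forall p, is_highest (w p)) -> free [seq w p | p : 'I_4] ->
  (forall A, skew A -> intertwines X A) <->
  exists k : 'I_4 -> C, X = \sum_p k p *: lowering_map eta (w p).
Proof.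
move=> hw fw; split=> [X_int|[k ->] A skA]; last first.
  rewrite /intertwines mulmx_suml mulmx_sumr; apply: eq_bigr=> p _.
  rewrite -scalemxAl -scalemxAr; congr (_ *: _).
  exact: (lowering_map_intertwines w0_minus w0_highest eta_dual (hw p) skA).
have [_ w0X w0h] := w0_highest.
have [k kE] : exists k : 'I_4 -> C, X *m w0 = \sum_p k p *: w p.
  apply: highest_weight_span => // [k hk|j].
    by rewrite mulmxA (X_int _ (skew_raising _ k)) -mulmxA w0X // mulmx0.
  by rewrite mulmxA (X_int _ (skew_cartan _ j)) -mulmxA w0h scalemxAr.
exists k; apply: (hom_ext w0_minus w0_highest eta_dual) => [v Vv|I okI].
  rewrite (intertwiner_plus X_int Vv) mulmx_suml big1 // => p _.
  by rewrite -scalemxAl (lowering_map_plus eta_dual _ Vv) scaler0.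
rewrite (intertwiner_lower X_int) kE mulmx_suml.
transitivity (\sum_p k p *: lower (@rho9x3 R) I (w p)).
  elim: I {okI} => //= i I ->; rewrite mulmx_sumr; apply: eq_bigr=> p _.
  by rewrite -scalemxAr.
apply: eq_bigr=> p _; rewrite -scalemxAl.
by rewrite (lowering_map_lower w0_minus w0_highest eta_dual (hw p) okI).
Qed.

End Intertwiners.

Theorem theorem3p27 (R : realType)
    (phi : 'M[R[i]]_16 -> 'M[R[i]]_dim16 * 'M[R[i]]_16)
    (B : 'M[R[i]]_dim16) (w0 : Sigma16 R) (w : 'I_4 -> Sigma9x3 R)
    (eta : nat -> nat -> 'rV[R[i]]_dim16)
    (phi_lift : is_spin9_lift phi)
    (B_nondegenerate : B \in unitmx) (B_invariant : invariant_form B)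
    (w0_minus : in_Sigma16_minus w0)
    (w0_highest : highest_weight_vector (@rho16 R) (@weight_1_4 R) w0)
    (w_highest :
       forall p, highest_weight_vector (@rho9x3 R) (@weight_1_4 R) (w p))
    (w_free : free [seq w p | p : 'I_4])
    (eta_dual : dual_forms w0 eta) :
  free [seq psi B eta (w p) | p : 'I_4] /\
  (forall x : Spinors R,
     x \in <<[seq psi B eta (w p) | p : 'I_4]>>%VS <-> invariant_spinor phi x).
Proof.
have map_comb (k : 'I_4 -> R[i]) : spinor_map B (\sum_p k p *: psi B eta (w p)) =
    \sum_p k p *: lowering_map eta (w p).
  rewrite (linear_prop_sum (@spinor_map_linear R B)); apply: eq_bigr=> p _.
  by rewrite (linear_propZ (@spinor_map_linear R B)) (spinor_map_psi B_nondegenerate).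
split.
  apply/free_famP => k k0; have /free_famP := w_free; apply.
  have := map_comb k; rewrite k0 (linear_prop0 (@spinor_map_linear R B)).
  (* Evaluation at w_0, the case of the empty multi-index, recovers the combination of the w_p. *)
  move/(congr1 (mulmx^~ w0)); rewrite /= mul0mx mulmx_suml => w0E; rewrite [RHS]w0E.
  apply: eq_bigr=> p _; rewrite -scalemxAl; congr (_ *: _).
  by rewrite [RHS](lowering_map_lower (I := [::]) w0_minus w0_highest eta_dual (w_highest p)).
move=> x; rewrite span_famP (invariant_spinorP phi_lift).
have intP := intertwinerP w0_minus w0_highest eta_dual (spinor_map B x) w_highest w_free.
have mapP A (skA : skew A) := spinor_map_intertwines B_nondegenerate B_invariant x skA.
split=> [[k xE] A skA|inv].
  by apply/(mapP A skA); move: A skA; apply/intP; exists k; rewrite xE map_comb.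
have /intP[k kE] : forall A, skew A -> intertwines (spinor_map B x) A.
  by move=> A skA; apply/(mapP A skA)/inv.
exists k; apply: (spinor_map_inj B_nondegenerate); rewrite map_comb; exact: kE.
Qed.
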